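(* The following decision problem D-MAX-0-1-TMBD3B-1 is NP-complete: given a temporal graph $\mathcal{G}=(\mathcal{V},\mathcal{E})$ with lifetime $\mathcal{T}$ whose underlying graph is bipartite with every node of degree at most $3$, in which every edge is associated with a single time interval, and a positive integer $r$, does there exist a 0-1 timed matching $M$ for $\mathcal{G}$ with $|M|=r$?
   Context: A temporal graph $\mathcal{G}=(\mathcal{V},\mathcal{E})$ with lifetime $\mathcal{T}\in\mathbb{N}$ consists of a finite node set $\mathcal{V}$ and a finite set $\mathcal{E}$ of edges; each edge joins two distinct nodes (at most one edge per pair of nodes) and is associated with a nonempty list of time intervals $[s_1,f_1),\dots,[s_k,f_k)$ with integers $0\le s_1<f_1<s_2<\dots<s_k<f_k\le\mathcal{T}$; the edge exists at each integer timestep lying in one of its intervals. The underlying graph is the static graph on $\mathcal{V}$ with an edge $\{u,v\}$ for each temporal edge between $u$ and $v$. Two distinct edges overlap if they share an endpoint and there is a timestep at which both exist. A 0-1 timed matching is a subset of $\mathcal{E}$ no two of whose edges overlap. *)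

(* Defs.v *)
From HB Require Import structures.
From mathcomp Require Import all_boot all_order all_algebra.

Set Implicit Arguments.
Unset Strict Implicit.
Unset Printing Implicit Defensive.

Local Open Scope nat_scope.

(* Deterministic multi-tape Turing machines over the input alphabet {0,1}.

   Tapes are infinite to the right; cells are numbered by nat, None is the
   blank, [Some (inl b)] an input symbol, and [tm_sym] collects the extra tape
   symbols of the machine.  Tape 0 carries the input; tape 1 carries either the
   certificate (for verifiers) or the output (for transducers); the other
   tapes are work tapes. *)

Inductive move := MoveLeft | Stay | MoveRight.

Definition cell (S : finType) : finType := option (bool + S)%type.

Record tm := TM {
  tm_state : finType;
  tm_sym : finType;
  tm_work : nat;
  tm_start : tm_state;
  tm_halt : pred tm_state;
  tm_accept : pred tm_state;
  tm_trans : tm_state -> {ffun 'I_tm_work.+2 -> cell tm_sym} ->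
             tm_state * ('I_tm_work.+2 -> cell tm_sym * move)
}.

Definition tape_index (M : tm) := 'I_(tm_work M).+2.

Record config (M : tm) := Config {
  cf_state : tm_state M;
  cf_head : tape_index M -> nat;
  cf_tape : tape_index M -> nat -> cell (tm_sym M)
}.

(* A head on cell 0 that is told to move left does not move. *)
Definition shift (m : move) (h : nat) : nat :=
  match m with MoveLeft => h.-1 | Stay => h | MoveRight => h.+1 end.

Definition step (M : tm) (c : config M) : config M :=
  if tm_halt (cf_state c) then c else
  let: (q, act) :=
    tm_trans (cf_state c) [ffun i => cf_tape c i (cf_head c i)] in
  Config q
    (fun i => shift (act i).2 (cf_head c i))
    (fun i j => if j == cf_head c i then (act i).1 else cf_tape c i j).

Definition word_on_tape (S : finType) (w : seq bool) : nat -> cell S :=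
  fun j => omap inl (onth w j).

Definition init (M : tm) (x y : seq bool) : config M :=
  Config (tm_start M) (fun=> 0)
    (fun i => word_on_tape (tm_sym M)
                (if val i == 0 then x else if val i == 1 then y else [::])).

Definition run (M : tm) (t : nat) (x y : seq bool) : config M :=
  iter t (@step M) (init M x y).

Definition halts_in (M : tm) (t : nat) (x y : seq bool) : Prop :=
  tm_halt (cf_state (run M t x y)).

Definition accepts_in (M : tm) (t : nat) (x y : seq bool) : Prop :=
  halts_in M t x y /\ tm_accept (cf_state (run M t x y)).

Definition outputs_in (M : tm) (t : nat) (x z : seq bool) : Prop :=
  halts_in M t x [::] /\
  forall j, cf_tape (run M t x [::]) (inord 1) j
            = word_on_tape (tm_sym M) z j.

Definition language := seq bool -> Prop.

Definition poly_time_computable (f : seq bool -> seq bool) : Prop :=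
  exists (M : tm) (p : {poly nat}),
    forall x, outputs_in M p.[size x]%R x (f x).

Definition poly_time_reducible (A B : language) : Prop :=
  exists f, poly_time_computable f /\ forall x, A x <-> B (f x).

Definition in_NP (A : language) : Prop :=
  exists (M : tm) (p q : {poly nat}),
    (forall x y, halts_in M p.[(size x + size y)%N]%R x y) /\
    (forall x, A x <->
       exists2 y, size y <= q.[size x]%R
                & accepts_in M p.[(size x + size y)%N]%R x y).

Definition NP_hard (A : language) : Prop :=
  forall B, in_NP B -> poly_time_reducible B A.

Definition NP_complete (A : language) : Prop := in_NP A /\ NP_hard A.

(* Temporal graphs.  The pair (s, f) stands for the interval [s, f). *)

Definition valid_intervals (T : nat) (l : seq (nat * nat)) : bool :=
  [&& l != [::],
      sorted ltn (flatten [seq [:: i.1; i.2] | i <- l])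
    & all (fun i => i.2 <= T) l].

(* An edge is the set of its two endpoints; the values of [intervals] outside
   [edges] are irrelevant. *)
Record temporal_graph (V : finType) := TemporalGraph {
  lifetime : nat;
  edges : {set {set V}};
  intervals : {set V} -> seq (nat * nat);
  edges_card2 : forall e, e \in edges -> #|e| = 2;
  intervals_valid :
    forall e, e \in edges -> valid_intervals lifetime (intervals e)
}.

Section TemporalGraphs.
Variables (V : finType) (G : temporal_graph V).

Definition underlying : rel V := fun u v => [set u; v] \in edges G.

Definition bipartite (g : rel V) : Prop :=
  exists c : V -> bool, forall u v, g u v -> c u != c v.

Definition degree (g : rel V) (u : V) : nat := #|[set v | g u v]|.

Definition exists_at (e : {set V}) (t : nat) : bool :=
  has (fun i => i.1 <= t < i.2) (intervals G e).

Definition overlap (e f : {set V}) : Prop :=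
  [/\ e != f, e :&: f != set0 & exists t, exists_at e t && exists_at f t].

Definition timed_matching (M : {set {set V}}) : Prop :=
  M \subset edges G /\
  forall e f, e \in M -> f \in M -> ~ overlap e f.

End TemporalGraphs.

(* Binary strings describing instances.  All codes are self-delimiting, so
   tuples are coded by concatenation. *)

Definition enc_seq (T : Type) (enc : T -> seq bool) (s : seq T) : seq bool :=
  flatten [seq true :: enc x | x <- s] ++ [:: false].

(* Binary digits, least significant first, the last one being 1; 0 has none. *)
Definition digits (n : nat) : seq bool :=
  [seq odd (n %/ 2 ^ i) | i <- iota 0 (up_log 2 n.+1)].

Definition enc_nat (n : nat) : seq bool :=
  enc_seq (fun b => [:: b]) (digits n).

Definition enc_edge (n : nat) (G : temporal_graph 'I_n) (e : 'I_n * 'I_n) :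
    seq bool :=
  enc_nat e.1 ++ enc_nat e.2 ++
  enc_seq (fun i => enc_nat i.1 ++ enc_nat i.2)
    (intervals G [set e.1; e.2]).

(* The number of nodes is written in unary, so that codes are at least as long
   as the list of nodes; all other numbers are in binary. *)
Definition enc_instance (n : nat) (G : temporal_graph 'I_n)
    (es : seq ('I_n * 'I_n)) (r : nat) : seq bool :=
  enc_seq (fun=> [::]) (enum 'I_n) ++ enc_nat (lifetime G) ++ enc_nat r ++
  enc_seq (enc_edge G) es.

Definition lists_edges (n : nat) (G : temporal_graph 'I_n)
    (es : seq ('I_n * 'I_n)) : Prop :=
  perm_eq [seq [set e.1; e.2] | e <- es] (enum (edges G)).

(* Underlying graph bipartite of maximum degree at most 3, one interval per
   edge. *)
Definition TMBD3B_1 (V : finType) (G : temporal_graph V) : Prop :=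
  [/\ bipartite (underlying G),
      forall u, degree (underlying G) u <= 3
    & forall e, e \in edges G -> size (intervals G e) = 1].

(* The language of codes of yes-instances; the edges of an instance may be
   listed in any order, each with its endpoints in either order. *)
Definition D_MAX_01_TMBD3B_1 : language := fun w =>
  exists (n : nat) (G : temporal_graph 'I_n) (es : seq ('I_n * 'I_n))
         (r : nat),
    [/\ lists_edges G es /\ w = enc_instance G es r,
        TMBD3B_1 G,
        0 < r
      & exists M : {set {set 'I_n}}, timed_matching G M /\ #|M| = r].

(* Main.v *)
Require Import Defs.
From HB Require Import structures.
From mathcomp Require Import all_boot all_order all_algebra zify.
From Stdlib Require Import FunctionalExtensionality.

Set Implicit Arguments.
Unset Strict Implicit.
Unset Printing Implicit Defensive.

Local Open Scope nat_scope.

(* Turing machines are programmed through arithmetic terms built from bounded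
   sums and access to the bits of the two words: such a term is evaluated with
   finitely many counters of polynomial size, and a counter is the position of a
   head on a tape whose first cell is marked.  Hence the predicates and the word
   functions that these terms define are decidable, respectively computable, in
   polynomial time.

   Membership: the certificate tabulates the instance, a 2-colouring and the
   matching; the verifier encodes the tabulated instance again, compares the
   result with its input, and checks the remaining conditions, which are
   bounded-quantifier statements.

   Hardness: a computation of length [T] is described by columns, where column
   [e] at time [t] lists the cells at distance [e - Z] from the heads, so that
   the next column depends only on its neighbours and on the columns under and
   to the left of the heads.  This gives clauses of bounded width, apart from
   those on the initial row.  A variable is then represented by a cycle of edges
   that all exist at time 1, whose two maximum matchings are its truth values; a
   clause is represented by a path with one node in excess, which has to be
   matched by an edge leading to a cycle; at time 0 that edge meets only the
   cycle edges that contradict the literal.  Every node has degree at most 3,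
   regardless of the width of the clauses. *)


(** * Counter programs *)

(** A term has polynomially bounded values, since it nests a fixed number of sums over ranges that
    are themselves values. Polynomial time thus becomes a closure property, but numbers of
    exponential size cannot occur as values. The lifetime and the interval bounds are written in
    binary and may be that large, so the certificate holds them as rows of bits, which are compared
    and printed digit by digit. The reduction only prints numbers of polynomial size.

    The heads of a machine move independently, so in absolute coordinates the cells read by one
    transition may be far apart. Measuring every tape from its own head brings them into one column.

    In the gadget each edge is charged to an endpoint of one of two kinds, and edges charged to the
    same node exclude each other. The size required of the matching is the number of these nodes,
    hence each of them has to be charged, and the truth values and the clauses are read off from
    that.

    The language asks for some instance with the given code; the converse of the reduction therefore
    rests on unique readability. *)

Inductive test := TPos of nat | TNonblank of nat | TBit of nat.

Inductive cmd :=
  | Skip | Inc of nat | Dec of nat | Out of test | Accept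
  | Seq of cmd & cmd | While of test & cmd | When of test & cmd.

Lemma cmd_eq_dec (a b : cmd) : decidable (a = b).
Proof.
have dec_nat (m n : nat) : {m = n} + {m <> n} by case: (m =P n); [left | right].
have dec_test (s t : test) : {s = t} + {s <> t} by decide equality.
by rewrite /decidable; decide equality.
Qed.

HB.instance Definition _ := comparableMixin cmd_eq_dec.

Definition store := ((nat -> nat) * seq bool)%type.

Definition upd (f : nat -> nat) (r v : nat) : nat -> nat :=
  fun i => if i == r then v else f i.

(** The stack of pending commands acts as program counter. A [While] stays below its body, so that
    it is tested again; [Accept] is never removed and so becomes a halting state. *)
Definition control (tv : test -> bool) (k : seq cmd) : seq cmd :=
  match k with
  | [::] => [::]
  | Accept :: _ => k
  | Seq a b :: k => [:: a, b & k]
  | While t a :: k' => if tv t then a :: k else k'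
  | When t a :: k => if tv t then a :: k else k
  | _ :: k => k
  end.

Section Programs.

(* [tr] tells transducers from verifiers.  In a transducer tape 1 is write-only:
   [Out] appends to it and the other commands treat it as void.  Every other
   tape serves as a register whose value is the position of its head. *)
Variable tr : bool.

Local Arguments onth : simpl never.

Definition sealed (r : nat) := tr && (r == 1).

Section Semantics.
Variables (x y : seq bool).

Definition content (i j : nat) : option bool :=
  if i == 0 then onth x j else if (i == 1) && ~~ tr then onth y j else None.

Definition test_val (s : store) (t : test) : bool :=
  match t with
  | TPos r => ~~ sealed r && (0 < s.1 r)
  | TNonblank r => content r (s.1 r)
  | TBit r => content r (s.1 r) == Some true
  end.

Definition effect (k : seq cmd) (s : store) : store :=
  match k with
  | Inc r :: _ => if sealed r then s else (upd s.1 r (s.1 r).+1, s.2)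
  | Dec r :: _ => if sealed r then s else (upd s.1 r (s.1 r).-1, s.2)
  | Out t :: _ => if tr then (s.1, rcons s.2 (test_val s t)) else s
  | _ => s
  end.

Definition next (p : seq cmd * store) : seq cmd * store :=
  (control (test_val p.2) p.1, effect p.1 p.2).

(** The quantification over the continuation [k] is what makes executions compose. *)
Definition exec (c : cmd) (s : store) (t : nat) (s' : store) : Prop :=
  forall k, iter t next (c :: k, s) = (k, s').

Lemma exec_skip s : exec Skip s 1 s.
Proof. by []. Qed.

Lemma exec_inc r s : ~~ sealed r -> exec (Inc r) s 1 (upd s.1 r (s.1 r).+1, s.2).
Proof. by move=> /negbTE h k; rewrite /= /next /= h. Qed.

Lemma exec_dec r s : ~~ sealed r -> exec (Dec r) s 1 (upd s.1 r (s.1 r).-1, s.2).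
Proof. by move=> /negbTE h k; rewrite /= /next /= h. Qed.

Lemma exec_out t s : tr -> exec (Out t) s 1 (s.1, rcons s.2 (test_val s t)).
Proof. by move=> h k; rewrite /= /next /= h. Qed.

Lemma exec_seq a b s t1 s1 t2 s2 :
  exec a s t1 s1 -> exec b s1 t2 s2 -> exec (Seq a b) s (t1 + t2).+1 s2.
Proof. by move=> h1 h2 k; rewrite iterSr addnC iterD h1 h2. Qed.

Lemma exec_while_stop t a s : ~~ test_val s t -> exec (While t a) s 1 s.
Proof. by move=> /negbTE h k; rewrite /= /next /= h. Qed.

Lemma exec_while_step t a s t1 s1 t2 s2 :
  test_val s t -> exec a s t1 s1 -> exec (While t a) s1 t2 s2 ->
  exec (While t a) s (t1 + t2).+1 s2.
Proof.
move=> h h1 h2 k; rewrite iterSr addnC iterD.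
have -> : next (While t a :: k, s) = (a :: While t a :: k, s) by rewrite /next /= h.
by rewrite h1 h2.
Qed.

Lemma exec_when_stop t a s : ~~ test_val s t -> exec (When t a) s 1 s.
Proof. by move=> /negbTE h k; rewrite /= /next /= h. Qed.

Lemma exec_when_step t a s t1 s1 :
  test_val s t -> exec a s t1 s1 -> exec (When t a) s t1.+1 s1.
Proof.
move=> h h1 k; rewrite iterSr.
have -> : next (When t a :: k, s) = (a :: k, s) by rewrite /next /= h.
by rewrite h1.
Qed.

Lemma exec_eq c s t s' t' s'' :
  exec c s t s' -> t = t' -> s' = s'' -> exec c s t' s''.
Proof. by move=> h <- <-. Qed.

Lemma exec_conv c s0 t s' s s'' :
  exec c s0 t s' -> s0 = s -> s' = s'' -> exec c s t s''.
Proof. by move=> h <- <-. Qed.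

End Semantics.

(** * Realisation by Turing machines *)

(** The stack has to fit into the finite control. What lies below a subcommand is determined by its
    position in the program, so only finitely many stacks occur. *)
Fixpoint conts (c : cmd) (k : seq cmd) : seq (seq cmd) :=
  (c :: k) :: match c with
  | Seq a b => conts a (b :: k) ++ conts b k
  | While t a => conts a (c :: k)
  | When t a => conts a k
  | _ => [::]
  end.

Lemma conts_unfold c k :
  conts c k = (c :: k) :: match c with
  | Seq a b => conts a (b :: k) ++ conts b k
  | While t a => conts a (c :: k)
  | When t a => conts a k
  | _ => [::]
  end.
Proof. by case: c. Qed.

Arguments conts : simpl never.

Lemma conts_head c k : c :: k \in conts c k.
Proof. by rewrite conts_unfold mem_head. Qed.

(** Control leaves the stacks of a subcommand only through its continuation, which heads the list of
    the next subcommand or is [k] itself. *)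
Lemma conts_control c k tv k' :
  k' \in conts c k -> (control tv k' \in conts c k) || (control tv k' == k).
Proof.
elim: c k => [|r|r|t||a IHa b IHb|t a IHa|t a IHa] k;
  rewrite conts_unfold !inE ?mem_cat; try by move=> /eqP->; rewrite /= eqxx ?orbT.
- case/or3P=> [/eqP->|/IHa|/IHb].
  + by rewrite conts_head orbT.
  + case/orP=> [->|/eqP->]; first by rewrite orbT.
    by rewrite conts_head !orbT.
  + by case/orP=> ->; rewrite !orbT.
- case/orP=> [/eqP->|/IHa].
  + by rewrite /=; case: (tv t); rewrite ?conts_head ?eqxx !orbT.
  + by case/orP=> ->; rewrite ?orbT.
- case/orP=> [/eqP->|/IHa].
  + by rewrite /=; case: (tv t); rewrite ?conts_head ?eqxx !orbT.
  + by case/orP=> ->; rewrite ?orbT.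
Qed.

Definition test_reg (t : test) : nat :=
  match t with TPos r | TNonblank r | TBit r => r end.

Fixpoint max_reg (c : cmd) : nat :=
  match c with
  | Skip | Accept => 0
  | Inc r | Dec r => r
  | Out t => test_reg t
  | Seq a b => maxn (max_reg a) (max_reg b)
  | While t a | When t a => maxn (test_reg t) (max_reg a)
  end.

Lemma conts_max_reg w c k k' :
  max_reg c <= w -> all (fun d => max_reg d <= w) k -> k' \in conts c k ->
  all (fun d => max_reg d <= w) k'.
Proof.
elim: c k => [|r|r|t||a IHa b IHb|t a IHa|t a IHa] k hc hk;
  rewrite conts_unfold !inE ?mem_cat; try by move=> /eqP->; apply/andP.
- have /andP[ha hb] : (max_reg a <= w) && (max_reg b <= w).
    by rewrite -geq_max.
  by case/or3P=> [/eqP->|/IHa|/IHb]; rewrite /= ?hc ?hb //; apply; rewrite /= ?hb.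
- have /andP[ha hb] : (test_reg t <= w) && (max_reg a <= w).
    by rewrite -geq_max.
  by case/orP=> [/eqP->|/IHa]; [rewrite /= hc | apply; rewrite //= hc].
- have /andP[ha hb] : (test_reg t <= w) && (max_reg a <= w).
    by rewrite -geq_max.
  by case/orP=> [/eqP->|/IHa]; [rewrite /= hc | apply].
Qed.

Section Machine.
Variable prog : cmd.

Definition stacks := rcons (conts prog [::]) [::].
Definition mstate : finType := 'I_(size stacks).+1.
(** An extra symbol is a marked cell together with its former content, so that marking cell 0 loses
    no input bit. *)
Definition msym : finType := option bool.
Definition mwork := max_reg prog.
Definition stack_of (q : mstate) : seq cmd := nth [::] stacks q.-1.
Definition state_of (k : seq cmd) : mstate := inord (index k stacks).+1.

Definition cell_bit (c : cell msym) : option bool :=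
  match c with None => None | Some (inl b) => Some b | Some (inr o) => o end.

Definition is_marked (c : cell msym) : bool :=
  if c is Some (inr _) then true else false.

Definition read_test (rd : 'I_mwork.+2 -> cell msym) (t : test) : bool :=
  match t with
  | TPos r => ~~ sealed r && ~~ is_marked (rd (inord r))
  | TNonblank r => cell_bit (rd (inord r))
  | TBit r => cell_bit (rd (inord r)) == Some true
  end.

Definition read_act (rd : 'I_mwork.+2 -> cell msym) (k : seq cmd)
    (i : 'I_mwork.+2) : cell msym * move :=
  match k with
  | Inc r :: _ =>
      (rd i, if (i == r :> nat) && ~~ sealed r then MoveRight else Stay)
  | Dec r :: _ =>
      (rd i, if (i == r :> nat) && ~~ sealed r then MoveLeft else Stay)
  | Out t :: _ =>
      if sealed i then (Some (inl (read_test rd t)), MoveRight) else (rd i, Stay)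
  | _ => (rd i, Stay)
  end.

Definition halting (k : seq cmd) :=
  match k with [::] | Accept :: _ => true | _ => false end.

Definition accepting (k : seq cmd) :=
  match k with Accept :: _ => true | _ => false end.

(* State 0 marks cell 0 of every register tape, which makes zero testable. *)
Definition machine_trans (q : mstate) (rd : {ffun 'I_mwork.+2 -> cell msym}) :
    mstate * ('I_mwork.+2 -> cell msym * move) :=
  if q == ord0 then
    (state_of [:: prog],
     fun i : 'I_mwork.+2 => (if sealed i then rd i else Some (inr (cell_bit (rd i))), Stay))
  else (state_of (control (read_test rd) (stack_of q)),
        read_act rd (stack_of q)).

Definition machine : tm :=
  @TM mstate msym mwork ord0
    (fun q => (q != ord0) && halting (stack_of q))
    (fun q => (q != ord0) && accepting (stack_of q))
    machine_trans.

Section Simulation.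
Variables (x y : seq bool).

Definition tape_val (s : store) (i j : nat) : cell msym :=
  if sealed i then omap inl (onth s.2 j)
  else if j == 0 then Some (inr (content x y i 0))
  else omap inl (content x y i j).

Definition represents (p : seq cmd * store) (c : config machine) : Prop :=
  [/\ p.1 \in stacks, cf_state c = state_of p.1,
      forall i : 'I_mwork.+2,
        cf_head (M := machine) c i = if sealed i then size p.2.2 else p.2.1 i
    & forall (i : 'I_mwork.+2) j,
        cf_tape (M := machine) c i j = tape_val p.2 i j].

Lemma state_ofK k : k \in stacks -> stack_of (state_of k) = k.
Proof.
by move=> h; rewrite /stack_of /state_of inordK ?ltnS ?index_mem //= nth_index.
Qed.

Lemma state_of_neq0 k : k \in stacks -> state_of k != ord0.
Proof.
by move=> h; rewrite -val_eqE /= /state_of inordK ?ltnS ?index_mem.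
Qed.

Lemma control_stacks tv k : k \in stacks -> control tv k \in stacks.
Proof.
rewrite !mem_rcons !inE => /orP[/eqP->|h]; first by [].
by have /orP[->|->] := conts_control tv h; rewrite ?orbT.
Qed.

Lemma stacks_max_reg k :
  k \in stacks -> all (fun d => max_reg d <= mwork) k.
Proof.
rewrite mem_rcons inE => /orP[/eqP->//|].
exact: conts_max_reg.
Qed.

Lemma cell_bit_tape_val s i j :
  ~~ sealed i -> cell_bit (tape_val s i j) = content x y i j.
Proof.
rewrite /tape_val => /negbTE->; case: eqP => [->//|_].
by case: content.
Qed.

Lemma read_testE s (rd : 'I_mwork.+2 -> cell msym) t : test_reg t <= mwork ->
  (forall i, rd i = tape_val s i (if sealed i then size s.2 else s.1 i)) ->
  read_test rd t = test_val x y s t.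
Proof.
have hin r : r <= mwork -> nat_of_ord (inord r : 'I_mwork.+2) = r.
  by move=> h; rewrite inordK // ltnS leqW.
have hbit r : r <= mwork ->
    (forall i, rd i = tape_val s i (if sealed i then size s.2 else s.1 i)) ->
    cell_bit (rd (inord r)) = content x y r (s.1 r).
  move=> hr ->; rewrite hin //; case: ifP => hl; last first.
    by rewrite cell_bit_tape_val ?hl.
  (* The head of the output tape is behind the last symbol written and reads a blank, in agreement
     with [content]. *)
  rewrite /tape_val hl onth_default //= /content.
  by move: hl; rewrite /sealed => /andP[-> /eqP->].
case: t => r /= hr hrd; rewrite ?(hbit r) //.
rewrite hrd hin //; case: ifP => //= hl.
by rewrite /tape_val hl; case: (s.1 r) => [|n] //=; case: content.
Qed.

Lemma represents_step p c : represents p c -> represents (next x y p) (step c).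
Proof.
case: p => k s [/= hk hq hh ht].
have hk' tv := control_stacks tv hk.
rewrite /step /= hq state_of_neq0 //= state_ofK //.
case: ifP => [hal|hal].
  by rewrite /next /=; case: k hal hk hq {hk'} => [|[]].
rewrite /machine_trans (negbTE (state_of_neq0 hk)) state_ofK //.
set rd := [ffun i => _].
have hrd i : rd i = tape_val s i (if sealed i then size s.2 else s.1 i).
  by rewrite ffunE ht hh.
have htest t : test_reg t <= mwork -> read_test rd t = test_val x y s t.
  by move=> h; apply: read_testE.
have hc : control (read_test rd) k = control (test_val x y s) k.
  move: (stacks_max_reg hk); case: k {hk hk' hq hal} => [|[]] //= t a k /andP[+ _];
  by rewrite geq_max => /andP[h _]; rewrite htest.
split=> /=; first exact: hk'.
- by rewrite hc.
- move=> i; rewrite hh.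
  case: k {hk' hq hc} hk hal => [|[|r|r|t||a b|t a|t a] k] //= hk _ //.
  + case: (eqVneq (i : nat) r) => [<-|hir] /=.
      case hl: (sealed i) => /=; first by [].
      by rewrite /upd eqxx.
    by case: (sealed r); case: (sealed i) => //=; rewrite /upd (negbTE hir).
  + case: (eqVneq (i : nat) r) => [<-|hir] /=.
      case hl: (sealed i) => /=; first by [].
      by rewrite /upd eqxx.
    by case: (sealed r); case: (sealed i) => //=; rewrite /upd (negbTE hir).
  + by rewrite /sealed; case: tr; case: eqP => //=; rewrite size_rcons.
- move=> i j; rewrite hh ht.
  have hback : (if j == (if sealed i then size s.2 else s.1 i) then rd i
      else tape_val s i j) = tape_val s i j.
    by case: eqP => // ->.
  have hno s' : s'.2 = s.2 -> tape_val s' i j = tape_val s i j.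
    by rewrite /tape_val => ->.
  case: k {hk' hq hc} hk hal => [|[|r|r|t||a b|t a|t a] k] //= hk _;
    try by rewrite hback.
  + by rewrite hback; case: ifP => // _; rewrite hno.
  + by rewrite hback; case: ifP => // _; rewrite hno.
  + have /andP[hr _] := stacks_max_reg hk.
    case hl: (sealed i) => /=; last first.
      move: hback; rewrite hl => ->; case: (tr) => //.
      by rewrite /tape_val hl.
    have -> : tr by move: hl; rewrite /sealed; case: (tr).
    rewrite /tape_val hl /= -cats1 onth_cat htest //.
    case: ltngtP => // h; last by rewrite h subnn.
    by rewrite !onth_default /= ?subn_gt0 ?(ltnW h).
Qed.

Lemma represents_init : (tr -> y = [::]) ->
  represents ([:: prog], (fun=> 0, [::])) (step (init machine x y)).
Proof.
move=> hy; rewrite /step /= /machine_trans /=; split=> //=.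
- by rewrite mem_rcons inE conts_head orbT.
- by move=> i; rewrite if_same.
- move=> i j; rewrite ffunE /word_on_tape /=.
  have hword j' : omap inl (onth (if (i : nat) == 0 then x else
      if (i : nat) == 1 then y else [::]) j') =
      (if sealed i then None else omap inl (content x y i j')) :> cell msym.
    rewrite /sealed /content.
    case: eqP => [->|_]; first by rewrite /= andbF.
    case: eqP => _; last by rewrite andbF onth0n.
    by case: (tr) hy => //= hy; rewrite hy ?onth0n.
  rewrite /tape_val !hword; case: (sealed i); first by rewrite if_same onth0n.
  by case: ifP => // _; case: content.
Qed.

Lemma run_represents t : (tr -> y = [::]) ->
  represents (iter t (next x y) ([:: prog], (fun=> 0, [::])))
    (run machine t.+1 x y).
Proof.
move=> hy; elim: t => [|t IH]; first exact: represents_init.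
by rewrite iterS /run iterS; apply: represents_step.
Qed.

End Simulation.
End Machine.
End Programs.

(** * Arithmetic with bounded sums *)

(* Two words and the values of the bound variables, innermost first. *)
Definition ctx := ((seq bool * seq bool) * seq nat)%type.

Definition top (g : ctx) : nat := head 0 g.2.
Definition pop (g : ctx) : ctx := (g.1, behead g.2).
Definition push (i : nat) (g : ctx) : ctx := (g.1, i :: g.2).
Definition word (tp : bool) (g : ctx) : seq bool := if tp then g.1.2 else g.1.1.

Inductive expr :=
  | EVar | EWk of expr | EOne
  | EAdd of expr & expr | ESub of expr & expr | ESum of expr & expr
  | EBit of bool & expr | ELen of bool.

Fixpoint eval (e : expr) (g : ctx) : nat :=
  match e with
  | EVar => top g
  | EWk a => eval a (pop g)
  | EOne => 1
  | EAdd a b => eval a g + eval b g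
  | ESub a b => eval a g - eval b g
  | ESum a b => \sum_(i < eval a g) eval b (push i g)
  | EBit tp a => nth false (word tp g) (eval a g)
  | ELen tp => size (word tp g)
  end.

(** * Compilation of terms into counter programs *)

Section Compilation.
Variable tr : bool.

Definition move_reg (r r' : nat) : cmd := While (TPos r) (Seq (Dec r) (Inc r')).
Definition clear (r : nat) : cmd := While (TPos r) (Dec r).

(* [compile rho b tgt e] adds the value of [e] to register [tgt]; the variables
   live in the registers [rho], and the registers from [b] on are scratch. *)
Fixpoint compile (rho : seq nat) (b tgt : nat) (e : expr) : cmd :=
  match e with
  | EVar =>
      if rho is r :: _ then
        Seq (move_reg r b)
            (While (TPos b) (Seq (Dec b) (Seq (Inc r) (Inc tgt))))
      else Skip
  | EWk a => compile (behead rho) b tgt a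
  | EOne => Inc tgt
  | EAdd a c => Seq (compile rho b tgt a) (compile rho b tgt c)
  | ESub a c =>
      Seq (compile rho b.+2 b a)
        (Seq (compile rho b.+2 b.+1 c)
           (Seq (While (TPos b.+1) (Seq (Dec b.+1) (Dec b)))
              (move_reg b tgt)))
  | ESum a c =>
      Seq (compile rho b.+2 b a)
        (Seq (While (TPos b)
                (Seq (Dec b)
                   (Seq (compile (b.+1 :: rho) b.+2 tgt c) (Inc b.+1))))
           (clear b.+1))
  | EBit tp a =>
      Seq (compile rho b.+1 b a)
        (if tr && tp then clear b else
           Seq (move_reg b tp)
             (Seq (When (TBit tp) (Inc tgt)) (clear tp)))
  | ELen tp =>
      if tr && tp then Skip else
        Seq (While (TNonblank tp) (Seq (Inc tp) (Inc tgt))) (clear tp)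
  end.

(** Scratch registers are zero, and the heads on the two word tapes rest on cell 0, so that they can
    serve as pointers into the words. *)
Definition layout (s : store) (rho : seq nat) (b : nat) (env : seq nat) : Prop :=
  [/\ [seq s.1 r | r <- rho] = env, all (fun r => 1 < r < b) rho,
      forall r, b <= r -> s.1 r = 0, s.1 0 = 0 & ~~ tr -> s.1 1 = 0].

Lemma map_upd_notin (f : nat -> nat) r v rho :
  r \notin rho -> [seq upd f r v i | i <- rho] = [seq f i | i <- rho].
Proof.
move=> h; apply/eq_in_map => i hi; rewrite /upd; case: eqP => // e.
by move: h; rewrite -e hi.
Qed.

Lemma layout_notin s rho b env r : layout s rho b env -> b <= r -> r \notin rho.
Proof.
case=> _ /allP h _ _ _ hr; apply/negP=> /h /andP[_].
by rewrite ltnNge hr.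
Qed.

Lemma layout_upd s rho b env r v b' : layout s rho b env -> b <= b' -> 1 < r < b' ->
  r \notin rho -> layout (upd s.1 r v, s.2) rho b' env.
Proof.
case=> h1 h2 h3 h4 h5 hb /andP[hr1 hrb] hr; split=> /=.
- by rewrite map_upd_notin.
- by apply: sub_all h2 => i /andP[-> /leq_trans]; apply.
- move=> i hi; rewrite /upd; case: eqP => [?|_]; [lia | apply: h3; lia].
- by rewrite /upd; case: eqP => // ?; lia.
- by rewrite /upd; case: eqP => // ?; lia.
Qed.

Lemma layout_widen s rho b env b' : layout s rho b env -> b <= b' -> layout s rho b' env.
Proof.
case=> h1 h2 h3 h4 h5 hb; split=> //.
  by apply: sub_all h2 => i /andP[-> /leq_trans]; apply.
by move=> r hr; apply: h3; lia.
Qed.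

Lemma layout_push s rho b env r v b' : layout s rho b env -> b <= r < b' -> 1 < r ->
  layout (upd s.1 r v, s.2) (r :: rho) b' (v :: env).
Proof.
move=> h /andP[hb hb'] hr; have hn := layout_notin h hb.
have [] := @layout_upd s rho b env r v b' h; rewrite ?hr ?hb' //; first lia.
move=> /= h1 h2 h3 h4 h5; split=> //=; last by rewrite hr hb' h2.
by rewrite h1 /upd eqxx.
Qed.

Lemma layout_behead s rho b env : layout s rho b env -> layout s (behead rho) b (behead env).
Proof.
case: rho => [|r rho] [<- h2 h3 h4 h5]; split=> //=.
by case/andP: h2.
Qed.

Section Exec.
Variables (x y : seq bool).
Notation exec := (exec tr x y).

Lemma unsealed r : 1 < r -> ~~ sealed tr r.
Proof. by move=> h; rewrite /sealed; case: eqP => [?|]; [lia | rewrite andbF]. Qed.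

Lemma exec_loop t a (S : nat -> store) n T :
  (forall i, i < n -> test_val tr x y (S i) t) -> ~~ test_val tr x y (S n) t ->
  (forall i, i < n -> exists2 k, k <= T & exec a (S i) k (S i.+1)) ->
  exists2 k, k <= n * T.+1 + 1 & exec (While t a) (S 0) k (S n).
Proof.
elim: n S => [|n IH] S h1 h2 h3.
  by exists 1 => //; apply: exec_while_stop.
have [k1 hk1 e1] := h3 0 isT.
have [k2 hk2 e2] := IH (S \o succn) (fun i => h1 i.+1) h2 (fun i => h3 i.+1).
exists (k1 + k2).+1; first by rewrite mulSn; lia.
by apply: exec_while_step e1 e2; apply: h1.
Qed.

Lemma exec_countdown r a (S : nat -> store) n T s s' :
  ~~ sealed tr r -> (forall i, i <= n -> (S i).1 r = n - i) ->
  (forall i, i < n -> exists2 k, k <= T & exec a (S i) k (S i.+1)) ->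
  S 0 = s -> S n = s' ->
  exists2 k, k <= n * T.+1 + 1 & exec (While (TPos r) a) s k s'.
Proof.
move=> hl hr hs <- <-; apply: exec_loop hs => [i hi|] /=.
  by rewrite hl hr ?subn_gt0 // ltnW.
by rewrite hr // subnn andbF.
Qed.

End Exec.
End Compilation.

Ltac upd_case :=
  repeat match goal with
  | |- context [if ?i == ?i then _ else _] => rewrite eqxx
  | |- context [if ?i == ?j then _ else _] =>
      case: (i =P j) => [?|?]; first [exfalso; lia | subst i | idtac]
  end.

Ltac store_eq :=
  congr pair; apply: functional_extensionality => j; rewrite /upd /=;
  upd_case; try lia.

(** * Correctness and cost of compiled terms *)

Section CompileExec.
Variable tr : bool.
Variables (x y : seq bool).
Notation exec := (exec tr x y).


Lemma exec_move_reg s r r' : ~~ sealed tr r -> ~~ sealed tr r' -> r <> r' ->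
  exists2 k, k <= s.1 r * 4 + 1
  & exec (move_reg r r') s k
         (upd (upd s.1 r 0) r' (s.1 r' + s.1 r), s.2).
Proof.
case: s => f o /= hr hr' hne.
apply: (@exec_countdown tr x y r (Seq (Dec r) (Inc r'))
  (fun i => (upd (upd f r (f r - i)) r' (f r' + i), o)) (f r) 3) => //.
- by move=> i hi /=; rewrite /upd; upd_case.
- move=> i hi; exists 3 => //; apply: exec_eq.
    by apply: exec_seq; [apply: exec_dec | apply: exec_inc].
  + by [].
  + by store_eq.
- by store_eq.
- by store_eq.
Qed.

Lemma exec_clear s r : ~~ sealed tr r ->
  exists2 k, k <= s.1 r * 4 + 1 & exec (clear r) s k (upd s.1 r 0, s.2).
Proof.
case: s => f o /= hr.
have [||||k hk e] := @exec_countdown tr x y r (Dec r)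
  (fun i => (upd f r (f r - i), o)) (f r) 1 (f, o) (upd f r 0, o) hr.
- by move=> i hi /=; rewrite /upd; upd_case.
- move=> i hi; exists 1 => //; apply: exec_eq.
    by apply: exec_dec.
  + by [].
  + by store_eq.
- by store_eq.
- by store_eq.
- by exists k => //; apply: leq_trans hk _; lia.
Qed.

(** All costs are bounded by powers of one base, so the bound of a compound cost follows its syntax;
    this is the origin of the exponents in the [compiled] lemmas. *)
Lemma pow_add m i j a b :
  2 <= m -> a <= m ^ i -> b <= m ^ j -> a + b <= m ^ (i + j).+1.
Proof.
move=> hm ha hb; rewrite expnS expnD.
have : 0 < m ^ i by rewrite expn_gt0; lia.
have : 0 < m ^ j by rewrite expn_gt0; lia.
move=> hB hA; apply: (@leq_trans (2 * (m ^ i * m ^ j))); last by rewrite leq_mul2r hm orbT.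
by move: ha hb hA hB; move: (m ^ i) (m ^ j) => A B; nia.
Qed.

Lemma pow_mul m i j a b : a <= m ^ i -> b <= m ^ j -> a * b <= m ^ (i + j).
Proof. by rewrite expnD; apply: leq_mul. Qed.

Lemma pow_const m c : 2 <= m -> c <= m ^ c.
Proof.
by move=> hm; case: c => // c; apply: leq_trans (ltnW (ltn_expl _ (ltnSn 1))) _; rewrite leq_exp2r.
Qed.

Lemma pow_mono m i j : 2 <= m -> i <= j -> m ^ i <= m ^ j.
Proof. by move=> hm hij; rewrite leq_exp2l. Qed.


(** The value is bounded along with the time because a sum runs its body once per unit of a value.
    The base [m] is arbitrary, so that it can be raised under a sum to bound the new variable as
    well. *)
Definition compiled (e : expr) (K : nat) : Prop :=
  forall rho b tgt s env m,
  2 <= m -> size x <= m -> size y <= m -> all (fun v => v <= m) env ->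
  layout tr s rho b env -> 1 < tgt < b -> tgt \notin rho ->
  eval e ((x, y), env) <= m ^ K /\
  exists2 t, t <= m ^ K
  & exec (compile tr rho b tgt e) s t
         (upd s.1 tgt (s.1 tgt + eval e ((x, y), env)), s.2).

(** A counter is read by emptying it; its value passes through the scratch register [b] and is
    restored while it is added to [tgt]. *)
Lemma compiled_var : compiled EVar 5.
Proof.
move=> rho b tgt s env m hm hx hy henv hinv htgt htn.
case: rho hinv htn => [|r rho] hinv htn.
  case: (hinv) => <- _ _ _ _; rewrite /= /top /=; split=> //.
  exists 1; first by rewrite expn_gt0; lia.
  apply: exec_eq (exec_skip _ _ _ _) _ _ => //.
  by case: s {hinv} => f o; store_eq.
case: (hinv) => henvE /andP[hr _] hfresh _ _.
have hrt : r <> tgt by move=> e; move: htn; rewrite e inE eqxx.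
have hrm : s.1 r <= m by move: henv; rewrite -henvE => /andP[].
rewrite -henvE /= /top /=.
have hb := hfresh b (leqnn b).
have [|||k1 hk1 e1] := @exec_move_reg s r b; rewrite ?unsealed //; try lia.
have [|||||k2 hk2 e2] := @exec_countdown tr x y b
  (Seq (Dec b) (Seq (Inc r) (Inc tgt)))
  (fun i => (upd (upd (upd s.1 r i) b (s.1 r - i)) tgt (s.1 tgt + i), s.2))
  (s.1 r) 5
  (upd (upd s.1 r 0) b (s.1 b + s.1 r), s.2)
  (upd s.1 tgt (s.1 tgt + s.1 r), s.2).
- by apply: unsealed; lia.
- by move=> i hi /=; rewrite /upd; upd_case; lia.
- move=> i hi; exists 5 => //; apply: exec_eq.
    apply: exec_seq; first by apply: exec_dec; apply: unsealed; lia.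
    by apply: exec_seq; apply: exec_inc; apply: unsealed; lia.
  + by [].
  + by store_eq.
- by store_eq.
- by store_eq.
have hpow c : c <= 16 -> c * m <= m ^ 5.
  move=> hc; rewrite expnS mulnC leq_mul2l; apply/orP; right.
  by apply: leq_trans hc _; rewrite (@leq_exp2r 2 m 4).
split; first by apply: leq_trans (hpow 1 isT); lia.
exists (k1 + k2).+1; last by apply: exec_seq e1 e2.
by apply: leq_trans (hpow 16 isT); lia.
Qed.

Lemma compiled_wk a K : compiled a K -> compiled (EWk a) K.
Proof.
move=> IH rho b tgt s env m hm hx hy henv hinv htgt htn.
apply: IH => //; first by case: env henv {hinv} => //= v env /andP[].
  exact: layout_behead.
by apply: contra htn; apply: mem_behead.
Qed.

Lemma compiled_one : compiled EOne 1.
Proof.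
move=> rho b tgt s env m hm hx hy henv hinv htgt htn /=; rewrite expn1.
split; first by lia.
exists 1; first by lia.
apply: exec_eq; first by apply: exec_inc; apply: unsealed; lia.
- by [].
- by rewrite addn1.
Qed.

Lemma compiled_add a c Ka Kc :
  compiled a Ka -> compiled c Kc -> compiled (EAdd a c) ((Ka + Kc).+1 + 1).+1.
Proof.
move=> IHa IHc rho b tgt s env m hm hx hy henv hinv htgt htn.
have [va [ta hta ea]] := IHa rho b tgt s env m hm hx hy henv hinv htgt htn.
have hinva : layout tr (upd s.1 tgt (s.1 tgt + eval a (x, y, env)), s.2) rho b env.
  by apply: layout_upd hinv _ _ _.
have [vc [tc htc ec]] := IHc rho b tgt _ env m hm hx hy henv hinva htgt htn.
split=> /=.
  by apply: leq_trans (pow_add hm va vc) _; apply: pow_mono => //; lia.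
exists (ta + tc).+1; first by rewrite -addn1 !pow_add // pow_const.
apply: exec_eq; first by apply: exec_seq ea ec.
- by [].
- by store_eq.
Qed.

(** Truncated subtraction is decrementing, since a head on cell 0 does not move left. *)
Lemma compiled_sub a c Ka Kc :
  compiled a Ka -> compiled c Kc ->
  compiled (ESub a c) ((Ka + ((Kc + (5 + Ka)).+1 + (5 + Kc)).+1).+1 + 5).+1.
Proof.
move=> IHa IHc rho b tgt s env m hm hx hy henv hinv htgt htn.
have [hb hb1] : s.1 b = 0 /\ s.1 b.+1 = 0.
  by case: hinv => _ _ h _ _; split; apply: h; lia.
have hb' : 1 < b < b.+2 by lia.
have hb1' : 1 < b.+1 < b.+2 by lia.
have hn := layout_notin hinv (leqnn b); have hn1 := layout_notin hinv (leqnSn b).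
have [va [ta hta ea]] := IHa rho b.+2 b s env m hm hx hy henv
  (layout_widen hinv (leqW (leqnSn b))) hb' hn.
have hinva : layout tr (upd s.1 b (s.1 b + eval a (x, y, env)), s.2) rho b.+2 env.
  by apply: layout_upd hinv _ _ _ => //; lia.
have [vc [tc htc ec]] := IHc rho b.+2 b.+1 _ env m hm hx hy henv hinva hb1' hn1.
set A := eval a _ in va ea ec *; set C := eval c _ in vc ec *.
have [|||||k1 hk1 e1] := @exec_countdown tr x y b.+1 (Seq (Dec b.+1) (Dec b))
  (fun i => (upd (upd s.1 b (A - i)) b.+1 (C - i), s.2)) C 3
  (upd (upd s.1 b (s.1 b + A)) b.+1 (upd s.1 b (s.1 b + A) b.+1 + C), s.2)
  (upd (upd s.1 b (A - C)) b.+1 0, s.2).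
- by apply: unsealed; lia.
- by move=> i hi /=; rewrite /upd; upd_case; lia.
- move=> i hi; exists 3 => //; apply: exec_eq.
    by apply: exec_seq; apply: exec_dec; apply: unsealed; lia.
  + by [].
  + by store_eq.
- by store_eq.
- by store_eq.
have [|||k2 hk2 e2] := @exec_move_reg
  (upd (upd s.1 b (A - C)) b.+1 0, s.2) b tgt; try (by apply: unsealed; lia); first lia.
split; first by apply: leq_trans (leq_subr _ _) _; apply: leq_trans va _; apply: pow_mono => //; lia.
exists (ta + (tc + (k1 + k2).+1).+1).+1.
  (* The grouping of this sum is the one recorded in the exponent. *)
  apply: (@leq_trans (ta + ((tc + 5 * A) + 5 * C) + 5)); last first.
    rewrite !pow_add // ?pow_mul // ?pow_const //.
  move: hk2; rewrite /upd /=; upd_case; lia.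
apply: exec_eq.
  by apply: exec_seq ea _; apply: exec_seq ec _; apply: exec_seq e1 e2.
- by [].
- by rewrite /=; store_eq.
Qed.

(** The index stays below [m ^ Ka], so the body is run with base [m ^ Ka.+1], which bounds both the
    index and [m]; its cost is [m ^ (Ka.+1 * Kc)]. *)
Lemma compiled_sum a c Ka Kc :
  compiled a Ka -> compiled c Kc ->
  compiled (ESum a c) ((Ka + (Ka + ((Ka.+1 * Kc) + 10).+1)).+1 + 5).+1.
Proof.
move=> IHa IHc rho b tgt s env m hm hx hy henv hinv htgt htn.
have [hb hb1] : s.1 b = 0 /\ s.1 b.+1 = 0.
  by case: hinv => _ _ h _ _; split; apply: h; lia.
have hb' : 1 < b < b.+2 by lia.
have hn := layout_notin hinv (leqnn b).
have [va [ta hta ea]] := IHa rho b.+2 b s env m hm hx hy henv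
  (layout_widen hinv (leqW (leqnSn b))) hb' hn.
rewrite /=; set A := eval a _ in va ea *.
pose F l := eval c ((x, y), l :: env).
have -> : \sum_(l < A) eval c (push l (x, y, env)) = \sum_(l < A) F l by [].
have hm' : m <= m ^ Ka.+1 by rewrite -{1}(expn1 m) leq_exp2l.
have hA' : A <= m ^ Ka.+1 by apply: leq_trans va _; rewrite leq_exp2l.
have hc l X : l < A ->
    F l <= m ^ (Ka.+1 * Kc) /\ exists2 t, t <= m ^ (Ka.+1 * Kc)
    & exec (compile tr (b.+1 :: rho) b.+2 tgt c)
        (upd (upd (upd s.1 b (A - l.+1)) tgt X) b.+1 l, s.2) t
        (upd (upd (upd s.1 b (A - l.+1)) tgt (X + F l)) b.+1 l, s.2).
  move=> hl.
  have hi1 : layout tr (upd (upd s.1 b (A - l.+1)) tgt X, s.2) rho b.+1 env.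
    apply: (@layout_upd tr (upd s.1 b (A - l.+1), s.2) rho b.+1 env tgt X) => //; last lia.
    by apply: layout_upd hinv _ _ _ => //; lia.
  have hi2 : layout tr (upd (upd (upd s.1 b (A - l.+1)) tgt X) b.+1 l, s.2)
      (b.+1 :: rho) b.+2 (l :: env).
    by apply: (@layout_push tr (_, _) rho b.+1 env b.+1 l) hi1 _ _; lia.
  have [||||||vc [tc htc ec]] := IHc (b.+1 :: rho) b.+2 tgt _ (l :: env)
    (m ^ Ka.+1) _ _ _ _ hi2; try lia.
  - apply/andP; split; first lia.
    by apply: sub_all henv => i; lia.
  - by rewrite inE negb_or htn andbT; lia.
  rewrite expnM; split=> //; exists tc => //; apply: exec_eq ec _ _ => //.
  by rewrite -/(F l) /=; store_eq.
have [|||||k1 hk1 e1] := @exec_countdown tr x y b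
  (Seq (Dec b) (Seq (compile tr (b.+1 :: rho) b.+2 tgt c) (Inc b.+1)))
  (fun i => (upd (upd (upd s.1 b (A - i)) b.+1 i) tgt
               (s.1 tgt + \sum_(l < i) F l), s.2)) A (m ^ (Ka.+1 * Kc) + 4)
  (upd s.1 b (s.1 b + A), s.2)
  (upd (upd s.1 b.+1 A) tgt (s.1 tgt + \sum_(l < A) F l), s.2).
- by apply: unsealed; lia.
- by move=> i hi /=; rewrite /upd; upd_case; lia.
- move=> i hi; have [_ [tc htc ec]] := hc i (s.1 tgt + \sum_(l < i) F l) hi.
  exists (1 + (tc + 1).+1).+1; first lia.
  apply: exec_eq.
    apply: exec_seq; first by apply: exec_dec; apply: unsealed; lia.
    apply: exec_seq; last by apply: exec_inc; apply: unsealed; lia.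
    by apply: exec_conv ec _ _; [store_eq | by []].
  + by [].
  + by rewrite big_ord_recr /=; store_eq.
- by rewrite big_ord0; store_eq.
- by store_eq.
have hb1' : ~~ sealed tr b.+1 by apply: unsealed; lia.
have [k2 hk2 e2] := exec_clear
  (upd (upd s.1 b.+1 A) tgt (s.1 tgt + \sum_(l < A) F l), s.2) hb1'.
have hsum : \sum_(l < A) F l <= m ^ (Ka + Ka.+1 * Kc).
  rewrite expnD; apply: leq_trans (_ : \sum_(l < A) m ^ (Ka.+1 * Kc) <= _).
    by apply: leq_sum => i _; have [] := hc i 0 (ltn_ord i).
  by rewrite sum_nat_const card_ord leq_mul2r va orbT.
split; first by apply: leq_trans hsum _; apply: pow_mono => //; lia.
exists (ta + (k1 + k2).+1).+1.
  apply: (@leq_trans (ta + (A * (m ^ (Ka.+1 * Kc) + 10)) + 5)).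
    by move: hk2; rewrite /upd /=; upd_case; nia.
  by rewrite !pow_add // ?pow_mul // ?pow_add // ?pow_const.
apply: exec_eq.
  by apply: exec_seq ea _; apply: exec_seq e1 e2.
- by [].
- by rewrite /=; store_eq.
Qed.

(** The head on the word tape is driven to the position, read, and returned to cell 0. In a
    transducer the second word is empty, so its bits are 0. *)
Lemma compiled_bit tp a Ka : (tr -> y = [::]) ->
  compiled a Ka -> compiled (EBit tp a) ((Ka + (3 + Ka)).+1 + 10).+1.
Proof.
move=> hy0 IHa rho b tgt s env m hm hx hy henv hinv htgt htn.
have hb : s.1 b = 0 by case: hinv => _ _ h _ _; apply: h.
have hb' : 1 < b < b.+1 by lia.
have hn := layout_notin hinv (leqnn b).
have [va [ta hta ea]] := IHa rho b.+1 b s env m hm hx hy henv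
  (layout_widen hinv (leqnSn b)) hb' hn.
rewrite /=; set A := eval a _ in va ea *; rewrite hb add0n in ea.
have ub : ~~ sealed tr b by apply: unsealed; lia.
have ut : ~~ sealed tr tgt by apply: unsealed; lia.
split; first by apply: leq_trans (leq_b1 _) _; rewrite expn_gt0; lia.
have htime t : t <= ta + 8 * A + 10 -> t <= m ^ ((Ka + (3 + Ka)).+1 + 10).+1.
  move=> h; apply: leq_trans h _.
  rewrite !pow_add // ?pow_mul // ?pow_const //.
  by rewrite (@leq_exp2r 2 m 3).
case: ifP => htp.
  have [k1 hk1 e1] := exec_clear (upd s.1 b A, s.2) ub.
  exists (ta + k1).+1.
    by apply: htime; move: hk1; rewrite /upd /=; upd_case; lia.
  apply: exec_eq; first by apply: exec_seq ea e1.
  - by [].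
  - case/andP: htp => htr ->; rewrite /= hy0 // nth_nil.
    by store_eq.
have hs : ~~ sealed tr tp by move: htp; rewrite /sealed; case: (tr); case: tp.
have h0 : s.1 tp = 0.
  by case: hinv => _ _ _ h0 h1; case: (tp) htp => // htp; apply: h1; case: (tr) htp.
have hcont i : content tr x y tp i = onth (word tp ((x, y), env)) i.
  by rewrite /content; case: (tp) htp => //=; case: (tr).
have htp2 : tp <= 1 by case: (tp).
set w := word tp _ in hcont *.
have [|k1 hk1 e1] := @exec_move_reg (upd s.1 b A, s.2) b tp ub hs; first lia.
have hbit : (onth w A == Some true) = nth false w A.
  by rewrite -(odflt_onth false); case: onth => [[]|].
set v : nat := nth false w A.
have [k2 hk2 e2] : exists2 k, k <= 2 & exec (When (TBit tp) (Inc tgt))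
    (upd s.1 tp A, s.2) k (upd (upd s.1 tp A) tgt (s.1 tgt + v), s.2).
  have ht : test_val tr x y (upd s.1 tp A, s.2) (TBit tp) = nth false w A.
    by rewrite /= hcont -hbit /upd eqxx.
  rewrite /v; case hw : (nth false w A) ht => ht.
    exists 2 => //; apply: exec_eq.
      by apply: exec_when_step ht _; apply: exec_inc.
    + by [].
    + by move: (nat_of_bool tp) htp2 => q hq; rewrite /= addn1; clear -htgt hq; store_eq.
  exists 1 => //; apply: exec_eq.
    by apply: exec_when_stop; rewrite ht.
  + by [].
  + by move: (nat_of_bool tp) htp2 => q hq; rewrite /= addn0; clear -htgt hq; store_eq.
have [k3 hk3 e3] := exec_clear
  (upd (upd s.1 tp A) tgt (s.1 tgt + v), s.2) hs.
move: (nat_of_bool tp) v h0 htp2 hs e1 hk1 e2 e3 hk3 => {htp hbit hcont}q v h0 hq hs e1 hk1 e2 e3 hk3.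
exists (ta + (k1 + (k2 + k3).+1).+1).+1.
  apply: htime; move: hk1 hk3; rewrite /upd /=; upd_case; lia.
apply: exec_eq.
  apply: exec_seq ea _; apply: exec_seq; first exact: e1.
  apply: exec_seq e3.
  by apply: exec_conv e2 _ _; [store_eq | by []].
- by [].
- by rewrite /=; store_eq.
Qed.

Lemma compiled_len tp : (tr -> y = [::]) -> compiled (ELen tp) 5.
Proof.
move=> hy0 rho b tgt s env m hm hx hy henv hinv htgt htn.
have hpow c : c <= 16 -> c * m <= m ^ 5.
  move=> hc; rewrite expnS mulnC leq_mul2l; apply/orP; right.
  by apply: leq_trans hc _; rewrite (@leq_exp2r 2 m 4).
rewrite /=; case: ifP => htp.
  case/andP: htp => htr ->; rewrite /= hy0 //=; split=> //.
  exists 1; first by rewrite expn_gt0; lia.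
  by apply: exec_eq (exec_skip _ _ _ _) _ _ => //; case: s hinv => f o _; store_eq.
have hs : ~~ sealed tr tp by move: htp; rewrite /sealed; case: (tr); case: tp.
have h0 : s.1 tp = 0.
  by case: hinv => _ _ _ h0 h1; case: (tp) htp => // htp; apply: h1; case: (tr) htp.
have hcont i : content tr x y tp i = onth (word tp ((x, y), env)) i.
  by rewrite /content; case: (tp) htp => //=; case: (tr).
set w := word tp _ in hcont *.
have hw : size w <= m by rewrite /w /word; case: ifP.
split; first by apply: leq_trans (hpow 1 isT); lia.
have [|||k1 hk1 e1] := @exec_loop tr x y (TNonblank tp) (Seq (Inc tp) (Inc tgt))
  (fun i => (upd (upd s.1 tp i) tgt (s.1 tgt + i), s.2)) (size w) 3.
- by move=> i hi; rewrite /= hcont /upd; upd_case; rewrite onthTE; lia.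
- by rewrite /= hcont /upd; upd_case; rewrite onthTE; lia.
- move=> i hi; exists 3 => //; apply: exec_eq.
    by apply: exec_seq; apply: exec_inc => //; apply: unsealed; lia.
  + by [].
  + by store_eq.
have [k2 hk2 e2] := exec_clear
  (upd (upd s.1 tp (size w)) tgt (s.1 tgt + size w), s.2) hs.
exists (k1 + k2).+1; last first.
  apply: exec_eq.
    apply: exec_seq e2; apply: exec_conv; [exact: e1 | | by []].
    by move: h0; clear -htgt; case: s => f o /= h0; move: (nat_of_bool tp) h0 => q h0; store_eq.
  + by [].
  + by store_eq.
apply: leq_trans (hpow 16 isT); move: hk2; rewrite /upd /=; upd_case; lia.
Qed.

End CompileExec.

Lemma compile_correct (tr : bool) e :
  exists K, forall x y, (tr -> y = [::]) -> compiled tr x y e K.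
Proof.
elim: e => [|a [K h]||a [K h] c [K' h']|a [K h] c [K' h']|a [K h] c [K' h']
  |tp a [K h]|tp]; eexists => x y hy.
- exact: compiled_var.
- exact: compiled_wk (h x y hy).
- exact: compiled_one.
- exact: compiled_add (h x y hy) (h' x y hy).
- exact: compiled_sub (h x y hy) (h' x y hy).
- exact: compiled_sum (h x y hy) (h' x y hy).
- exact: compiled_bit (h x y hy).
- exact: compiled_len.
Qed.

(** * From definability to Turing machines *)

Definition store0 : store := (fun=> 0, [::]).

Lemma layout_store0 tr b : layout tr store0 [::] b [::].
Proof. by split. Qed.

Lemma iter_fix (T : Type) (f : T -> T) a n : f a = a -> iter n f a = a.
Proof. by move=> h; elim: n => //= n ->. Qed.

Lemma halted_run M t t' x y :
  halts_in M t x y -> t <= t' -> run M t' x y = run M t x y.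
Proof.
move=> h ht; rewrite /run -(subnK ht) iterD iter_fix //.
by rewrite /step h.
Qed.

Lemma machine_run (tr : bool) prog x y t t' k s : (tr -> y = [::]) ->
  iter t (next tr x y) ([:: prog], store0) = (k, s) -> halting k -> t < t' ->
  represents x y (k, s) (run (machine tr prog) t' x y) /\
  halts_in (machine tr prog) t' x y.
Proof.
move=> hy hit hk ht; have hr := run_represents prog x t hy.
rewrite hit in hr.
have hh : halts_in (machine tr prog) t.+1 x y.
  by case: hr => /= h1 h2 _ _; rewrite /halts_in h2 /= state_of_neq0 // state_ofK.
by rewrite /halts_in !(halted_run hh ht).
Qed.

(** The shift by 2 yields the base of at least 2 that the cost bounds require. *)
Definition time_poly (K : nat) : {poly nat} := (('X + 2%:P) ^+ K)%R.

Lemma time_polyE K n : (time_poly K).[n]%R = (n + 2) ^ K.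
Proof. by rewrite /time_poly horner_exp hornerD hornerX hornerC. Qed.

Definition definable (f : ctx -> nat) : Prop := exists e, forall g, eval e g = f g.

Theorem definable_in_NP (A : language) (v : ctx -> nat) (q : {poly nat}) :
  definable v ->
  (forall x, A x <-> exists2 y, size y <= q.[size x]%R & 0 < v ((x, y), [::])) ->
  in_NP A.
Proof.
case=> e he hA; have [K hK] := compile_correct false e.
(* A positive value reaches [Accept], which halts; the value 0 skips the loop and halts on the empty
   stack, which rejects. *)
pose prog := Seq (compile false [::] 3 2 e) (While (TPos 2) Accept).
have key x y t' : (size x + size y + 2) ^ K.+2 <= t' ->
    halts_in (machine false prog) t' x y /\
    (tm_accept (cf_state (run (machine false prog) t' x y)) <->
     0 < v ((x, y), [::])).
  move=> ht'.
  have [] // := hK x y _ [::] 3 2 store0 [::] (size x + size y + 2) _ _ _ _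
    (layout_store0 _ _) isT; try lia.
  move=> _ [t ht ex]; rewrite he /= in ex.
  set s1 := (upd _ _ _, _) in ex.
  have htt : t.+2 < t'.
    (* Two additional factors of at least 2 pay for the steps around the compiled term. *)
    apply: leq_trans ht'; rewrite addn2 expnS expnS in ht *.
    have : 0 < (size x + size y).+2 ^ K by rewrite expn_gt0.
    by move: ht; move: (_ ^ K) => P; nia.
  have hy : false -> y = [::] by [].
  have hit : iter t.+2 (next false x y) ([:: prog], store0) =
      (if 0 < v (x, y, [::]) then [:: Accept; While (TPos 2) Accept] else [::], s1).
    rewrite iterS iterSr.
    have -> : next false x y ([:: prog], store0) =
      ([:: compile false [::] 3 2 e; While (TPos 2) Accept], store0) by [].
    by rewrite ex.
  have hal : halting (if 0 < v (x, y, [::])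
      then [:: Accept; While (TPos 2) Accept] else [::]) by case: ifP.
  have [[h1 h2 _ _] h3] := machine_run hy hit hal htt.
  split=> //; rewrite h2 /= state_of_neq0 // state_ofK //=.
  by case: ifP.
exists (machine false prog), (time_poly K.+2), q; split.
  by move=> x y; have [] := key x y _ (leqnn _); rewrite time_polyE.
move=> x; rewrite hA; split=> -[y hy hv]; exists y => //.
  have [h1 h2] := key x y _ (leqnn _); rewrite time_polyE; split=> //.
  exact/h2.
case: hv => _; rewrite time_polyE => h.
by have [h1 h2] := key x y _ (leqnn _); apply/h2.
Qed.

(** A word is given by its length and its bits, the position of a bit being the innermost
    variable. *)
Definition wdefinable (f : ctx -> seq bool) : Prop :=
  definable (fun g => size (f g)) /\
  definable (fun g => nth false (f (pop g)) (top g)).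

Theorem wdefinable_poly_time (f : ctx -> seq bool) :
  wdefinable f -> poly_time_computable (fun x => f ((x, [::]), [::])).
Proof.
case=> -[es hes] [eb heb].
have [Ks hKs] := compile_correct true es.
have [Kb hKb] := compile_correct true eb.
(* Register 2 counts the bits still to be written, 3 is the current position, and 4 receives the
   bit, which is output by testing it for zero. *)
pose body := Seq (Dec 2) (Seq (compile true [:: 3] 5 4 eb)
  (Seq (Out (TPos 4)) (Seq (clear 4) (Inc 3)))).
pose prog := Seq (compile true [::] 5 2 es) (While (TPos 2) body).
pose Kt := ((Ks + (Ks + (Ks.+1 * Kb + 20).+1)).+1 + 5).+1.
exists (machine true prog), (time_poly Kt) => x; rewrite time_polyE.
set m := size x + 2.
set w := f _.
have hsz : eval es ((x, [::]), [::]) = size w by rewrite hes.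
have hbit i : eval eb ((x, [::]), [:: i]) = nth false w i by rewrite heb.
have hm : 2 <= m by rewrite /m; lia.
have hx : size x <= m by rewrite /m; lia.
clearbody m.
have [hn [ts hts es1]] := hKs x [::] (fun=> erefl) [::] 5 2 store0 [::] m hm hx
  isT isT (layout_store0 _ _) isT isT.
rewrite hsz /= in hn es1.
have hm' : m <= m ^ Ks.+1 by rewrite -{1}(expn1 m) leq_exp2l.
have hn' : size w <= m ^ Ks.+1 by apply: leq_trans hn _; rewrite leq_exp2l.
pose S i : store := (upd (upd (fun=> 0) 2 (size w - i)) 3 i, take i w).
have hbody i : i < size w ->
    exists2 k, k <= m ^ (Ks.+1 * Kb) + 15 & exec true x [::] body (S i) k (S i.+1).
  move=> hi.
  have hinv : layout true (upd (upd (fun=> 0) 2 (size w - i.+1)) 3 i, take i w)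
      [:: 3] 5 [:: i].
    by split=> // r hr /=; rewrite /upd; upd_case.
  have hi' : all (fun v => v <= m ^ Ks.+1) [:: i] by rewrite /= andbT; lia.
  have [_ [tb htb eb1]] := hKb x [::] (fun=> erefl) [:: 3] 5 4 _ [:: i]
    (m ^ Ks.+1) (leq_trans hm hm') (leq_trans hx hm') isT hi' hinv isT isT.
  rewrite hbit /= -expnM in htb eb1.
  pose b : nat := nth false w i.
  have [kc hkc ec] := @exec_clear true x [::]
    (upd (upd (upd (fun=> 0) 2 (size w - i.+1)) 3 i) 4 b, take i.+1 w) 4 isT.
  exists (1 + (tb + (1 + (kc + 1).+1).+1).+1).+1.
    move: hkc; rewrite /upd /= /b; case: nth => /=; lia.
  apply: exec_seq.
    apply: exec_eq; [exact: exec_dec | by [] |].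
    by rewrite /S /=; instantiate (1 := (upd (upd (fun=> 0) 2 (size w - i.+1)) 3 i, take i w)); store_eq.
  apply: exec_seq eb1 _.
  apply: exec_seq.
    apply: exec_eq; [exact: exec_out | by [] |].
    instantiate (1 := (upd (upd (upd (fun=> 0) 2 (size w - i.+1)) 3 i) 4 b, take i.+1 w)).
    congr pair; rewrite (take_nth false) //; congr rcons.
    by rewrite /= /upd /b /=; case: nth.
  apply: exec_seq ec _.
  apply: exec_eq; [exact: exec_inc | by [] |].
  by rewrite /S /=; store_eq.
have [||||kl hkl el] := @exec_countdown true x [::] 2 body S (size w)
  (m ^ (Ks.+1 * Kb) + 15) (upd (fun=> 0) 2 (0 + size w), [::]) (S (size w)) isT.
- by move=> i hi; rewrite /S /upd.
- exact: hbody.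
- by rewrite /S take0; store_eq.
- by [].
have hit : iter (ts + kl).+1 (next true x [::]) ([:: prog], store0) =
    ([::], S (size w)).
  exact: (exec_seq es1 el).
have htt : (ts + kl).+1 < m ^ Kt.
  apply: (@leq_trans (ts + size w * (m ^ (Ks.+1 * Kb) + 20) + 5)); first by nia.
  by rewrite !pow_add // ?pow_mul // ?pow_add // ?pow_const.
have [[_ _ _ ht] hh] := machine_run (y := [::]) (fun=> erefl) hit isT htt.
split=> // j.
have -> : cf_tape (run (machine true prog) (m ^ Kt) x [::]) (inord 1) j =
    tape_val true x [::] (S (size w)) 1 j.
  by have := ht (inord 1) j; rewrite inordK.
by rewrite /tape_val /= /S /= take_size.
Qed.

(** * Closure properties of definability *)

Lemma definable_eq f f' : definable f -> f =1 f' -> definable f'.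
Proof. by case=> e he h; exists e => g; rewrite he. Qed.

Lemma def_top : definable (fun g => top g).
Proof. by exists EVar. Qed.

Lemma def_pop f : definable f -> definable (fun g => f (pop g)).
Proof. by case=> e he; exists (EWk e) => g /=; rewrite he. Qed.

Lemma def_iter_pop n f : definable f -> definable (fun g => f (iter n pop g)).
Proof.
by move=> hf; elim: n => [|n /def_pop IH] //; apply: definable_eq IH _ => g; rewrite -iterSr.
Qed.

Lemma def_add f h : definable f -> definable h -> definable (fun g => f g + h g).
Proof. by case=> e he [e' he']; exists (EAdd e e') => g /=; rewrite he he'. Qed.

Lemma def_sub f h : definable f -> definable h -> definable (fun g => f g - h g).
Proof. by case=> e he [e' he']; exists (ESub e e') => g /=; rewrite he he'. Qed.

Lemma def_const n : definable (fun=> n).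
Proof.
elim: n => [|n IH]; first by exists (ESub EOne EOne) => g /=.
by apply: definable_eq (def_add (ex_intro _ EOne (fun=> erefl)) IH) _ => g /=.
Qed.

Lemma pop_push i g : pop (push i g) = g.
Proof. by case: g. Qed.

Lemma def_sum f (h : ctx -> nat -> nat) :
  definable f -> definable (fun g => h (pop g) (top g)) ->
  definable (fun g => \sum_(i < f g) h g i).
Proof.
case=> e he [e' he']; exists (ESum e e') => g /=; rewrite he.
by apply: eq_bigr => i _; rewrite he' pop_push.
Qed.

Lemma def_size tp : definable (fun g => size (word tp g)).
Proof. by exists (ELen tp). Qed.

Lemma def_bit tp f : definable f ->
  definable (fun g => nat_of_bool (nth false (word tp g) (f g))).
Proof. by case=> e he; exists (EBit tp e) => g /=; rewrite he. Qed.

Lemma def_mul f h : definable f -> definable h -> definable (fun g => f g * h g).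
Proof.
move=> hf hh; apply: definable_eq (@def_sum _ (fun g _ => h g) hf (def_pop hh)) _ => g.
by rewrite sum_nat_const card_ord.
Qed.

Lemma def_succ f : definable f -> definable (fun g => (f g).+1).
Proof. by move=> h; apply: definable_eq (def_add h (def_const 1)) _ => g; rewrite addn1. Qed.

Lemma def_pred f : definable f -> definable (fun g => (f g).-1).
Proof. by move=> h; apply: definable_eq (def_sub h (def_const 1)) _ => g; rewrite subn1. Qed.

(** Environments are read with default 0, as [eval] does, so a substitution is described by its
    entries. *)
Definition substitution (s : ctx -> ctx) : Prop :=
  (forall g, (s g).1 = g.1) /\ forall j, definable (fun g => nth 0 (s g).2 j).

Lemma subst_push f s : definable f -> substitution s ->
  substitution (fun g => push (f g) (s g)).
Proof. by move=> hf [h1 h2]; split=> // -[|j]; [exact: hf | exact: h2]. Qed.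

Lemma subst_pop s : substitution s -> substitution (fun g => pop (s g)).
Proof.
move=> [h1 h2]; split=> // j; apply: definable_eq (h2 j.+1) _ => g.
by rewrite /= nth_behead.
Qed.

Lemma subst_comp_pop s : substitution s -> substitution (fun g => s (pop g)).
Proof.
by move=> [h1 h2]; split=> [g|j]; [rewrite h1 | apply: (def_pop (h2 j))].
Qed.

Lemma subst_id : substitution id.
Proof.
split=> // j; apply: definable_eq (def_iter_pop j def_top) _ => g.
by elim: j g => [|j IH] [w [|v env]] //; rewrite iterSr IH //= nth_nil.
Qed.

(** Induction on the term; under a sum the substitution is shifted and extended by the new variable.
    In particular, bits of a definable word can be taken at any definable position. *)
Lemma def_subst f s : definable f -> substitution s -> definable (fun g => f (s g)).
Proof.
case=> e he; apply: (@id (_ -> _)) => hs.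
suff: definable (fun g => eval e (s g)).
  by move=> h; apply: definable_eq h _ => g; rewrite he.
elim: e s hs {f he} => [|a IH||a IHa b IHb|a IHa b IHb|a IHa b IHb|tp a IH|tp] s hs /=.
- by case: hs => _ h; apply: definable_eq (h 0) _ => g; rewrite /top nth0.
- exact/IH/subst_pop.
- exact: (def_const 1).
- by apply: def_add; [apply: IHa | apply: IHb].
- by apply: def_sub; [apply: IHa | apply: IHb].
- apply: (@def_sum _ (fun g i => eval b (push i (s g)))); first exact: IHa.
  apply: (IHb (fun g => push (top g) (s (pop g)))).
  by apply: subst_push def_top _; apply: subst_comp_pop.
- apply: definable_eq (def_bit tp (IH s hs)) _ => g.
  by case: hs => h _; rewrite /word h.
- by apply: definable_eq (def_size tp) _ => g; case: hs => h _; rewrite /word h.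
Qed.

Lemma def_let f (h : ctx -> nat -> nat) :
  definable f -> definable (fun g => h (pop g) (top g)) ->
  definable (fun g => h g (f g)).
Proof.
move=> hf hh; apply: definable_eq (def_subst hh (subst_push hf subst_id)) _ => g.
by rewrite pop_push.
Qed.

Notation decidable_by P := (definable (fun g => nat_of_bool (P g))).

Lemma def_pos f : definable f -> decidable_by (fun g => 0 < f g).
Proof.
move=> h; apply: definable_eq (def_sub (def_const 1) (def_sub (def_const 1) h)) _ => g.
by case: (f g) => // n; rewrite subSS sub0n.
Qed.

Lemma def_not P : decidable_by P -> decidable_by (fun g => ~~ P g).
Proof. by move=> h; apply: definable_eq (def_sub (def_const 1) h) _ => g; case: (P g). Qed.

Lemma def_and P Q : decidable_by P -> decidable_by Q -> decidable_by (fun g => P g && Q g).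
Proof. by move=> h h'; apply: definable_eq (def_mul h h') _ => g; rewrite mulnb. Qed.

Lemma def_or P Q : decidable_by P -> decidable_by Q -> decidable_by (fun g => P g || Q g).
Proof.
move=> h h'; apply: definable_eq (def_not (def_and (def_not h) (def_not h'))) _ => g.
by rewrite negb_and !negbK.
Qed.

Lemma def_imp P Q : decidable_by P -> decidable_by Q -> decidable_by (fun g => P g ==> Q g).
Proof.
by move=> h h'; apply: definable_eq (def_or (def_not h) h') _ => g; rewrite implybE.
Qed.

Lemma def_leq f h : definable f -> definable h -> decidable_by (fun g => f g <= h g).
Proof.
move=> hf hh; apply: definable_eq (def_not (def_pos (def_sub hf hh))) _ => g.
by rewrite subn_gt0 -leqNgt.
Qed.

Lemma def_eq f h : definable f -> definable h -> decidable_by (fun g => f g == h g).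
Proof.
move=> hf hh; apply: definable_eq (def_and (def_leq hf hh) (def_leq hh hf)) _ => g.
by rewrite -eqn_leq.
Qed.

Lemma def_eqb P Q : decidable_by P -> decidable_by Q -> decidable_by (fun g => P g == Q g).
Proof.
by move=> hf hh; apply: definable_eq (def_eq hf hh) _ => g; case: (P g); case: (Q g).
Qed.

Lemma def_if P f h : decidable_by P -> definable f -> definable h ->
  definable (fun g => if P g then f g else h g).
Proof.
move=> hP hf hh.
apply: definable_eq (def_add (def_mul hP hf) (def_mul (def_not hP) hh)) _ => g.
by case: (P g); rewrite /= ?mul1n ?addn0.
Qed.

Lemma def_ifb P Q R : decidable_by P -> decidable_by Q -> decidable_by R ->
  decidable_by (fun g => if P g then Q g else R g).
Proof.
by move=> hP hf hh; apply: definable_eq (def_if hP hf hh) _ => g; case: (P g).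
Qed.

Lemma def_constb (b : bool) : decidable_by (fun=> b).
Proof. exact: (def_const b). Qed.

Lemma count_iota (a : pred nat) n : count a (iota 0 n) = \sum_(i < n) a i.
Proof.
elim: n => [|n IH]; first by rewrite big_ord0.
by rewrite -{1}addn1 iotaD count_cat IH /= addn0 big_ord_recr.
Qed.

Lemma def_count n (P : ctx -> nat -> bool) :
  definable n -> decidable_by (fun g => P (pop g) (top g)) ->
  definable (fun g => count (P g) (iota 0 (n g))).
Proof.
move=> hn hP; apply: definable_eq (@def_sum _ (fun g i => P g i : nat) hn hP) _ => g.
by rewrite count_iota.
Qed.

Lemma def_has n (P : ctx -> nat -> bool) :
  definable n -> decidable_by (fun g => P (pop g) (top g)) ->
  decidable_by (fun g => has (P g) (iota 0 (n g))).
Proof.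
move=> hn hP; apply: definable_eq (def_pos (def_count hn hP)) _ => g.
by rewrite has_count.
Qed.

Lemma def_all n (P : ctx -> nat -> bool) :
  definable n -> decidable_by (fun g => P (pop g) (top g)) ->
  decidable_by (fun g => all (P g) (iota 0 (n g))).
Proof.
move=> hn hP.
apply: definable_eq (def_not (@def_has n (fun g i => ~~ P g i) hn (def_not hP))) _ => g.
by rewrite has_predC negbK.
Qed.

Lemma sum_ltn_min m q : \sum_(i < m) (i < q : nat) = minn m q.
Proof.
elim: m => [|m IH]; first by rewrite big_ord0 min0n.
by rewrite big_ord_recr /= IH; lia.
Qed.

(** For a positive divisor, the quotient counts its positive multiples up to the dividend. *)
Lemma def_div f h : definable f -> definable h -> definable (fun g => f g %/ h g).
Proof.
move=> hf hh.
have H : decidable_by (fun g => (top g).+1 * h (pop g) <= f (pop g)).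
  by apply: def_leq; [apply: def_mul; [exact/def_succ/def_top | exact: def_pop] | exact: def_pop].
apply: definable_eq (def_if (def_pos hh)
  (@def_sum _ (fun g i => i.+1 * h g <= f g : nat) hf H) (def_const 0)) _ => g.
case: posnP => [->|h0] //=.
have -> : \sum_(i < f g) (i.+1 * h g <= f g) = \sum_(i < f g) (i < f g %/ h g).
  by apply: eq_bigr => i _; rewrite -leq_divRL.
by rewrite sum_ltn_min; apply/minn_idPr/leq_div.
Qed.

Lemma def_mod f h : definable f -> definable h -> definable (fun g => f g %% h g).
Proof.
move=> hf hh; apply: definable_eq (def_sub hf (def_mul (def_div hf hh) hh)) _ => g.
by rewrite {1}(divn_eq (f g) (h g)) addKn.
Qed.

Lemma def_dvd f h : definable f -> definable h -> decidable_by (fun g => f g %| h g).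
Proof. by move=> hf hh; apply: def_eq (def_const 0); apply: def_mod. Qed.

Lemma def_odd f : definable f -> decidable_by (fun g => odd (f g)).
Proof.
by move=> hf; apply: definable_eq (def_mod hf (def_const 2)) _ => g; rewrite modn2.
Qed.

Lemma def_poly (p : {poly nat}) f : definable f -> definable (fun g => p.[f g]%R).
Proof.
move=> hf; rewrite /horner; elim: (polyseq p) => [|a s IH] /=; first exact: (def_const 0).
exact: (def_add (def_mul IH hf) (def_const a)).
Qed.

Ltac def_user := fail.

Ltac def_hyp :=
  match goal with H : definable _ |- _ => first
    [ exact H | exact (@def_iter_pop 1 _ H) | exact (@def_iter_pop 2 _ H)
    | exact (@def_iter_pop 3 _ H) | exact (@def_iter_pop 4 _ H)
    | exact (@def_iter_pop 5 _ H) | exact (@def_iter_pop 6 _ H) ] end.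

Ltac def_step :=
  cbv beta;
  lazymatch goal with
  | |- definable (fun g => nat_of_bool (@?a g && @?b g)) => apply (@def_and a b)
  | |- definable (fun g => nat_of_bool (@?a g || @?b g)) => apply (@def_or a b)
  | |- definable (fun g => nat_of_bool (@?a g ==> @?b g)) => apply (@def_imp a b)
  | |- definable (fun g => nat_of_bool (~~ @?a g)) => apply (@def_not a)
  | |- definable (fun g => nat_of_bool (odd (@?a g))) => apply (@def_odd a)
  | |- definable (fun g => nat_of_bool (dvdn (@?a g) (@?b g))) => apply (@def_dvd a b)
  | |- definable (fun g => nat_of_bool (leq (@?a g) (@?b g))) => apply (@def_leq a b)
  | |- definable (fun g => nat_of_bool (@eq_op Datatypes_nat__canonical__eqtype_Equality (@?a g) (@?b g))) =>
      apply (@def_eq a b)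
  | |- definable (fun g => nat_of_bool (@eq_op Datatypes_bool__canonical__eqtype_Equality (@?a g) (@?b g))) =>
      apply (@def_eqb a b)
  | |- definable (fun g => nat_of_bool (all (@?p g) (iota 0 (@?n g)))) => apply (@def_all n p)
  | |- definable (fun g => nat_of_bool (has (@?p g) (iota 0 (@?n g)))) => apply (@def_has n p)
  | |- definable (fun g => nat_of_bool (nth false (word ?tp _) (@?a g))) => apply (@def_bit tp a)
  | |- definable (fun g => addn (@?a g) (@?b g)) => apply (@def_add a b)
  | |- definable (fun g => subn (@?a g) (@?b g)) => apply (@def_sub a b)
  | |- definable (fun g => muln (@?a g) (@?b g)) => apply (@def_mul a b)
  | |- definable (fun g => divn (@?a g) (@?b g)) => apply (@def_div a b)
  | |- definable (fun g => modn (@?a g) (@?b g)) => apply (@def_mod a b)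
  | |- definable (fun g => (@?a g).-1) => apply (@def_pred a)
  | |- definable (fun g => count (@?p g) (iota 0 (@?n g))) => apply (@def_count n p)
  | |- definable (fun g => size (word ?tp _)) => exact (def_size tp)
  | |- definable (fun g => top _) => first
     [ exact def_top
     | exact (@def_iter_pop 1 _ def_top) | exact (@def_iter_pop 2 _ def_top)
     | exact (@def_iter_pop 3 _ def_top) | exact (@def_iter_pop 4 _ def_top)
     | exact (@def_iter_pop 5 _ def_top) | exact (@def_iter_pop 6 _ def_top) ]
  | |- definable (fun g => nat_of_bool true) => exact (def_constb true)
  | |- definable (fun g => nat_of_bool false) => exact (def_constb false)
  | |- definable (fun g => (@?a g).+1) => apply (@def_succ a)
  | |- _ => first [ def_hyp | exact (def_const _) | exact (def_constb _) | def_user | apply def_ifb | apply def_if ]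
  end.

Ltac def := repeat def_step.

(** * Definable words *)

Lemma wdef_size F : wdefinable F -> definable (fun g => size (F g)).
Proof. by case. Qed.

Lemma wdef_nth F i : wdefinable F -> definable i ->
  decidable_by (fun g => nth false (F g) (i g)).
Proof.
by case=> _ h hi; apply: (@def_let i (fun g j => nat_of_bool (nth false (F g) j))).
Qed.

Lemma wdef_subst F s : wdefinable F -> substitution s -> wdefinable (fun g => F (s g)).
Proof.
case=> h1 h2 hs; split; first exact: (def_subst h1 hs).
have hs' := subst_push def_top (subst_comp_pop hs).
by apply: definable_eq (def_subst h2 hs') _ => g; rewrite pop_push.
Qed.

Lemma wdefI F : definable (fun g => size (F g)) ->
  (forall s i, substitution s -> definable i ->
     decidable_by (fun g => nth false (F (s g)) (i g))) -> wdefinable F.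
Proof.
move=> h1 h2; split=> //; apply: h2 def_top; exact: subst_comp_pop subst_id.
Qed.

Lemma wdef_eq_fun F F' : wdefinable F -> F =1 F' -> wdefinable F'.
Proof.
case=> h1 h2 e; split; first by apply: definable_eq h1 _ => g; rewrite e.
by apply: definable_eq h2 _ => g; rewrite e.
Qed.

Lemma wdef_nil : wdefinable (fun=> [::]).
Proof. by split; [exact: def_const | apply: definable_eq (def_const 0) _ => g; rewrite nth_nil]. Qed.

Lemma wdef_seq1 P : decidable_by P -> wdefinable (fun g => [:: P g]).
Proof.
move=> h; split; first exact: (def_const 1).
have h' : decidable_by (fun g => (top g == 0) && P (pop g)) by def.
by apply: definable_eq h' _ => g; case: (top g) => //= n; rewrite nth_nil.
Qed.

Lemma wdef_cat F G : wdefinable F -> wdefinable G -> wdefinable (fun g => F g ++ G g).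
Proof.
move=> hF hG; apply: wdefI => [|s i hs hi].
  by apply: definable_eq (def_add (wdef_size hF) (wdef_size hG)) _ => g; rewrite size_cat.
have hFs := wdef_subst hF hs; have hGs := wdef_subst hG hs.
have h : decidable_by (fun g => if i g < size (F (s g)) then nth false (F (s g)) (i g)
    else nth false (G (s g)) (i g - size (F (s g)))).
  apply: def_ifb; first exact: def_leq (def_succ hi) (wdef_size hFs).
    exact: wdef_nth.
  exact: wdef_nth (def_sub hi (wdef_size hFs)).
by apply: definable_eq h _ => g; rewrite nth_cat.
Qed.

Lemma wdef_if P F G : decidable_by P -> wdefinable F -> wdefinable G ->
  wdefinable (fun g => if P g then F g else G g).
Proof.
move=> hP hF hG; apply: wdefI => [|s i hs hi].
  apply: definable_eq (def_if hP (wdef_size hF) (wdef_size hG)) _ => g.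
  by case: (P g).
have hFs := wdef_subst hF hs; have hGs := wdef_subst hG hs.
apply: definable_eq (def_ifb (def_subst hP hs) (wdef_nth hFs hi) (wdef_nth hGs hi)) _ => g.
by case: (P (s g)).
Qed.

Lemma size_flatten_iota (F : nat -> seq bool) n :
  size (flatten [seq F i | i <- iota 0 n]) = \sum_(l < n) size (F l).
Proof.
elim: n => [|n IH]; first by rewrite big_ord0.
by rewrite -{1}addn1 iotaD map_cat flatten_cat size_cat IH /= cats0 big_ord_recr.
Qed.

(** Prefix sums of the block lengths locate the block of position [j], which turns indexing into a
    bounded search. *)
Lemma nth_flatten_iota (F : nat -> seq bool) n j :
  nth false (flatten [seq F i | i <- iota 0 n]) j =
  has (fun i => [&& \sum_(l < i) size (F l) <= j,
       j - \sum_(l < i) size (F l) < size (F i)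
     & nth false (F i) (j - \sum_(l < i) size (F l))]) (iota 0 n).
Proof.
elim: n => [|n IH]; first by rewrite nth_nil.
rewrite -addn1 iotaD map_cat flatten_cat nth_cat has_cat -IH size_flatten_iota /= cats0 orbF add0n.
case: (ltnP j (\sum_(l < n) size (F l))) => h /=; first by rewrite orbF.
rewrite [nth _ (flatten _) _]nth_default ?size_flatten_iota //=.
by case: ltnP => // h'; rewrite nth_default.
Qed.

Lemma wdef_flatten (F : ctx -> nat -> seq bool) n :
  definable n -> wdefinable (fun g => F (pop g) (top g)) ->
  wdefinable (fun g => flatten [seq F g i | i <- iota 0 (n g)]).
Proof.
move=> hn hF.
have hFs s a : substitution s -> definable a -> wdefinable (fun g => F (s g) (a g)).
  move=> hs ha; apply: wdef_eq_fun (wdef_subst hF (subst_push ha hs)) _ => g.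
  by rewrite pop_push.
apply: wdefI => [|s j hs hj].
  have h := @def_sum _ (fun g i => size (F g i)) hn (wdef_size hF).
  apply: definable_eq h _ => g.
  by rewrite size_flatten_iota.
have hs' := subst_comp_pop hs.
have hpre : definable (fun g => \sum_(l < top g) size (F (s (pop g)) l)).
  apply: (@def_sum _ (fun g l => size (F (s (pop g)) l))); first exact: def_top.
  exact: wdef_size (hFs (fun g => s (pop (pop g))) _ (subst_comp_pop hs') def_top).
have hFi := hFs _ _ hs' def_top.
have hj' := def_pop hj.
have h : decidable_by (fun g => has (fun i =>
  [&& \sum_(l < i) size (F (s g) l) <= j g,
       j g - \sum_(l < i) size (F (s g) l) < size (F (s g) i)
     & nth false (F (s g) i) (j g - \sum_(l < i) size (F (s g) l))]) (iota 0 (n (s g)))).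
  apply: def_has; first exact: def_subst hn hs.
  apply: def_and; first exact: def_leq.
  apply: def_and.
    exact: def_leq (def_succ (def_sub hj' hpre)) (wdef_size hFi).
  exact: wdef_nth hFi (def_sub hj' hpre).
by apply: definable_eq h _ => g; rewrite nth_flatten_iota.
Qed.

Lemma wdef_nseq n : definable n -> wdefinable (fun g => nseq (n g) true).
Proof.
move=> hn; split; first by apply: definable_eq hn _ => g; rewrite size_nseq.
have h : decidable_by (fun g => top g < n (pop g)) by def.
by apply: definable_eq h _ => g; rewrite nth_nseq; case: ltnP.
Qed.

Lemma wdef_word tp : wdefinable (fun g => word tp g).
Proof. by split; [exact: def_size | exact: (def_bit tp def_top)]. Qed.

Lemma wdef_eq F G : wdefinable F -> wdefinable G -> decidable_by (fun g => F g == G g).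
Proof.
move=> hF hG.
have h : decidable_by (fun g => (size (F g) == size (G g)) &&
   all (fun i => nth false (F g) i == nth false (G g) i) (iota 0 (size (F g)))).
  apply: def_and; first exact: def_eq (wdef_size hF) (wdef_size hG).
  apply: def_all; first exact: wdef_size.
  by apply: def_eqb; [case: hF | case: hG].
apply: definable_eq h _ => g; congr nat_of_bool; apply/andP/eqP => [[/eqP hs /allP ha]|->].
  by apply: (eq_from_nth (x0 := false)) => // i hi; apply/eqP/ha; rewrite mem_iota.
by split=> //; apply/allP.
Qed.

Definition pow2b (w : nat) := all (fun d => (d.+2 %| w) ==> ~~ odd d) (iota 0 w).

Lemma pow2P w : 0 < w -> reflect (exists k, w = 2 ^ k) (pow2b w).
Proof.
move=> w0; apply: (iffP allP) => [|[k ->] d _].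
  have [n] := ubnP w; elim: n w w0 => // n IH w w0 hwn hw.
  case: (ltngtP w 1) => [|w1|->]; [lia | | by exists 0].
  have he : ~~ odd w.
    have hd : (w - 2).+2 = w by lia.
    have := hw (w - 2); rewrite mem_iota hd dvdnn oddB //= addbF.
    by apply; lia.
  have hw2 : w = w./2 * 2 by rewrite muln2 halfK; move: he; case: odd => //; rewrite subn0.
  have [|||k hk] := IH w./2; try lia.
    move=> d; rewrite mem_iota => hd; apply/implyP => hdv.
    have := hw d; rewrite mem_iota [X in _ %| X]hw2 dvdn_mulr //=; apply; lia.
  by exists k.+1; rewrite hw2 hk expnSr.
apply/implyP => /(dvdn_pfactor _ _ (isT : prime 2))[m _ hm].
by case: m hm => // m hd; have := congr1 odd hd; rewrite expnS oddM /= negbK => ->.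
Qed.

(** The weights of the digits of [n] are the powers of two up to [n]. Searching all numbers up to
    [n] for them is affordable, because [n] is the value of a term. *)
Lemma enc_nat_def n :
  enc_nat n = flatten [seq (if pow2b i.+1 then [:: true; odd (n %/ i.+1)] else [::])
                        | i <- iota 0 n] ++ [:: false].
Proof.
rewrite /enc_nat /enc_seq /digits -map_comp; congr (_ ++ _).
pose F w := [:: true; odd (n %/ w)].
have -> : flatten [seq (if pow2b i.+1 then [:: true; odd (n %/ i.+1)] else [::]) | i <- iota 0 n]
   = flatten [seq F w | w <- [seq i.+1 | i <- iota 0 n] & pow2b w].
  elim: (iota 0 n) => //= i s ->; by case: ifP.
rewrite (_ : [seq w <- _ | pow2b w] = [seq 2 ^ i | i <- iota 0 (up_log 2 n.+1)]).
  by rewrite -!map_comp.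
apply: (irr_sorted_eq ltn_trans ltnn).
- apply: sorted_filter; first exact: ltn_trans.
  rewrite -[[seq _.+1 | _ <- _]]/(map (addn 1) (iota 0 n)) -iotaDl.
  exact: iota_ltn_sorted.
- rewrite sorted_map; apply: sub_sorted (iota_ltn_sorted _ _) => i j /=.
  by rewrite ltn_exp2l.
move=> w; rewrite mem_filter; apply/andP/mapP.
  case=> hp /mapP[i]; rewrite mem_iota => /= hi hw.
  have [k hk] : exists k, w = 2 ^ k by apply/pow2P => //; rewrite hw.
  exists k => //; rewrite mem_iota /= add0n ltnNge; apply/negP => hu.
  have h1 := up_logP n.+1 (isT : 1 < 2).
  have h2 : 2 ^ up_log 2 n.+1 <= 2 ^ k by rewrite leq_exp2l.
  by lia.
case=> k; rewrite mem_iota add0n => /= hk ->; split; first by apply/pow2P; rewrite ?expn_gt0 //; exists k.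
have h : 2 ^ k < n.+1.
  by rewrite ltnNge; apply/negP => /(up_log_min (isT : 1 < 2)); rewrite leqNgt hk.
have h0 : 0 < 2 ^ k by rewrite expn_gt0.
by apply/mapP; exists (2 ^ k).-1; [rewrite mem_iota; lia | lia].
Qed.

Lemma wdef_enc_nat n : definable n -> wdefinable (fun g => enc_nat (n g)).
Proof.
move=> hn.
have h : wdefinable (fun g => flatten [seq (if pow2b i.+1 then
     [:: true] ++ [:: odd (n g %/ i.+1)] else [::]) | i <- iota 0 (n g)] ++ [:: false]).
  apply: wdef_cat; last by apply: wdef_seq1; def.
  apply: wdef_flatten => //; apply: wdef_if; last exact: wdef_nil.
    rewrite /pow2b; def.
  by apply: wdef_cat; apply: wdef_seq1; def.
by apply: wdef_eq_fun h _ => g; rewrite enc_nat_def.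
Qed.

Ltac wdef_user := fail.

Ltac wdef_step :=
  cbv beta;
  lazymatch goal with
  | |- wdefinable (fun g => cat (@?a g) (@?b g)) => apply (@wdef_cat a b)
  | |- wdefinable (fun g => enc_nat (@?n g)) => apply (@wdef_enc_nat n)
  | |- wdefinable (fun g => flatten (map (@?F g) (iota 0 (@?n g)))) =>
      apply (@wdef_flatten F n)
  | |- wdefinable (fun g => [::]) => exact wdef_nil
  | |- wdefinable (fun g => [:: @?b g]) => apply (@wdef_seq1 b)
  | |- wdefinable (fun g => nseq (@?n g) true) => apply (@wdef_nseq n)
  | |- wdefinable (fun g => word ?tp _) => exact (wdef_word tp)
  | |- wdefinable _ => first [assumption | wdef_user | apply wdef_if]
  end.

Ltac wdef := repeat wdef_step.

(** * Binary digits *)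

Definition bit (a j : nat) : bool := odd (a %/ 2 ^ j).

Lemma bit0 a : bit a 0 = odd a.
Proof. by rewrite /bit expn0 divn1. Qed.

Lemma bitS a j : bit a j.+1 = bit a./2 j.
Proof. by rewrite /bit expnS divnMA divn2. Qed.

Lemma half_bound a N : a < 2 ^ N.+1 -> a./2 < 2 ^ N.
Proof. by rewrite expnS; lia. Qed.

Lemma bit_eq N a b : a < 2 ^ N -> b < 2 ^ N ->
  (forall j, j < N -> bit a j = bit b j) -> a = b.
Proof.
elim: N a b => [|N IH] a b; first by rewrite expn0; lia.
move=> ha hb h.
have := h 0 isT; rewrite !bit0 => h0.
have := IH _ _ (half_bound ha) (half_bound hb).
have hj j : j < N -> bit a./2 j = bit b./2 j by move=> hj; rewrite -!bitS; apply: h.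
by move=> /(_ hj) h1; rewrite -(odd_double_half a) -(odd_double_half b) h0 h1.
Qed.

Lemma ltn_up_log k n : (k < up_log 2 n.+1) = (2 ^ k <= n).
Proof.
apply/idP/idP => h.
  by rewrite -ltnS ltnNge; apply/negP => /(up_log_min (isT : 1 < 2)); rewrite leqNgt h.
rewrite ltnNge; apply/negP => hu.
have h1 := up_logP n.+1 (isT : 1 < 2).
have h2 : 2 ^ up_log 2 n.+1 <= 2 ^ k by rewrite leq_exp2l.
by lia.
Qed.

Lemma has_iota0 (P : pred nat) N :
  has P (iota 0 N.+1) = P 0 || has (fun j => P j.+1) (iota 0 N).
Proof.
by rewrite /= -[1]/(1 + 0) iotaDl has_map; congr (_ || _); apply: eq_has => j.
Qed.

Lemma all_iota0 (P : pred nat) N :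
  all P (iota 0 N.+1) = P 0 && all (fun j => P j.+1) (iota 0 N).
Proof.
by rewrite /= -[1]/(1 + 0) iotaDl all_map; congr (_ && _); apply: eq_all => j.
Qed.

Lemma has_bit a N i : a < 2 ^ N ->
  has (fun j => (i <= j) && bit a j) (iota 0 N) = (2 ^ i <= a).
Proof.
elim: N a i => [|N IH] a i ha; first by case: a ha => //= _; rewrite leqn0 expn_eq0.
rewrite has_iota0 (eq_has (a2 := fun j => (i.-1 <= j) && bit a./2 j)); last first.
  by move=> j; rewrite bitS; case: i.
rewrite IH ?half_bound // bit0; case: i => [|i] /=.
  by rewrite !expn0; lia.
by rewrite expnS; lia.
Qed.

(** A position belongs to the numeral iff a digit 1 occurs there or higher. *)
Lemma up_log_bits a N : a < 2 ^ N ->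
  up_log 2 a.+1 =
  count (fun i => has (fun j => (i <= j) && bit a j) (iota 0 N)) (iota 0 N).
Proof.
move=> ha; rewrite (eq_count (a2 := fun i => i < up_log 2 a.+1)); last first.
  by move=> i; rewrite has_bit // ltn_up_log.
by rewrite count_iota sum_ltn_min; apply/esym/minn_idPr/up_log_min.
Qed.

(** The highest position where the two rows differ decides. *)
Definition bits_lt N (a b : nat -> bool) :=
  has (fun j => [&& ~~ a j, b j & all (fun i => (j < i) ==> (a i == b i)) (iota 0 N)])
    (iota 0 N).

Lemma bits_ltP N a b : a < 2 ^ N -> b < 2 ^ N -> bits_lt N (bit a) (bit b) = (a < b).
Proof.
elim: N a b => [|N IH] a b ha hb; first by rewrite expn0 in ha hb; rewrite /bits_lt /=; lia.
have hS j : [&& ~~ bit a j.+1, bit b j.+1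
      & all (fun i => (j.+1 < i) ==> (bit a i == bit b i)) (iota 0 N.+1)] =
    [&& ~~ bit a./2 j, bit b./2 j
      & all (fun i => (j < i) ==> (bit a./2 i == bit b./2 i)) (iota 0 N)].
  rewrite !bitS all_iota0; congr [&& _, _ & _].
  by apply: eq_all => i; rewrite !bitS.
rewrite /bits_lt has_iota0 (eq_has hS) all_iota0.
have := IH _ _ (half_bound ha) (half_bound hb); rewrite /bits_lt => ->.
rewrite !bit0 (eq_all (a2 := fun i => bit a./2 i == bit b./2 i)); last by move=> i; rewrite !bitS.
rewrite ltnn /=.
have -> : all (fun i => bit a./2 i == bit b./2 i) (iota 0 N) = (a./2 == b./2).
  apply/allP/eqP => [h|-> //]; apply: (bit_eq (half_bound ha) (half_bound hb)) => j hj.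
  by apply/eqP/h; rewrite mem_iota.
rewrite -[in RHS](odd_double_half a) -[in RHS](odd_double_half b).
move: (odd a) (odd b) (a./2) (b./2) => p q c d.
by rewrite -!muln2; case: p; case: q; rewrite /= ?add0n ?add1n; case: (ltngtP c d) => h; lia.
Qed.

(** * Codes of instances *)

(** The arbitrary remainders make this form of injectivity pass to concatenations and lists. *)
Definition uniquely_prefixed (T : Type) (enc : T -> seq bool) : Prop :=
  forall a b s s', enc a ++ s = enc b ++ s' -> a = b /\ s = s'.

Lemma enc_seq_cons (T : Type) (enc : T -> seq bool) a l :
  enc_seq enc (a :: l) = true :: enc a ++ enc_seq enc l.
Proof. by rewrite /enc_seq /= catA. Qed.

Lemma enc_seq_nil (T : Type) (enc : T -> seq bool) : enc_seq enc [::] = [:: false].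
Proof. by []. Qed.

Lemma enc_seq_cons_cat (T : Type) (enc : T -> seq bool) a l s :
  enc_seq enc (a :: l) ++ s = true :: enc a ++ (enc_seq enc l ++ s).
Proof. by rewrite /enc_seq /= -!catA. Qed.

Section UniqueDecoding.

#[local] Arguments enc_seq : simpl never.

Lemma enc_seq_prefix (T : Type) (enc : T -> seq bool) :
  uniquely_prefixed enc -> uniquely_prefixed (enc_seq enc).
Proof.
move=> h; elim=> [|a l IH] [|b l'] s s'; rewrite ?enc_seq_cons_cat ?enc_seq_nil //.
  by case.
by move=> [] /h[-> /IH[-> ->]].
Qed.

Lemma bit_seq_inj a b :
  [seq bit a i | i <- iota 0 (up_log 2 a.+1)] =
  [seq bit b i | i <- iota 0 (up_log 2 b.+1)] -> a = b.
Proof.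
move=> h; have := congr1 size h; rewrite !size_map !size_iota => hs.
have ha := up_logP a.+1 (isT : 1 < 2); have hb := up_logP b.+1 (isT : 1 < 2).
rewrite -hs in hb h; apply: (bit_eq ha hb) => j hj.
by have := congr1 (nth false ^~ j) h; rewrite !(nth_map 0) ?size_iota // !nth_iota.
Qed.

Lemma enc_nat_prefix : uniquely_prefixed enc_nat.
Proof.
have h1 : uniquely_prefixed (fun b : bool => [:: b]) by move=> a b s s' [-> ->].
by move=> a b s s' /(enc_seq_prefix h1)[/bit_seq_inj-> ->].
Qed.

(* Endpoints and interval of an edge. *)
Definition quad := ((nat * nat) * (nat * nat))%type.

Definition enc_quad (q : quad) : seq bool :=
  enc_nat q.1.1 ++ enc_nat q.1.2 ++
  enc_seq (fun i => enc_nat i.1 ++ enc_nat i.2) [:: q.2].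

Definition code (n T r : nat) (l : seq quad) : seq bool :=
  nseq n true ++ [:: false] ++ enc_nat T ++ enc_nat r ++ enc_seq enc_quad l.

Lemma enc_quad_prefix : uniquely_prefixed enc_quad.
Proof.
move=> [[a b] [c d]] [[a' b'] [c' d']] s s'; rewrite /enc_quad.
rewrite -!(catA (enc_nat _)).
case/enc_nat_prefix=> [/= -> /enc_nat_prefix[/= ->]].
rewrite -!(catA (enc_nat _)) => -[].
by case/enc_nat_prefix=> [/= -> /enc_nat_prefix[/= -> []]].
Qed.

Lemma code_inj n T r l n' T' r' l' : code n T r l = code n' T' r' l' ->
  [/\ n = n', T = T', r = r' & l = l'].
Proof.
rewrite /code; elim: n n' => [|n IH] [|n'] //=.
  case=> /enc_nat_prefix[-> /enc_nat_prefix[-> h]].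
  move: h; rewrite -[enc_seq _ l]cats0 -[enc_seq _ l']cats0.
  by case/(enc_seq_prefix enc_quad_prefix) => ->.
by case=> /IH[-> -> -> ->].
Qed.

End UniqueDecoding.

(** The endpoints of an edge may be listed in either order; the sorted pair identifies it. *)
Definition ukey (q : quad) : nat * nat := (minn q.1.1 q.1.2, maxn q.1.1 q.1.2).

Definition touching (p q : quad) : bool :=
  [|| p.1.1 == q.1.1, p.1.1 == q.1.2, p.1.2 == q.1.1 | p.1.2 == q.1.2].

Definition meeting (p q : quad) : bool := (p.2.1 < q.2.2) && (q.2.1 < p.2.2).

Definition compatible (sel : pred quad) (l : seq quad) : Prop :=
  forall p q, p \in l -> q \in l -> sel p -> sel q -> p != q ->
  touching p q -> ~~ meeting p q.

(** Yes-instances over plain numbers: the matching is a predicate on listed edges, a form that a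
    certificate can tabulate and the gadget can satisfy directly. *)
Record valid (n T r : nat) (l : seq quad) : Prop := Valid {
  valid_range : forall q, q \in l ->
    [/\ q.1.1 < n, q.1.2 < n, q.2.1 < q.2.2 & q.2.2 <= T];
  valid_color : exists col : nat -> bool, forall q, q \in l -> col q.1.1 != col q.1.2;
  valid_uniq : uniq [seq ukey q | q <- l];
  valid_degree : forall w, count (fun q => (q.1.1 == w) || (q.1.2 == w)) l <= 3;
  valid_pos : 0 < r;
  valid_matching : exists2 sel, count sel l = r & compatible sel l }.

Lemma uniq_map_factor (A B C : eqType) (f : A -> B) (g : A -> C) s :
  uniq (map f s) -> {in s &, forall a b, g a = g b -> f a = f b} -> uniq (map g s).
Proof.
elim: s => //= a s IH /andP[ha hs] h; rewrite IH //; last first.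
  by move=> b c hb hc; apply: h; rewrite inE ?hb ?hc orbT.
rewrite andbT; apply/negP => /mapP[b hb hg]; case/negP: ha.
by rewrite (h a b _ _ hg) ?map_f // !inE ?eqxx ?hb ?orbT.
Qed.

Lemma uniq_map_inj (A B : eqType) (f : A -> B) s :
  uniq (map f s) -> {in s &, injective f}.
Proof.
elim: s => //= c s IH /andP[hc hs] a b; rewrite !inE.
case/predU1P=> [->|ha] /predU1P[->|hb] // e.
- by case/negP: hc; rewrite e map_f.
- by case/negP: hc; rewrite -e map_f.
- exact: IH.
Qed.

Lemma set2_eq_cases (T : finType) (a b c d : T) : [set a; b] = [set c; d] ->
  (a = c /\ b = d) \/ (a = d /\ b = c).
Proof.
move=> h.
have ha : a \in [set c; d] by rewrite -h !inE eqxx.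
have hb : b \in [set c; d] by rewrite -h !inE eqxx orbT.
have hc : c \in [set a; b] by rewrite h !inE eqxx.
have hd : d \in [set a; b] by rewrite h !inE eqxx orbT.
move: ha hb hc hd; rewrite !inE => /orP[]/eqP-> /orP[]/eqP->; rewrite ?orbb.
- by move=> _ /eqP->; left.
- by left.
- by right.
- by move=> /eqP->; right.
Qed.

Lemma enc_seq_unit (T : Type) (s : seq T) :
  enc_seq (fun=> [::]) s = nseq (size s) true ++ [:: false].
Proof. by elim: s => // a s IH; rewrite enc_seq_cons IH. Qed.

Definition edge_quad n (G : temporal_graph 'I_n) (e : 'I_n * 'I_n) : quad :=
  ((e.1 : nat, e.2 : nat), head (0, 0) (intervals G [set e.1; e.2])).

Lemma enc_instance_code n (G : temporal_graph 'I_n) es r :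
  lists_edges G es -> (forall e, e \in edges G -> size (intervals G e) = 1) ->
  enc_instance G es r = code n (lifetime G) r [seq edge_quad G e | e <- es].
Proof.
move=> hes h1; rewrite /enc_instance /code.
rewrite enc_seq_unit size_enum_ord.
rewrite -[LHS]catA; do 4 congr (_ ++ _).
have : {in es, forall e, size (intervals G [set e.1; e.2]) = 1}.
  move=> e he; apply: h1; rewrite -mem_enum -(perm_mem hes).
  exact: (map_f (fun e => [set e.1; e.2])).
elim: es {hes} => // e es IH h; rewrite /= !enc_seq_cons IH; last first.
  by move=> e' he'; apply: h; rewrite inE he' orbT.
congr (_ :: (_ ++ _)); rewrite /enc_edge /enc_quad /=.
have := h e (mem_head _ _); by case: (intervals G _) => [|i [|]].
Qed.

Lemma valid_of_instance n (G : temporal_graph 'I_n) es r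
    (M : {set {set 'I_n}}) :
  lists_edges G es -> TMBD3B_1 G -> 0 < r -> timed_matching G M -> #|M| = r ->
  valid n (lifetime G) r [seq edge_quad G e | e <- es].
Proof.
move=> hes [[c hc] hdeg h1] hr [hM hov] hcard.
pose S (e : 'I_n * 'I_n) := [set e.1; e.2].
pose Q (e : 'I_n * 'I_n) : quad :=
  ((e.1 : nat, e.2 : nat), head (0, 0) (intervals G (S e))).
rewrite -[map _ es]/(map Q es).
have hmem e : e \in es -> S e \in edges G.
  by move=> he; rewrite -mem_enum -(perm_mem hes) (map_f S).
have huS : uniq (map S es) by rewrite (perm_uniq hes) enum_uniq.
have hne e : e \in es -> e.1 != e.2.
  by move=> /hmem /edges_card2; rewrite cards2; case: eqP.
have hint e : e \in es -> intervals G (S e) = [:: (Q e).2].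
  by move=> /hmem /h1; rewrite /Q /=; case: (intervals G _) => [|i [|]].
have hSk : {in es &, forall e e', ukey (Q e) = ukey (Q e') -> S e = S e'}.
  move=> [a b] [a' b'] _ _; rewrite /ukey /Q /S /= => -[h2 h3].
  have [[ea eb]|[ea eb]] : (a = a' :> nat /\ b = b' :> nat) \/ (a = b' :> nat /\ b = a' :> nat) by lia.
    by rewrite (val_inj ea) (val_inj eb).
  by rewrite (val_inj ea) (val_inj eb) setUC.
split=> //.
- move=> _ /mapP[e he ->]; have := intervals_valid (hmem e he).
  rewrite hint // /valid_intervals /Q /= !andbT !ltn_ord => /andP[-> ->].
  by split.
- exists (fun k => if insub k is Some i then c i else false) => _ /mapP[e he ->].
  by rewrite /Q /= !valK; apply: hc; apply: hmem.
- rewrite -map_comp; exact: uniq_map_factor huS hSk.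
- move=> w; rewrite count_map.
  case: (ltnP w n) => hw; last first.
    rewrite (eq_count (a2 := pred0)) ?count_pred0 // => e /=.
    by apply/negP => /orP[] /eqP h; have := ltn_ord e.1; have := ltn_ord e.2; lia.
  pose u : 'I_n := Ordinal hw.
  pose o (e : 'I_n * 'I_n) := if e.1 == u then e.2 else e.1.
  rewrite (eq_count (a2 := fun e => (e.1 == u) || (e.2 == u))) //.
  rewrite -size_filter; set s := filter _ es.
  have hs e : e \in s -> e \in es /\ S e = [set u; o e].
    rewrite mem_filter => /andP[/= h he]; split=> //; rewrite /S /o.
    by case: eqP h => [->|_ /= /eqP->] //; rewrite setUC.
  (* Edges at [u] are counted through their other endpoints, which determine them. *)
  have huo : uniq (map o s).
    apply: (@uniq_map_factor _ _ _ S); last first.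
      by move=> e e' /hs[_ ->] /hs[_ ->] ->.
    by apply: subseq_uniq huS; apply: map_subseq; apply: filter_subseq.
  rewrite -(size_map o) -(card_uniqP huo); apply: leq_trans (hdeg u).
  apply: subset_leq_card; apply/subsetP => _ /mapP[e /hs[he hS] ->].
  by rewrite inE /underlying -hS hmem.
- pose sel (q : quad) := [exists e : 'I_n * 'I_n,
    (((e.1 : nat), (e.2 : nat)) == q.1) && (S e \in M)].
  have hsel e : sel (Q e) = (S e \in M).
    apply/existsP/idP => [[e' /andP[/eqP h hin]]|h]; last by exists e; rewrite eqxx.
    move: h => -[/val_inj ha /val_inj hb].
    by rewrite /S -ha -hb.
  exists sel.
    rewrite count_map (eq_count (a2 := preim S (mem M))); last by move=> e; rewrite /= hsel.
    rewrite -count_map -hcard; move/permP: hes => /(_ (mem M)) ->.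
    rewrite -size_filter cardE; apply: perm_size; apply: uniq_perm.
    + by rewrite filter_uniq ?enum_uniq.
    + exact: enum_uniq.
    + move=> E; rewrite mem_filter !mem_enum /=.
      by case h : (E \in M) => //=; apply: (subsetP hM).
  move=> _ _ /mapP[e he ->] /mapP[e' he' ->]; rewrite !hsel => hin hin' hneq ht.
  apply/negP => hm; apply: (hov _ _ hin hin'); split.
  + apply/eqP => /(uniq_map_inj huS he he') hee; by rewrite hee eqxx in hneq.
  + have hI (a : 'I_n) : a \in S e -> a \in S e' -> S e :&: S e' != set0.
      by move=> ha ha'; apply/set0Pn; exists a; rewrite inE ha ha'.
    by case/or4P: ht => /eqP/val_inj h;
      [apply: (hI e.1) | apply: (hI e.1) | apply: (hI e.2) | apply: (hI e.2)];
      rewrite /S !inE ?h ?eqxx ?orbT.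
  + have hlt e0 : e0 \in es -> (Q e0).2.1 < (Q e0).2.2.
      move=> h0; have := intervals_valid (hmem e0 h0).
      by rewrite hint // /valid_intervals => /and3P[_ /= /andP[]].
    (* Two intervals that meet share the later of their starts. *)
    exists (maxn (Q e).2.1 (Q e').2.1); rewrite /exists_at !hint //.
    move: hm (hlt e he) (hlt e' he'); rewrite /meeting.
    by case: (Q e) (Q e') => [_ [s f]] [_ [s' f']] /=; lia.
Qed.

Lemma instance_of_valid n T r l : valid n T r l -> D_MAX_01_TMBD3B_1 (code n T r l).
Proof.
case=> hrange [col hcol] huniq hdeg hr [sel hsel hcomp].
(* A positive [r] requires an edge, hence a node, and [inord] needs an inhabited node type. *)
have [n' en] : exists n', n = n'.+1.
  case: (n) hrange => [|n'] hrange; last by exists n'.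
  case: (l) hsel hrange => [|q l'] hsel hrange; first by rewrite -hsel in hr.
  by have [] := hrange q (mem_head _ _).
subst n.
pose E (q : quad) : 'I_n'.+1 * 'I_n'.+1 := (inord q.1.1, inord q.1.2).
pose S (q : quad) := [set (E q).1; (E q).2].
have h1 q : q \in l -> (E q).1 = q.1.1 :> nat by move=> /hrange[h *]; rewrite inordK.
have h2 q : q \in l -> (E q).2 = q.1.2 :> nat by move=> /hrange[_ h *]; rewrite inordK.
have hne q : q \in l -> (E q).1 != (E q).2.
  move=> hq; rewrite -val_eqE /= h1 // h2 //.
  by apply/eqP => e; move: (hcol q hq); rewrite e eqxx.
have hSk : {in l &, forall q q', S q = S q' -> ukey q = ukey q'}.
  move=> q q' hq hq' /set2_eq_cases h; rewrite /ukey -!h1 // -!h2 //.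
  by case: h => -[-> ->] //; rewrite minnC maxnC.
have huS : uniq (map S l) by apply: uniq_map_factor huniq hSk.
have hSi := uniq_map_inj huS.
pose int X := if [seq q <- l | S q == X] is q :: _ then [:: q.2] else [::].
have hint q : q \in l -> int (S q) = [:: q.2].
  move=> hq; rewrite /int.
  case e : [seq _ <- _ | _] => [|q' s].
    by have : q \in [seq q' <- l | S q' == S q]; [rewrite mem_filter eqxx | rewrite e].
  have : q' \in [seq q' <- l | S q' == S q] by rewrite e mem_head.
  by rewrite mem_filter => /andP[/eqP h hq']; rewrite (hSi _ _ hq' hq h).
pose ed : {set {set 'I_n'.+1}} := [set X in map S l].
have edP X : X \in ed -> exists2 q, q \in l & X = S q.
  by rewrite inE => /mapP[q hq ->]; exists q.
have hed q : q \in l -> S q \in ed by move=> hq; rewrite inE map_f.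
have c1 X : X \in ed -> #|X| = 2.
  by move=> /edP[q /hne hq ->]; rewrite cards2 hq.
have c2 X : X \in ed -> valid_intervals T (int X).
  move=> /edP[q hq ->]; rewrite hint // /valid_intervals /= !andbT.
  by have [_ _ -> ->] := hrange q hq.
pose G := TemporalGraph c1 c2.
have hle : lists_edges G (map E l).
  rewrite /lists_edges -map_comp; apply: uniq_perm => //; first exact: enum_uniq.
  by move=> X; rewrite mem_enum inE.
have hsize X : X \in edges G -> size (intervals G X) = 1.
  by move=> /edP[q hq ->]; rewrite /= hint.
exists n'.+1, G, (map E l), r; split=> //.
- split=> //; rewrite enc_instance_code // -map_comp map_id_in //.
  move=> q hq; rewrite /= /edge_quad /= -/(S q) hint // !inordK //.
    by case: q {hq} => [[]].
  by have [] := hrange q hq.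
  by have [] := hrange q hq.
- split=> //.
    exists (fun i : 'I_n'.+1 => col i) => u v /edP[q hq /set2_eq_cases h].
    have := hcol q hq; rewrite -h1 // -h2 //.
    by case: h => -[-> ->] //; rewrite eq_sym.
  move=> u; apply: leq_trans (hdeg u); rewrite -size_filter.
  set s := filter _ l.
  pose o (q : quad) := if (E q).1 == u then (E q).2 else (E q).1.
  rewrite -(size_map o); apply: leq_trans (card_size _).
  apply: subset_leq_card; apply/subsetP => v; rewrite inE => /edP[q hq hqs].
  apply/mapP; exists q; rewrite ?mem_filter ?hq /o -?h1 -?h2 //.
    by case: (set2_eq_cases hqs) => -[-> _]; rewrite eqxx ?orbT.
  case: (set2_eq_cases hqs) => -[e1 e2]; first by rewrite -e1 eqxx.
  by rewrite e2; case: eqP => // ->.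
- pose M : {set {set 'I_n'.+1}} := [set X in map S (filter sel l)].
  have MP X : X \in M -> exists q, [/\ q \in l, sel q & X = S q].
    by rewrite inE => /mapP[q]; rewrite mem_filter => /andP[hs hq] ->; exists q.
  exists M; split.
    split; first by apply/subsetP => X /MP[q [hq _ ->]]; apply: hed.
    move=> X Y /MP[p [hp sp ->]] /MP[q [hq sq ->]] [hneq hI [t]].
    rewrite /exists_at /= !hint //= !orbF => /andP[ht ht'].
    have hpq : p != q by apply: contra hneq => /eqP->.
    have ht2 : touching p q.
      case/set0Pn: hI => a; rewrite inE /S !inE -!val_eqE /= !h1 // !h2 //.
      by rewrite /touching => /andP[/orP[]/eqP-> /orP[]->]; rewrite ?orbT.
    case/negP: (hcomp p q hp hq sp sq hpq ht2).
    by rewrite /meeting; lia.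
  have huM : uniq (map S (filter sel l)).
    by apply: subseq_uniq huS; apply/map_subseq/filter_subseq.
  rewrite -hsel -size_filter -(size_map S) -(card_uniqP huM).
  by apply: eq_card => X; rewrite inE.
Qed.

Theorem D_MAX_01_TMBD3B_1P w : D_MAX_01_TMBD3B_1 w <->
  exists n T r l, w = code n T r l /\ valid n T r l.
Proof.
split=> [[n [G [es [r [[hes ->] htm hr [M [hM hcard]]]]]]]|[n [T [r [l [-> h]]]]]].
  exists n, (lifetime G), r, [seq edge_quad G e | e <- es]; split.
    by apply: enc_instance_code => //; case: htm.
  exact: valid_of_instance hes htm hr hM hcard.
exact: instance_of_valid.
Qed.

(** * Membership in NP *)

(** The comparisons involving interval bounds are parameters, since the verifier compares rows of
    bits where the proofs compare numbers. *)
Definition check (n m r : nat) (u v : nat -> nat) (lt_sf : nat -> nat -> bool)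
    (lt_Tf : nat -> bool) (col sel : nat -> bool) : bool :=
  [&& all (fun k => [&& u k < n, v k < n, ~~ (col (u k) == col (v k)), lt_sf k k
                     & ~~ lt_Tf k]) (iota 0 m),
   all (fun k => all (fun k' => (k < k') ==>
     ~~ (((u k == u k') && (v k == v k')) || ((u k == v k') && (v k == u k'))))
     (iota 0 m)) (iota 0 m),
   all (fun w => count (fun k => (u k == w) || (v k == w)) (iota 0 m) <= 3) (iota 0 n),
   0 < r, count sel (iota 0 m) == r
 & all (fun k => all (fun k' =>
     [&& sel k, sel k', ~~ (k == k')
       & [|| u k == u k', u k == v k', v k == u k' | v k == v k']] ==>
     ~~ (lt_sf k k' && lt_sf k' k)) (iota 0 m)) (iota 0 m)].

Lemma check_valid n m T r u v s f col sel :
  check n m r u v (fun k k' => s k < f k') (fun k => T < f k) col sel ->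
  valid n T r [seq ((u k, v k), (s k, f k)) | k <- iota 0 m].
Proof.
case/and5P=> /allP h1 /allP h2 /allP h3 hr /andP[/eqP h4 /allP h5].
pose Q k : quad := ((u k, v k), (s k, f k)); rewrite -[map _ _]/(map Q (iota 0 m)).
have hne k k' : k < k' -> k' < m -> ukey (Q k) != ukey (Q k').
  move=> hk hk'; have hkm : k < m by apply: ltn_trans hk'.
  have := allP (h2 k _) k'; rewrite !mem_iota hkm hk' => /(_ isT isT); rewrite hk /=.
  by apply: contra => /eqP[]; rewrite /=; lia.
have hneq k k' : k < m -> k' < m -> k != k' -> ukey (Q k) != ukey (Q k').
  move=> hk hk'; case: (ltngtP k k') => // h _; first exact: hne.
  by rewrite eq_sym; apply: hne.
have hinj : {in iota 0 m &, injective Q}.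
  move=> k k'; rewrite !mem_iota /= !add0n => hk hk' e.
  by apply/eqP; apply: contraT => /(hneq _ _ hk hk'); rewrite e eqxx.
split=> //.
- move=> _ /mapP[k hk ->]; have /and5P[-> -> _ -> ] := h1 k hk.
  by rewrite -leqNgt.
- exists col => _ /mapP[k hk ->]; by have /and5P[_ _ ->] := h1 k hk.
- rewrite -map_comp map_inj_in_uniq ?iota_uniq // => k k'.
  rewrite !mem_iota /= !add0n => hk hk' e.
  by apply/eqP; apply: contraT => /(hneq _ _ hk hk'); rewrite e eqxx.
- move=> w; rewrite count_map.
  case: (ltnP w n) => hw; first by apply: (h3 w); rewrite mem_iota.
  rewrite (_ : count _ _ = 0) //; apply/eqP; rewrite -leqn0 leqNgt -has_count.
  apply/hasPn => k hk /=; have /and5P[hu hv _ _ _] := h1 k hk.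
  by apply/negP; lia.
- exists (fun q => has (fun k => (Q k == q) && sel k) (iota 0 m)).
    rewrite count_map -h4; apply: eq_in_count => k hk /=.
    apply/hasP/idP => [[k' hk' /andP[/eqP e hs]]|hs]; last by exists k; rewrite ?eqxx.
    by rewrite -(hinj _ _ hk' hk e).
  move=> p q _ _ /hasP[k hk /andP[/eqP<- sk]] /hasP[k' hk' /andP[/eqP<- sk']] hpq ht.
  have := allP (h5 k hk) k' hk'; rewrite sk sk'.
  have -> : ~~ (k == k') by apply: contra hpq => /eqP->.
  by move: ht; rewrite /touching /meeting /= => ->.
Qed.

Lemma valid_check n T r l (q0 := ((0, 0), (0, 0)) : quad) : valid n T r l ->
  exists col sel : nat -> bool,
  [/\ forall k, col k -> k < n, forall k, sel k -> k < size l
    & check n (size l) r (fun k => (nth q0 l k).1.1) (fun k => (nth q0 l k).1.2)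
       (fun k k' => (nth q0 l k).2.1 < (nth q0 l k').2.2)
       (fun k => T < (nth q0 l k).2.2) col sel].
Proof.
case=> h1 [col hcol] huniq hdeg hr [sel hsel hcomp].
have hnth k : k \in iota 0 (size l) -> nth q0 l k \in l.
  by rewrite mem_iota => /= h; apply: mem_nth.
have hneq k k' : k \in iota 0 (size l) -> k' \in iota 0 (size l) -> k != k' ->
    ukey (nth q0 l k) != ukey (nth q0 l k').
  rewrite !mem_iota => /= hk hk' hne.
  rewrite -!(nth_map q0 (ukey q0) ukey) // nth_uniq ?size_map //.
have hcount (a : pred quad) : count (fun k => a (nth q0 l k)) (iota 0 (size l)) = count a l.
  by rewrite -(count_map (nth q0 l) a) map_nth_iota0 // take_size.
(* Both predicates are cut off so that a finite table determines them. *)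
exists (fun k => (k < n) && col k), (fun k => (k < size l) && sel (nth q0 l k)).
split=> [k /andP[]//|k /andP[]//|].
apply/and5P; split=> //.
- apply/allP => k /hnth hk; have [-> -> -> hT] := h1 _ hk.
  by rewrite -leqNgt hT andbT /= hcol.
- apply/allP => k hk; apply/allP => k' hk'; apply/implyP => hlt.
  have := hneq k k' hk hk'; rewrite neq_ltn hlt => /(_ isT); apply: contra => h.
  by apply/eqP; rewrite /ukey; congr pair; lia.
- apply/allP => w _; apply: leq_trans (hdeg w).
  by rewrite (hcount (fun q => (q.1.1 == w) || (q.1.2 == w))).
- apply/andP; split.
    rewrite -hsel -(hcount sel); apply/eqP/eq_in_count => k.
    by rewrite mem_iota => /= ->.
  apply/allP => k hk; apply/allP => k' hk'; apply/implyP.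
  case/and4P=> /andP[_ sk] /andP[_ sk'] hne ht.
  apply: (hcomp _ _ (hnth k hk) (hnth k' hk')) => //.
  by apply: contra (hneq k k' hk hk' hne) => /eqP->.
Qed.

(** * Certificates as tables of bits *)

Fixpoint row_val (N : nat) (row : nat -> bool) : nat :=
  if N is N'.+1 then row 0 + (row_val N' (fun j => row j.+1)).*2 else 0.

Lemma row_val_bound N row : row_val N row < 2 ^ N.
Proof.
elim: N row => // N IH row; rewrite expnS /=.
by have := IH (fun j => row j.+1); case: (row 0); lia.
Qed.

Lemma bit_row_val N row j : j < N -> bit (row_val N row) j = row j.
Proof.
elim: N row j => // N IH row [|j] hj /=.
  by rewrite bit0 oddD odd_double addbF; case: (row 0).
by rewrite bitS half_bit_double IH.
Qed.

Lemma bits_lt_row_val N r r' : bits_lt N r r' = (row_val N r < row_val N r').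
Proof.
rewrite -(bits_ltP (row_val_bound N r) (row_val_bound N r')).
apply: eq_in_has => j; rewrite mem_iota => /= hj; rewrite !bit_row_val //.
congr [&& _, _ & _]; apply: eq_in_all => i; rewrite mem_iota => /= hi.
by rewrite !bit_row_val.
Qed.

Definition enc_row (N : nat) (row : nat -> bool) : seq bool :=
  flatten [seq [:: true] ++ [:: row j] | j <- iota 0
    (count (fun i => has (fun j => (i <= j) && row j) (iota 0 N)) (iota 0 N))]
  ++ [:: false].

Lemma enc_rowE N row : enc_row N row = enc_nat (row_val N row).
Proof.
rewrite /enc_row /enc_nat /enc_seq /digits -map_comp (up_log_bits (row_val_bound N row)).
have -> : count (fun i => has (fun j => (i <= j) && bit (row_val N row) j) (iota 0 N)) (iota 0 N)
  = count (fun i => has (fun j => (i <= j) && row j) (iota 0 N)) (iota 0 N).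
  apply: eq_count => i; apply: eq_in_has => j; rewrite mem_iota => /= hj.
  by rewrite bit_row_val.
congr (flatten _ ++ _); apply/eq_in_map => j; rewrite mem_iota => /= hj.
rewrite -[odd _]/(bit _ j) bit_row_val //; apply: leq_trans hj _.
by apply: leq_trans (count_size _ _) _; rewrite size_iota.
Qed.

(* Bit [j] of row [k] of the table [tag] in the certificate [w.2]; rows and
   tables have dimension [size w.1], the length of the instance. *)
Definition cellw (w : seq bool * seq bool) (tag k j : nat) : bool :=
  [&& k < size w.1, j < size w.1
    & nth false w.2 ((tag * size w.1 + k) * size w.1 + j)].

Definition rowsum (w : seq bool * seq bool) (tag k : nat) : nat :=
  count (cellw w tag k) (iota 0 (size w.1)).

Definition verify (w : seq bool * seq bool) : bool :=
  (w.1 == nseq (rowsum w 0 0) true ++ [:: false] ++ enc_row (size w.1) (cellw w 3 0) ++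
     enc_nat (rowsum w 2 0) ++
     flatten [seq [:: true] ++ enc_nat (rowsum w 4 k) ++ enc_nat (rowsum w 5 k) ++
        [:: true] ++ enc_row (size w.1) (cellw w 6 k) ++
        enc_row (size w.1) (cellw w 7 k) ++ [:: false] | k <- iota 0 (rowsum w 1 0)] ++
     [:: false]) &&
  check (rowsum w 0 0) (rowsum w 1 0) (rowsum w 2 0) (rowsum w 4) (rowsum w 5)
    (fun k k' => bits_lt (size w.1) (cellw w 6 k) (cellw w 7 k'))
    (fun k => bits_lt (size w.1) (cellw w 3 0) (cellw w 7 k))
    (cellw w 8 0) (cellw w 9 0).

Lemma def_cellw tag k j : definable k -> definable j ->
  decidable_by (fun g => cellw g.1 tag (k g) (j g)).
Proof.
move=> hk hj.
have h : decidable_by (fun g => [&& k g < size (word false g), j g < size (word false g)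
  & nth false (word true g) ((tag * size (word false g) + k g) * size (word false g) + j g)]).
  def.
exact: h.
Qed.

Lemma def_size1 : definable (fun g => size g.1.1).
Proof. exact: (def_size false). Qed.

Lemma def_rowsum tag k : definable k -> definable (fun g => rowsum g.1 tag (k g)).
Proof.
move=> hk; apply: (@def_count (fun g => size g.1.1) (fun g j => cellw g.1 tag (k g) j)).
  exact: def_size1.
exact: def_cellw (def_pop hk) def_top.
Qed.

Ltac def_user ::=
  lazymatch goal with
  | |- definable (fun g => nat_of_bool (cellw _ ?tag (@?k g) (@?j g))) =>
      apply (@def_cellw tag k j)
  | |- definable (fun g => rowsum _ ?tag (@?k g)) => apply (@def_rowsum tag k)
  | |- definable (fun g => size _) => exact def_size1
  end.

Lemma def_bits_lt tag tag' k k' : definable k -> definable k' ->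
  decidable_by (fun g => bits_lt (size g.1.1) (cellw g.1 tag (k g)) (cellw g.1 tag' (k' g))).
Proof. by move=> hk hk'; rewrite /bits_lt; def. Qed.

Lemma wdef_enc_row tag k : definable k ->
  wdefinable (fun g => enc_row (size g.1.1) (cellw g.1 tag (k g))).
Proof. by move=> hk; rewrite /enc_row; wdef; def. Qed.

Ltac def_user ::=
  lazymatch goal with
  | |- definable (fun g => nat_of_bool (cellw _ ?tag (@?k g) (@?j g))) =>
      apply (@def_cellw tag k j)
  | |- definable (fun g => rowsum _ ?tag (@?k g)) => apply (@def_rowsum tag k)
  | |- definable (fun g => nat_of_bool (bits_lt _ (cellw _ ?tag (@?k g)) (cellw _ ?tag' (@?k' g)))) =>
      apply (@def_bits_lt tag tag' k k')
  | |- definable (fun g => size _) => exact def_size1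
  end.

Ltac wdef_user ::=
  lazymatch goal with
  | |- wdefinable (fun g => enc_row _ (cellw _ ?tag (@?k g))) => apply (@wdef_enc_row tag k)
  end.

Lemma def_verify : decidable_by (fun g => verify g.1).
Proof.
rewrite /verify; apply: def_and; last by rewrite /check; def.
apply: wdef_eq; first exact: (wdef_word false).
wdef; def.
Qed.

Lemma verifyE w (N := size w.1) : verify w =
  (w.1 == code (rowsum w 0 0) (row_val N (cellw w 3 0)) (rowsum w 2 0)
     [seq ((rowsum w 4 k, rowsum w 5 k),
           (row_val N (cellw w 6 k), row_val N (cellw w 7 k))) | k <- iota 0 (rowsum w 1 0)]) &&
  check (rowsum w 0 0) (rowsum w 1 0) (rowsum w 2 0) (rowsum w 4) (rowsum w 5)
    (fun k k' => row_val N (cellw w 6 k) < row_val N (cellw w 7 k'))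
    (fun k => row_val N (cellw w 3 0) < row_val N (cellw w 7 k))
    (cellw w 8 0) (cellw w 9 0).
Proof.
rewrite /verify /code /enc_seq -map_comp enc_rowE; congr (_ && _).
  congr (_ == _ ++ _ ++ _ ++ _ ++ flatten _ ++ _).
  apply: eq_map => k; rewrite /= !enc_rowE /enc_quad /enc_seq /=.
  by rewrite -!catA.
congr check.
  apply: functional_extensionality => k; apply: functional_extensionality => k'.
  exact: bits_lt_row_val.
apply: functional_extensionality => k; exact: bits_lt_row_val.
Qed.

Lemma verify_sound w : verify w -> D_MAX_01_TMBD3B_1 w.1.
Proof.
rewrite verifyE => /andP[/eqP hw hc]; apply/D_MAX_01_TMBD3B_1P.
do 4 eexists; split; [exact: hw | exact: check_valid hc].
Qed.

Lemma enc_nat_bound a : a < 2 ^ size (enc_nat a).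
Proof.
apply: leq_trans (up_logP a.+1 (isT : 1 < 2)) _; rewrite leq_exp2l //.
rewrite /enc_nat /enc_seq size_cat /digits -map_comp.
by rewrite (size_flatten_iota (fun i => [:: true; bit a i])) /= sum_nat_const card_ord; lia.
Qed.

Lemma size_enc_quad_le l q : q \in l -> size (enc_quad q) <= size (enc_seq enc_quad l).
Proof.
elim: l => // p l IH; rewrite inE enc_seq_cons /= size_cat.
by case/predU1P=> [->|/IH]; lia.
Qed.

Lemma size_enc_seq_ge l : size l <= size (enc_seq enc_quad l).
Proof. by elim: l => // p l IH; rewrite enc_seq_cons /= size_cat; lia. Qed.

Lemma count_ltn N c : c <= N -> count (fun j => j < c) (iota 0 N) = c.
Proof. by move=> h; rewrite count_iota sum_ltn_min; apply/minn_idPr. Qed.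

Lemma verify_complete n T r l : valid n T r l ->
  let x := code n T r l in
  exists2 y, size y = 10 * size x * size x & verify (x, y).
Proof.
move=> hv x; set N := size x.
have [col [sel [hcol hsel hcheck]]] := valid_check hv.
move: hcheck; set q0 : quad := ((0, 0), (0, 0)).
set u := fun k => (nth q0 l k).1.1; set v := fun k => (nth q0 l k).1.2.
pose s k := (nth q0 l k).2.1; pose f k := (nth q0 l k).2.2.
rewrite -/(fun k k' => s k < f k') => hcheck.
have hx : N = n + (1 + (size (enc_nat T) + (size (enc_nat r) + size (enc_seq enc_quad l)))).
  by rewrite /N /x /code !size_cat size_nseq.
have hl := size_enc_seq_ge l.
have hn : n <= N by lia.
have hm : size l <= N by lia.
have hT : T < 2 ^ N.
  by apply: leq_trans (enc_nat_bound T) _; rewrite leq_exp2l //; lia.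
(* Although [r] is written in binary, it counts listed edges, each of which contributes to the
   length of the code. *)
have hr : r <= N.
  by case: hv => _ _ _ _ _ [se <- _]; apply: leq_trans (count_size _ _) hm.
have hq k : [/\ u k <= N, v k <= N, s k < 2 ^ N & f k < 2 ^ N].
  case: (ltnP k (size l)) => hk; last by rewrite /u /v /s /f nth_default // expn_gt0.
  have hin := mem_nth q0 hk.
  have [h1 h2 _ _] := valid_range hv hin.
  have hsz : size (enc_quad (nth q0 l k)) <= N.
    by rewrite hx; apply: leq_trans (size_enc_quad_le hin) _; rewrite !addnA leq_addl.
  have e : size (enc_quad (nth q0 l k)) =
      size (enc_nat (u k)) + size (enc_nat (v k)) + size (enc_nat (s k)) + size (enc_nat (f k)) + 2.
    by rewrite /enc_quad /enc_seq /= !size_cat /= !size_cat /= -/(s k) -/(f k) -/(u k) -/(v k); lia.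
  rewrite e in hsz.
  split; [exact: leq_trans (ltnW h1) hn | exact: leq_trans (ltnW h2) hn | |].
    by apply: leq_trans (enc_nat_bound _) _; rewrite leq_exp2l //; lia.
  by apply: leq_trans (enc_nat_bound _) _; rewrite leq_exp2l //; lia.
pose body tag k j := match tag with
  | 0 => j < n | 1 => j < size l | 2 => j < r | 3 => bit T j
  | 4 => j < u k | 5 => j < v k | 6 => bit (s k) j | 7 => bit (f k) j
  | 8 => col j | _ => sel j end.
pose y := mkseq (fun p => body (p %/ N %/ N) ((p %/ N) %% N) (p %% N)) (10 * N * N).
exists y; first by rewrite size_mkseq.
have hcell tag k j : tag < 10 ->
    cellw (x, y) tag k j = [&& k < N, j < N & body tag k j].
  move=> ht; rewrite /cellw /= -/N; case: (ltnP k N) => //= hk; case: (ltnP j N) => //= hj.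
  have hN : 0 < N by apply: leq_ltn_trans hk.
  rewrite nth_mkseq; last by nia.
  by rewrite !divnMDl // !modnMDl (divn_small hj) addn0 !divnMDl // !modnMDl
     (divn_small hk) addn0 !modn_small.
have N0 : 0 < N by rewrite hx; lia.
(* Rows beyond [N] read as zero, like the default edge [q0]; so the tabulated functions are equal to
   [u], [v], [s] and [f] everywhere. *)
have hsum tag k c : tag < 10 -> (forall j, body tag k j = (j < c)) -> c <= N ->
    (N <= k -> c = 0) -> rowsum (x, y) tag k = c.
  move=> ht hb hc hk; rewrite /rowsum -/N.
  case: (ltnP k N) => hkN.
    rewrite -[RHS](count_ltn hc); apply: eq_in_count => j; rewrite mem_iota => /= hj.
    by rewrite hcell // hkN hj hb.
  rewrite (hk hkN) -[RHS](count_pred0 (iota 0 N)); apply: eq_count => j.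
  by rewrite hcell // ltnNge hkN.
have hrow tag k a : tag < 10 -> (forall j, body tag k j = bit a j) -> a < 2 ^ N ->
    (N <= k -> a = 0) -> row_val N (cellw (x, y) tag k) = a.
  move=> ht hb ha hk; apply: bit_eq (row_val_bound _ _) ha _ => j hj.
  rewrite bit_row_val // hcell // hj hb; case: (ltnP k N) => //= hkN.
  by rewrite (hk hkN) /bit div0n.
have e0 : rowsum (x, y) 0 0 = n by apply: hsum => //; lia.
have e1 : rowsum (x, y) 1 0 = size l by apply: hsum => //; lia.
have e2 : rowsum (x, y) 2 0 = r by apply: hsum => //; lia.
have e3 : row_val N (cellw (x, y) 3 0) = T by apply: hrow => //; lia.
have hdef k : N <= k -> nth q0 l k = q0 by move=> h; apply: nth_default; lia.
have e4 : rowsum (x, y) 4 = u.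
  apply: functional_extensionality => k; have [? _ _ _] := hq k.
  by apply: hsum => // /hdef h; rewrite /u h.
have e5 : rowsum (x, y) 5 = v.
  apply: functional_extensionality => k; have [_ ? _ _] := hq k.
  by apply: hsum => // /hdef h; rewrite /v h.
have e6 k : row_val N (cellw (x, y) 6 k) = s k.
  have [_ _ ? _] := hq k.
  by apply: hrow => // /hdef h; rewrite /s h.
have e7 k : row_val N (cellw (x, y) 7 k) = f k.
  have [_ _ _ ?] := hq k.
  by apply: hrow => // /hdef h; rewrite /f h.
have e8 : cellw (x, y) 8 0 = col.
  apply: functional_extensionality => j; rewrite hcell // N0 /=.
  by case hj : (col j); rewrite ?andbF // (leq_trans (hcol j hj) hn).
have e9 : cellw (x, y) 9 0 = sel.
  apply: functional_extensionality => j; rewrite hcell // N0 /=.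
  by case hj : (sel j); rewrite ?andbF // (leq_trans (hsel j hj) hm).
rewrite verifyE /= -/N e0 e1 e2 e3 e4 e5 e8 e9.
have -> : (fun k k' => row_val N (cellw (x, y) 6 k) < row_val N (cellw (x, y) 7 k')) =
    (fun k k' => s k < f k').
  by do 2 (apply: functional_extensionality => ?); rewrite e6 e7.
have -> : (fun k => T < row_val N (cellw (x, y) 7 k)) = (fun k => T < f k).
  by apply: functional_extensionality => ?; rewrite e7.
rewrite hcheck andbT (eq_map (g := nth q0 l)); last first.
  by move=> k; rewrite e6 e7 /u /v /s /f; case: (nth _ _ _) => [[? ?] [? ?]].
by rewrite map_nth_iota0 // take_size eqxx.
Qed.

Theorem D_MAX_in_NP : in_NP D_MAX_01_TMBD3B_1.
Proof.
apply: (@definable_in_NP _ _ ((10%N)%:P * 'X * 'X)%R def_verify) => x; split.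
  move=> /D_MAX_01_TMBD3B_1P[n [T [r [l [-> hv]]]]].
  have [y hy hver] := verify_complete hv.
  exists y; last by rewrite lt0b.
  by rewrite !hornerM hornerC hornerX hy.
by case=> y _; rewrite lt0b => /verify_sound.
Qed.

(** * From satisfiability to matchings *)

Section Gadget.

(* A formula in conjunctive normal form with variables [v < V] and clauses
   [c < C]: clause [c] contains [v] if [occ v c], positively iff [sgn v c]. *)
Variables (V C : nat) (occ sgn : nat -> nat -> bool).

Definition satisfiable : Prop := exists alpha : nat -> bool,
  forall c, c < C -> exists2 v, v < V & occ v c && (alpha v == sgn v c).

(** Kinds 0 and 1 alternate on the cycle of [v]. The path of [c] has [V] nodes of kind 2, separated
    by nodes of kind 3. *)
Definition node (v c k : nat) : nat := 4 * (v * C + c) + k.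

Definition prev_clause (c : nat) : nat := if c == 0 then C.-1 else c.-1.

(* For fixed [v], the kinds 0 and 1 form a cycle, all of whose edges exist at
   time 1; kind 0 is selected iff [v] is true.  For fixed [c], the kinds 3 and 4
   form a path; it cannot cover all the nodes [node v c 2], so that some edge of
   kind 2 is selected.  At time 0 that edge meets only the cycle edge that
   contradicts the literal. *)
Definition gadget_edge (x : nat * nat * nat) : quad :=
  let: (v, c, k) := x in
  match k with
  | 0 => ((node v c 0, node v c 1), if sgn v c then (1, 3) else (0, 2))
  | 1 => ((node v c 0, node v (prev_clause c) 1), if sgn v c then (0, 2) else (1, 3))
  | 2 => ((node v c 0, node v c 2), (0, 1))
  | 3 => ((node v c 3, node v c 2), (0, 1))
  | _ => ((node v c 3, node v.+1 c 2), (0, 1))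
  end.

Definition present (x : nat * nat * nat) : bool :=
  let: (v, c, k) := x in
  match k with 0 | 1 => true | 2 => occ v c | _ => v.+1 < V end.

Definition cells : seq (nat * nat) := [seq (v, c) | v <- iota 0 V, c <- iota 0 C].

Definition edge_index : seq (nat * nat * nat) :=
  [seq x <- [seq (p, k) | p <- cells, k <- iota 0 5] | present x].

Definition gadget : seq quad := map gadget_edge edge_index.

Lemma cellsP v c : ((v, c) \in cells) = (v < V) && (c < C).
Proof.
apply/allpairsP/andP => [[[a b] /= []]|[hv hc]].
  by rewrite !mem_iota => ha hb [-> ->].
by exists (v, c); rewrite /= !mem_iota.
Qed.

Lemma edge_indexP v c k :
  ((v, c, k) \in edge_index) = [&& v < V, c < C, k < 5 & present (v, c, k)].
Proof.
rewrite mem_filter andbC andbA andbA -cellsP; congr (_ && _).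
apply/allpairsP/andP => [[[p j] [hp]]|[hp hk]].
  by rewrite mem_iota => hj [-> ->].
by exists ((v, c), k); rewrite mem_iota.
Qed.

Lemma uniq_cells : uniq cells.
Proof. by rewrite allpairs_uniq ?iota_uniq // => -[a b] [a' b']. Qed.

Lemma uniq_edge_index : uniq edge_index.
Proof.
rewrite filter_uniq // allpairs_uniq ?iota_uniq ?uniq_cells //.
by move=> [a b] [a' b'] _ _ /= [-> ->].
Qed.

Lemma count_edge_index (a : pred (nat * nat * nat)) :
  count a edge_index =
  \sum_(v < V) \sum_(c < C) count (fun k => a (v : nat, c : nat, k) && present (v : nat, c : nat, k)) (iota 0 5).
Proof.
rewrite count_filter count_flatten -map_comp sumnE big_map big_allpairs.
have hi n : iota 0 n = index_iota 0 n by rewrite /index_iota subn0.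
rewrite (hi V) big_mkord; apply: eq_bigr => v _.
rewrite (hi C) big_mkord; apply: eq_bigr => c _.
exact: count_map.
Qed.

Hypotheses (V0 : 0 < V) (C1 : 1 < C).

Lemma node_inj v c k v' c' k' : c < C -> c' < C -> k < 4 -> k' < 4 ->
  node v c k = node v' c' k' -> [/\ v = v', c = c' & k = k'].
Proof.
rewrite /node => hc hc' hk hk' e.
have e1 : v * C + c = v' * C + c' by lia.
have ek : k = k' by lia.
have := congr1 (fun n => n %/ C) e1; have := congr1 (fun n => n %% C) e1.
by rewrite !modnMDl !divnMDl ?(ltnW C1) // !modn_small // !divn_small // !addn0.
Qed.

Lemma prev_clause_lt c : c < C -> prev_clause c < C.
Proof. by rewrite /prev_clause; case: eqP; lia. Qed.

Definition next_clause (c : nat) : nat := if c.+1 == C then 0 else c.+1.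

Lemma next_clause_lt c : c < C -> next_clause c < C.
Proof. by rewrite /next_clause; case: eqP; lia. Qed.

Lemma next_clauseK c : c < C -> prev_clause (next_clause c) = c.
Proof. by rewrite /prev_clause /next_clause; case: (c.+1 =P C) => [<-|]. Qed.

Lemma prev_clauseK c : c < C -> next_clause (prev_clause c) = c.
Proof.
rewrite /prev_clause /next_clause; case: (c =P 0) => [->|h hc].
  by rewrite prednK ?eqxx //; lia.
by case: eqP; lia.
Qed.

Definition node_color (w : nat) : bool := (w %% 4 == 1) || (w %% 4 == 2).

Lemma node_colorE v c k : k < 4 -> node_color (node v c k) = (k == 1) || (k == 2).
Proof. by move=> h; rewrite /node_color /node mulnC modnMDl modn_small. Qed.

(** Each edge lists its endpoint of kind 0 or 3 first, so equality of unordered pairs and touching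
    can be tested position by position. *)
Lemma gadget_color x :
  node_color (gadget_edge x).1.1 = false /\ node_color (gadget_edge x).1.2 = true.
Proof.
by case: x => [[v c] k]; case: k => [|[|[|[|k]]]]; rewrite /= !node_colorE.
Qed.

Lemma gadget_ends_inj : {in edge_index &, injective (fun x => (gadget_edge x).1)}.
Proof.
move=> [[v c] k] [[v' c'] k']; rewrite !edge_indexP.
case/and4P=> hv hc hk _ /and4P[hv' hc' hk' _].
have hp := prev_clause_lt hc; have hp' := prev_clause_lt hc'.
(* With a single clause the cycle would degenerate into two parallel edges. *)
have hne : prev_clause c != c by rewrite /prev_clause; case: (c =P 0) => [->|?]; lia.
case: k hk => [|[|[|[|[|k]]]]] //= _; case: k' hk' => [|[|[|[|[|k']]]]] //= _ [e1 e2];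
  have [//|//|? ? //] := node_inj hc hc' _ _ e1; subst v' c' => //;
  have [||//|//|? ? ?] := node_inj _ _ _ _ e2; rewrite ?hc ?hp //; lia.
Qed.

Lemma ukey_gadget_inj : {in edge_index &, injective (ukey \o gadget_edge)}.
Proof.
move=> x x' hx hx' /= e; apply: gadget_ends_inj => //.
have [h1 h2] := gadget_color x; have [h1' h2'] := gadget_color x'.
move: e h1 h2 h1' h2'; rewrite /ukey.
case: (gadget_edge x) => -[a b] ?; case: (gadget_edge x') => -[a' b'] ? /= [e1 e2].
have [[-> ->]//|[-> ->]] : (a = a' /\ b = b') \/ (a = b' /\ b = a') by lia.
by move=> -> // ? ->.
Qed.

Lemma gadget_degree w :
  count (fun q => (q.1.1 == w) || (q.1.2 == w)) gadget <= 3.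
Proof.
rewrite /gadget count_map -size_filter; set s := filter _ _.
have C0 : 0 < C by lia.
pose c := (w %/ 4) %% C; pose v := (w %/ 4) %/ C.
have hc : c < C by rewrite ltn_mod.
have hw : w = node v c (w %% 4).
  by rewrite /node /v /c -divn_eq mulnC -divn_eq.
clearbody c v.
(* The candidates at a node depend on its kind only; [v.-1] accounts for the edge of kind 4 that
   arrives from the previous variable. *)
pose cand := nth [::] [:: [:: (v, c, 0); (v, c, 1); (v, c, 2)];
   [:: (v, c, 0); (v, next_clause c, 1)];
   [:: (v, c, 2); (v, c, 3); (v.-1, c, 4)]; [:: (v, c, 3); (v, c, 4)]] (w %% 4).
have hcand : size cand <= 3 by rewrite /cand; case: (w %% 4) => [|[|[|[|n]]]] //=; rewrite nth_nil.
apply: leq_trans hcand; apply: uniq_leq_size; first by rewrite filter_uniq ?uniq_edge_index.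
have hm : w %% 4 < 4 by rewrite ltn_mod.
move=> [[v' c'] k]; rewrite mem_filter edge_indexP hw /cand => /andP[+ /and4P[hv' hc' hk _]].
have hp' := prev_clause_lt hc'.
move: (w %% 4) hm => j hj {hw}.
case: k hk => [|[|[|[|[|k]]]]] //= _ /orP[] /eqP e;
  have [||||? ? ?] := node_inj _ _ _ _ e => //; subst; rewrite ?inE ?eqxx ?orbT //.
by rewrite prev_clauseK // eqxx orbT.
Qed.

Lemma gadget_edge_inj : {in edge_index &, injective gadget_edge}.
Proof. by move=> x x' hx hx' e; apply: ukey_gadget_inj; rewrite //= e. Qed.

Lemma node_lt v c k : v < V -> c < C -> k < 4 -> node v c k < 4 * (V * C).
Proof.
move=> hv hc hk; have : v * C + C <= V * C by rewrite addnC -mulSn leq_mul2r hv orbT.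
by rewrite /node; lia.
Qed.

Lemma gadget_range q : q \in gadget ->
  [/\ q.1.1 < 4 * (V * C), q.1.2 < 4 * (V * C), q.2.1 < q.2.2 & q.2.2 <= 3].
Proof.
case/mapP=> [[[v c] k]]; rewrite edge_indexP => /and4P[hv hc hk hp] ->.
have hc' := prev_clause_lt hc.
case: k hk hp => [|[|[|[|[|k]]]]] //= _ hp; try case: ifP => _;
  by split=> //; apply: node_lt.
Qed.

Lemma gadget_touching x x' :
  touching (gadget_edge x) (gadget_edge x') =
  ((gadget_edge x).1.1 == (gadget_edge x').1.1) ||
  ((gadget_edge x).1.2 == (gadget_edge x').1.2).
Proof.
rewrite /touching.
have [h1 h2] := gadget_color x; have [h1' h2'] := gadget_color x'.
have -> : ((gadget_edge x).1.1 == (gadget_edge x').1.2) = false.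
  by apply/eqP => e; rewrite e h2' in h1.
have -> : ((gadget_edge x).1.2 == (gadget_edge x').1.1) = false.
  by apply/eqP => e; rewrite e h1' in h2.
by [].
Qed.

(** * From a satisfying assignment to a matching *)

Section Completeness.
Variable alpha : nat -> bool.
Hypothesis sat : forall c, c < C -> exists2 v, v < V & occ v c && (alpha v == sgn v c).

Definition witness (c : nat) : nat :=
  find (fun v => occ v c && (alpha v == sgn v c)) (iota 0 V).

Lemma witnessP c : c < C ->
  [/\ witness c < V, occ (witness c) c & alpha (witness c) = sgn (witness c) c].
Proof.
move=> /sat[v hv hs].
have h : has (fun v => occ v c && (alpha v == sgn v c)) (iota 0 V).
  by apply/hasP; exists v => //; rewrite mem_iota.
have := nth_find 0 h; have := h; rewrite has_find size_iota -/(witness c) => hw.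
by rewrite nth_iota // add0n => /andP[-> /eqP].
Qed.

(** The path of a clause is matched by kind 3 before its witness and by kind 4 after it, which
    leaves the witness node to the edge of kind 2. *)
Definition selected (x : nat * nat * nat) : bool :=
  let: (v, c, k) := x in
  match k with
  | 0 => alpha v | 1 => ~~ alpha v | 2 => v == witness c
  | 3 => v < witness c | _ => witness c <= v
  end.

(** Each clause accounts for [V] cycle edges, one edge of kind 2 and [V - 1] path edges. *)
Lemma count_selected : count selected edge_index = 2 * (V * C).
Proof.
rewrite count_edge_index exchange_big /=.
transitivity (\sum_(c < C) 2 * V); last by rewrite sum_nat_const card_ord; nia.
apply: eq_bigr => c _; have [hw hocc _] := witnessP (ltn_ord c).
transitivity (\sum_(v < V) (1 + (v == witness c :> nat) + (v.+1 < V))).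
  apply: eq_bigr => v _; rewrite !addn0.
  have -> : (v == witness c :> nat) && occ v c = (v == witness c :> nat).
    by case: eqP => // ->.
  by case: (alpha v) => /=; case: (v.+1 < V); case: ltngtP; rewrite ?andbT ?andbF //=; lia.
rewrite !big_split /= sum_nat_const card_ord muln1.
rewrite (bigD1 (Ordinal hw)) //= eqxx big1 ?addn0; last first.
  by move=> v; rewrite -val_eqE /= => /negbTE->.
rewrite (eq_bigr (fun v : 'I_V => (v < V.-1 : nat))); last by move=> v _; congr nat_of_bool; lia.
by rewrite sum_ltn_min; lia.
Qed.

Lemma selected_compatible x x' :
  x \in edge_index -> x' \in edge_index -> selected x -> selected x' -> x != x' ->
  touching (gadget_edge x) (gadget_edge x') -> ~~ meeting (gadget_edge x) (gadget_edge x').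
Proof.
move=> hx hx'; rewrite gadget_touching; move: x x' hx hx'.
move=> [[v c] k] [[v' c'] k']; rewrite !edge_indexP.
case/and4P=> hv hc hk hp /and4P[hv' hc' hk' hp'].
have hpc := prev_clause_lt hc; have hpc' := prev_clause_lt hc'.
have [_ _ ha] := witnessP hc; have [_ _ ha'] := witnessP hc'.
case: k hk hp => [|[|[|[|[|k]]]]] //= _ hp; case: k' hk' hp' => [|[|[|[|[|k']]]]] //= _ hp' s s' hne;
  case/orP=> /eqP e; have [//|//|//|//|ev ec ek] := node_inj _ _ _ _ e; try discriminate ek;
  move: ha ha' s s' hne; rewrite /meeting -?ev -?ec ?eqxx //=.
all: try by move=> _ _ ->.
all: try by move=> _ _ /negbTE->.
all: try by move=> ha _ h /eqP ew; move: ha; rewrite -ew h => <-.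
all: try by move=> ha _ /negbTE h /eqP ew; move: ha; rewrite -ew h => <-.
all: try by move=> ha _ /eqP ew h; move: ha; rewrite -ew h => <-.
all: try by move=> ha _ /eqP ew /negbTE h; move: ha; rewrite -ew h => <-.
all: try (move=> _ _ ? ?; exfalso; lia).
(* Only pairs of kind 1 and pairs of kind 4 with a common second node are left; such edges
   coincide. *)
- have e' : c = c' by rewrite -(prev_clauseK hc) -(prev_clauseK hc') ec.
  by rewrite -e' eqxx.
- have e' : v = v' by case: ev.
  by rewrite -e' eqxx.
Qed.

Lemma gadget_complete : valid (4 * (V * C)) 3 (2 * (V * C)) gadget.
Proof.
split.
- exact: gadget_range.
- exists node_color => _ /mapP[x _ ->].
  by have [-> ->] := gadget_color x.
- rewrite /gadget -map_comp map_inj_in_uniq ?uniq_edge_index //.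
  exact: ukey_gadget_inj.
- exact: gadget_degree.
- by rewrite !muln_gt0 V0 (ltnW C1).
- exists (fun q => has (fun x => (gadget_edge x == q) && selected x) edge_index).
    rewrite /gadget count_map -count_selected; apply: eq_in_count => x hx /=.
    apply/hasP/idP => [[x' hx' /andP[/eqP e hs]]|hs]; last by exists x; rewrite ?eqxx.
    by rewrite -(gadget_edge_inj hx' hx e).
  move=> p q _ _ /hasP[x hx /andP[/eqP<- sx]] /hasP[x' hx' /andP[/eqP<- sx']] hne.
  apply: selected_compatible => //; by apply: contra hne => /eqP->.
Qed.

End Completeness.


(** * From a matching to a satisfying assignment *)

Section Soundness.
Variable sel : pred quad.
Hypothesis count_sel : count sel gadget = 2 * (V * C).
Hypothesis comp : compatible sel gadget.

(** Each edge is charged to its endpoint of kind 0 or 2. There are [V * C] nodes of either kind,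
    whence the target [2 * (V * C)]. *)
Definition charge (x : nat * nat * nat) : nat :=
  let: (v, c, k) := x in
  match k with 0 | 1 => node v c 0 | 2 | 3 => node v c 2 | _ => node v.+1 c 2 end.

Notation chosen v c k := (((v, c, k) \in edge_index) && sel (gadget_edge (v, c, k))).

Lemma conflict x x' : x \in edge_index -> x' \in edge_index ->
  sel (gadget_edge x) -> sel (gadget_edge x') -> x != x' ->
  ((gadget_edge x).1.1 == (gadget_edge x').1.1) ||
  ((gadget_edge x).1.2 == (gadget_edge x').1.2) ->
  ~~ meeting (gadget_edge x) (gadget_edge x').
Proof.
move=> hx hx' sx sx' hne ht; apply: comp; rewrite ?map_f //.
  by apply: contra hne => /eqP/(gadget_edge_inj hx hx')->.
by rewrite gadget_touching.
Qed.

Lemma kind_neq (p : nat * nat) (k k' : nat) : k != k' -> (p, k) != (p, k').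
Proof. by apply: contra => /eqP[->]. Qed.

(** Edges charged to the same node exist together, at time 1 on the cycles and at time 0 elsewhere,
    so at most one of them is selected. *)
Lemma charge_inj x x' : x \in edge_index -> x' \in edge_index ->
  sel (gadget_edge x) -> sel (gadget_edge x') -> charge x = charge x' -> x = x'.
Proof.
move=> hx hx' sx sx' e; apply/eqP; apply: contraT => hne.
have := conflict hx hx' sx sx' hne.
move: x x' hx hx' {sx sx'} hne e => [[v c] k] [[v' c'] k'].
rewrite !edge_indexP => /and4P[hv hc hk _] /and4P[hv' hc' hk' _].
case: k hk => [|[|[|[|[|k]]]]] //= _; case: k' hk' => [|[|[|[|[|k']]]]] //= _ hne e;
  have [//|//|//|//|ev ec ek] := node_inj _ _ _ _ e; try discriminate ek;
  subst; rewrite ?ev ?eqxx ?orbT => /(_ isT);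
  by rewrite /meeting /=; do 2 (try case: ifP => _).
Qed.

(** Pigeonhole: the charges of the selected edges are distinct and as numerous as the nodes of kinds
    0 and 2. *)
Lemma charged w :
  w \in [seq node p.1 p.2 0 | p <- cells] ++ [seq node p.1 p.2 2 | p <- cells] ->
  exists x, [/\ x \in edge_index, sel (gadget_edge x) & charge x = w].
Proof.
set tg := _ ++ _ => hw.
pose s := [seq x <- edge_index | sel (gadget_edge x)].
have hs x : x \in s -> x \in edge_index /\ sel (gadget_edge x).
  by rewrite mem_filter => /andP[].
have hcell v c k : (v, c, k) \in edge_index -> (v, c) \in cells.
  by rewrite edge_indexP cellsP => /and3P[-> ->].
have hu : uniq (map charge s).
  rewrite map_inj_in_uniq; first exact: filter_uniq uniq_edge_index.
  by move=> x x' /hs[hx sx] /hs[hx' sx']; apply: charge_inj.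
have hsub : {subset map charge s <= tg}.
  move=> _ /mapP[[[v c] k] /hs[hx sx] ->]; rewrite mem_cat.
  have hp := hcell _ _ _ hx.
  move: hx; rewrite edge_indexP => /and4P[hv hc hk].
  case: k hk {sx} => [|[|[|[|[|k]]]]] //= _ hpr.
  - by rewrite (map_f (fun p => node p.1 p.2 0) hp).
  - by rewrite (map_f (fun p => node p.1 p.2 0) hp).
  - by rewrite (map_f (fun p => node p.1 p.2 2) hp) orbT.
  - by rewrite (map_f (fun p => node p.1 p.2 2) hp) orbT.
  - have hp' : (v.+1, c) \in cells by rewrite cellsP hpr.
    by rewrite (map_f (fun p => node p.1 p.2 2) hp') orbT.
have hsz : size tg <= size (map charge s).
  rewrite size_cat !size_map size_filter -(count_map gadget_edge sel) count_sel.
  by rewrite size_allpairs !size_iota; lia.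
have [_ hmem] := uniq_min_size hu hsub hsz.
by move: hw; rewrite -hmem => /mapP[x /hs[hx sx] ->]; exists x.
Qed.

Lemma chosen_cycle v c : v < V -> c < C -> chosen v c 0 || chosen v c 1.
Proof.
move=> hv hc.
have hp : (v, c) \in cells by rewrite cellsP hv.
have [|[[v' c'] k] [hx sx]] := @charged (node v c 0).
  by rewrite mem_cat (map_f (fun p => node p.1 p.2 0) hp).
have := hx; rewrite edge_indexP => /and4P[hv' hc' hk _].
case: k hk hx sx => [|[|[|[|[|k]]]]] //= _ hx sx e;
  have [//|//|//|//|ev ec ek] := node_inj _ _ _ _ e; try discriminate ek;
  by subst; rewrite hx sx ?orbT.
Qed.

Lemma chosen_clause v c : v < V -> c < C ->
  [|| chosen v c 2, chosen v c 3 | (0 < v) && chosen v.-1 c 4].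
Proof.
move=> hv hc.
have hp : (v, c) \in cells by rewrite cellsP hv.
have [|[[v' c'] k] [hx sx]] := @charged (node v c 2).
  by rewrite mem_cat (map_f (fun p => node p.1 p.2 2) hp) orbT.
have := hx; rewrite edge_indexP => /and4P[hv' hc' hk _].
case: k hk hx sx => [|[|[|[|[|k]]]]] //= _ hx sx e;
  have [//|//|//|//|ev ec ek] := node_inj _ _ _ _ e; try discriminate ek;
  by subst; rewrite hx sx ?orbT.
Qed.

(** The edge of kind 1 at the next clause shares a node and the time 1 with the edge of kind 0 at
    [c], so [chosen_cycle] leaves kind 0. *)
Lemma chosen_next v c : v < V -> c < C -> chosen v c 0 -> chosen v (next_clause c) 0.
Proof.
move=> hv hc /andP[hx sx].
have := chosen_cycle hv (next_clause_lt hc); case/orP=> // /andP[hx' sx'].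
have hne : (v, c, 0) != (v, next_clause c, 1) by apply/eqP => -[].
have := conflict hx hx' sx sx' hne; rewrite /= next_clauseK // eqxx orbT => /(_ isT).
by rewrite /meeting /=; do 2 case: ifP => _ /=.
Qed.

(** The selection of kind 0 propagates forwards, and the passage from the last clause to clause 0
    gives the converse. *)
Lemma chosen_const v c : v < V -> c < C -> chosen v c 0 = chosen v 0 0.
Proof.
move=> hv; have C0 := ltnW C1.
have up i j : i <= j -> j < C -> chosen v i 0 -> chosen v j 0.
  elim: j => [|j IH]; first by rewrite leqn0 => /eqP->.
  rewrite leq_eqVlt ltnS => /predU1P[->//|hij] hj hi.
  have := chosen_next hv (ltnW hj) (IH hij (ltnW hj) hi).
  by rewrite /next_clause; case: eqP => // e; move: hj; rewrite e ltnn.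
move=> hc; apply/idP/idP => [h|]; last exact: up.
have hl : C.-1 < C by lia.
have := chosen_next hv hl (up c C.-1 _ hl h).
by rewrite /next_clause prednK // eqxx; apply; lia.
Qed.

Lemma gadget_sound : satisfiable.
Proof.
exists (fun v => chosen v 0 0) => c hc.
have [h|h] := boolP (has (fun v => chosen v c 2) (iota 0 V)); last first.
  have hn v : v < V -> ~~ chosen v c 2.
    by move=> hv; move/hasPn: h; apply; rewrite mem_iota.
  (* Without an edge of kind 2, each node of the path is charged by kind 3 in turn, since kind 4
     would conflict with the preceding kind 3; but the last node has no edge of kind 3. *)
  have h3 v : v < V -> chosen v c 3.
    elim: v => [|v IH] hv.
      by have := chosen_clause hv hc; rewrite (negbTE (hn _ hv)) /= orbF.
    have := chosen_clause hv hc; rewrite (negbTE (hn _ hv)) /= => /orP[//|/andP[hx' sx']].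
    have /andP[hx sx] := IH (ltnW hv).
    by have := conflict hx hx' sx sx' (@kind_neq (v, c) 3 4 isT); rewrite /= eqxx => /(_ isT).
  have hl : V.-1 < V by lia.
  have := h3 _ hl => /andP[]; rewrite edge_indexP => /and4P[_ _ _ /=].
  by rewrite prednK // ltnn.
case/hasP: h => v; rewrite mem_iota => /= hv /andP[hx sx]; exists v => //.
have := hx; rewrite edge_indexP => /and4P[_ _ _ /= ->] /=.
rewrite -(chosen_const hv hc).
(* At time 0 the edge of kind 2 excludes the cycle edge existing then, of kind 1 for a positive
   literal and of kind 0 for a negative one. *)
case hs : (sgn v c).
  have := chosen_cycle hv hc; case/orP=> [->//|/andP[hx' sx']].
  have := conflict hx hx' sx sx' (@kind_neq (v, c) 2 1 isT).
  by rewrite /= eqxx hs => /(_ isT).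
rewrite eqbF_neg; apply/negP => /andP[hx' sx'].
have := conflict hx hx' sx sx' (@kind_neq (v, c) 2 0 isT).
by rewrite /= eqxx hs => /(_ isT).
Qed.

End Soundness.

Theorem gadget_correct :
  D_MAX_01_TMBD3B_1 (code (4 * (V * C)) 3 (2 * (V * C)) gadget) <-> satisfiable.
Proof.
split=> [/D_MAX_01_TMBD3B_1P[n [T [r [l [/code_inj[<- <- <- <-] hv]]]]]|[alpha sat]].
  by case: hv => _ _ _ _ _ [sel hcount hcomp]; apply: gadget_sound hcount hcomp.
apply: instance_of_valid; exact: gadget_complete sat.
Qed.

End Gadget.

(** * Printing the gadget *)

Lemma flatten_big (T : Type) (I : Type) (F : I -> seq T) s :
  flatten [seq F i | i <- s] = \big[cat/[::]]_(i <- s) F i.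
Proof. by elim: s => [|i s IH]; rewrite ?big_nil ?big_cons //= IH. Qed.

Definition edge_word (a b s f : nat) : seq bool :=
  [:: true] ++ enc_nat a ++ enc_nat b ++ [:: true] ++ enc_nat s ++ enc_nat f ++ [:: false].

Lemma edge_wordE q : true :: enc_quad q = edge_word q.1.1 q.1.2 q.2.1 q.2.2.
Proof. by rewrite /enc_quad /enc_seq /edge_word /= -!catA. Qed.

Lemma wdef_edge_word a b s f : definable a -> definable b -> definable s -> definable f ->
  wdefinable (fun g => edge_word (a g) (b g) (s g) (f g)).
Proof. by move=> *; rewrite /edge_word; wdef; def. Qed.

Ltac wdef_user ::=
  lazymatch goal with
  | |- wdefinable (fun g => edge_word (@?a g) (@?b g) (@?s g) (@?f g)) =>
      apply (@wdef_edge_word a b s f)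
  end.

Ltac def_user ::=
  match goal with
  | H : forall v c k, _ -> _ -> definable (fun g => node _ (v g) (c g) k)
    |- definable (fun g => node _ (@?v g) (@?c g) ?k) => apply (H v c k)
  end.

(** The sign, read as 0 or 1, shifts the interval [[0, 2)] to [[1, 3)]. *)
Definition gadget_block (V C : nat) (occ sgn : nat -> nat -> bool) (v c : nat) : seq bool :=
  edge_word (node C v c 0) (node C v c 1) (sgn v c) (2 + sgn v c) ++
  edge_word (node C v c 0) (node C v (prev_clause C c) 1) (~~ sgn v c) (2 + ~~ sgn v c) ++
  (if occ v c then edge_word (node C v c 0) (node C v c 2) 0 1 else [::]) ++
  (if v.+1 < V then edge_word (node C v c 3) (node C v c 2) 0 1 ++
                    edge_word (node C v c 3) (node C v.+1 c 2) 0 1 else [::]).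

Lemma enc_gadget V C occ sgn :
  enc_seq enc_quad (gadget V C occ sgn) =
  flatten [seq flatten [seq gadget_block V C occ sgn v c | c <- iota 0 C] | v <- iota 0 V]
  ++ [:: false].
Proof.
rewrite /enc_seq /gadget -map_comp; congr (_ ++ _).
rewrite flatten_big /edge_index big_filter big_mkcond big_allpairs big_allpairs flatten_big.
apply: eq_bigr => v _; rewrite flatten_big; apply: eq_bigr => c _.
rewrite /= !big_cons big_nil cats0 /= !edge_wordE /gadget_block /=.
by case: (sgn v c); case: (occ v c); case: (v.+1 < V); rewrite /= ?cats0.
Qed.

Lemma wdef_code_gadget (V C : seq bool * seq bool -> nat)
    (occ sgn : seq bool * seq bool -> nat -> nat -> bool) :
  definable (fun g => V g.1) -> definable (fun g => C g.1) ->
  (forall v c, definable v -> definable c -> decidable_by (fun g => occ g.1 (v g) (c g))) ->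
  (forall v c, definable v -> definable c -> decidable_by (fun g => sgn g.1 (v g) (c g))) ->
  wdefinable (fun g => code (4 * (V g.1 * C g.1)) 3 (2 * (V g.1 * C g.1))
    (gadget (V g.1) (C g.1) (occ g.1) (sgn g.1))).
Proof.
move=> hV hC hocc hsgn.
have hV2 : definable (fun g => V (pop (pop g)).1) := def_iter_pop 2 hV.
have hC2 : definable (fun g => C (pop (pop g)).1) := def_iter_pop 2 hC.
have hC1 : definable (fun g => C (pop g).1) := def_iter_pop 1 hC.
have hv : definable (fun g => top (pop g)) := def_iter_pop 1 def_top.
have ho : decidable_by (fun g => occ (pop (pop g)).1 (top (pop g)) (top g)) := hocc _ _ hv def_top.
have hs : decidable_by (fun g => sgn (pop (pop g)).1 (top (pop g)) (top g)) := hsgn _ _ hv def_top.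
have hnode v c k : definable v -> definable c ->
    definable (fun g => node (C (pop (pop g)).1) (v g) (c g) k).
  by move=> *; rewrite /node; def.
have hprev : definable (fun g => prev_clause (C (pop (pop g)).1) (top g)).
  by rewrite /prev_clause; apply: def_if; def.
have hblock : wdefinable (fun g => gadget_block (V (pop (pop g)).1) (C (pop (pop g)).1)
    (occ (pop (pop g)).1) (sgn (pop (pop g)).1) (top (pop g)) (top g)).
  rewrite /gadget_block.
  have hsgn0 : definable (fun g => nat_of_bool (sgn (pop (pop g)).1 (top (pop g)) (top g))) by [].
  by wdef; def.
have h : wdefinable (fun g => nseq (4 * (V g.1 * C g.1)) true ++ [:: false] ++ enc_nat 3 ++
    enc_nat (2 * (V g.1 * C g.1)) ++ (flatten [seq flatten [seq gadget_block (V g.1) (C g.1)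
      (occ g.1) (sgn g.1) v c | c <- iota 0 (C g.1)] | v <- iota 0 (V g.1)] ++ [:: false])).
  by wdef; def.
by apply: wdef_eq_fun h _ => g; rewrite /code enc_gadget.
Qed.

(** * Computations as satisfying assignments *)

Section Tableau.
Variable M : tm.

(* A column of the tableau: whether it is the one under the heads, the state,
   and for each tape the cell, [None] standing for the left of cell 0. *)
Definition column_type : finType :=
  (bool * tm_state M * {ffun tape_index M -> option (cell (tm_sym M))})%type.
Notation A := column_type.

Section Local.
(* Columns are numbered relatively to the heads, which are all in column [Z]. *)
Variable Z : nat.

(** Each tape is shifted by its own head position, so that column [Z] contains everything a
    transition reads. *)
Definition column (c : config M) (e : nat) : A :=
  (e == Z, cf_state c,
   [ffun i => if cf_head c i + e < Z then None
              else Some (cf_tape c i (cf_head c i + e - Z))]).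

(* [l] and [z] are the columns [Z.-1] and [Z]; [a], [b] and [d] are a column and
   its neighbours. *)
Definition local_rule (l z a b d : A) : A :=
  let q := z.1.2 in
  if tm_halt q then b else
  let r := tm_trans q [ffun i => odflt None (z.2 i)] in
  let written (c : A) i := if c.1.1 then Some (r.2 i).1 else c.2 i in
  (b.1.1, r.1,
   [ffun i => match (r.2 i).2 with
     | Stay => written b i
     | MoveRight => written d i
     | MoveLeft => if l.2 i == None then written b i else written a i
     end]).

(** When a head moves right, its tape slides left, so the new cell comes from column [e.+1], and
    symmetrically. A left move on cell 0 is recognised by column [Z.-1] being off the tape. *)
Lemma column_step c e : 0 < Z -> 0 < e ->
  column (step c) e =
  local_rule (column c Z.-1) (column c Z) (column c e.-1) (column c e) (column c e.+1).
Proof.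
move=> Z0 e0; rewrite /local_rule /= /step; case: ifP => // _.
have -> : [ffun i => odflt None ([ffun i0 => if cf_head c i0 + Z < Z then None
      else Some (cf_tape c i0 (cf_head c i0 + Z - Z))] i)] =
    [ffun i => cf_tape c i (cf_head c i)].
  by apply/ffunP => i; rewrite !ffunE ltnNge leq_addl /= addnK.
case: (tm_trans _ _) => q act; rewrite /column /=.
congr (_, _, _); apply/ffunP => i; rewrite !ffunE.
set h := cf_head c i; set w := (act i).1.
(* Within the tape a column determines its cell, so writing in column [Z] is writing under the
   head. *)
have hw e' : (if e' == Z then Some w
      else if h + e' < Z then None else Some (cf_tape c i (h + e' - Z))) =
    (if h + e' < Z then None
     else Some (if h + e' - Z == h then w else cf_tape c i (h + e' - Z))).
  case: (e' =P Z) => [->|ne]; first by rewrite ltnNge leq_addl /= addnK eqxx.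
  by case: ifP => // h1; case: eqP => // h2; lia.
case: (act i).2 => /=; rewrite ?hw //.
- case: (posnP h) => [->|h0] /=.
    by rewrite ?add0n prednK // leqnn /= ?add0n.
  have -> : (h + Z.-1 < Z) = false by lia.
  by have -> : h.-1 + e = h + e.-1 by lia.
- by have -> : h.+1 + e = h + e.+1 by lia.
Qed.

End Local.

(** * The clauses of a computation *)

Variables (x : seq bool) (T Q : nat).

(** Each step loses a column at both borders, for want of a neighbour; after [T] steps exactly the
    columns [center.-1] and [center] remain. *)
Definition center := T.+1.
Definition width := center + T.+1.
Notation Z := center.
Notation P := width.

Definition tape1 : tape_index M := inord 1.

(** In this order: a step, two adjacent initial columns, and then acceptance for [Some a] or the
    choice of an initial column for [None]. *)
Definition clause_type : finType := ((A * A * A * A * A) + ((A * A) + option A))%type.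
Notation W := clause_type.

(** The first [Q] cells of tape 1 are left open for the unknown certificate. *)
Definition init_cell (e : nat) (i : tape_index M) (o : option (cell (tm_sym M))) : bool :=
  if e < Z then o == None else
  match o with
  | None => false
  | Some s =>
      if val i == 0 then s == word_on_tape (tm_sym M) x (e - Z)
      else if val i == 1 then
        (s == None) || ((e - Z < Q) && ((s == Some (inl true)) || (s == Some (inl false))))
      else s == None
  end.

Definition init_column (a : A) (e : nat) : bool :=
  [&& a.1.1 == (e == Z), a.1.2 == tm_start M & [forall i, init_cell e i (a.2 i)]].

Definition accepting_column (a : A) : bool := tm_halt a.1.2 && tm_accept a.1.2.

(** Every triple is numbered as a clause, which keeps the numbering arithmetical; this singles out
    the meaningful ones. A pair clause forbids a blank followed by a symbol, so that tape 1 carries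
    a word. *)
Definition clause_ok (t e : nat) (w : W) : bool :=
  match w with
  | inl _ => [&& t < T, 0 < e & e.+1 < P]
  | inr (inl (a, b)) =>
      [&& t == 0, e.+1 < P & (a.2 tape1 == Some None) && (b.2 tape1 != Some None)]
  | inr (inr None) => t == 0
  | inr (inr (Some a)) => [&& t == T, e == Z & ~~ accepting_column a]
  end.

(* The variable [(t, e, Some a)] says that column [e] is [a] at time [t]; the
   variables [(t, e, None)] satisfy the clauses that are not [clause_ok]. *)
Definition pos_literal (t e : nat) (w : W) (t' e' : nat) (a' : option A) : bool :=
  if clause_ok t e w then
    match w with
    | inl (l, z, a, b, d) => [&& t' == t.+1, e' == e & a' == Some (local_rule l z a b d)]
    | inr (inr None) => [&& t' == t, e' == e & if a' is Some a then init_column a e else false]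
    | _ => false
    end
  else [&& t' == t, e' == e & a' == None].

Definition neg_literal (t e : nat) (w : W) (t' e' : nat) (a' : option A) : bool :=
  clause_ok t e w &&
  match w with
  | inl (l, z, a, b, d) => (t' == t) &&
      [|| (e' == Z.-1) && (a' == Some l), (e' == Z) && (a' == Some z),
          (e' == e.-1) && (a' == Some a), (e' == e) && (a' == Some b)
        | (e' == e.+1) && (a' == Some d)]
  | inr (inl (a, b)) => (t' == t) &&
      (((e' == e) && (a' == Some a)) || ((e' == e.+1) && (a' == Some b)))
  | inr (inr None) => false
  | inr (inr (Some a)) => [&& t' == t, e' == e & a' == Some a]
  end.

(** In a step clause the positive literal is one time later than the negative ones. The gadget
    stores only one sign per variable and clause. *)
Lemma literal_sign t e w t' e' a' :
  pos_literal t e w t' e' a' -> neg_literal t e w t' e' a' = false.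
Proof.
rewrite /pos_literal /neg_literal; case: ifP => //= _.
case: w => [[[[[l z] a] b] d]|[[a b]|[a|]]] //.
by case/and3P=> /eqP-> _ _; rewrite eqn_leq ltnn.
Qed.

Definition tableau_sat (alpha : nat -> nat -> option A -> bool) : Prop :=
  forall t e w, t <= T -> e < P -> exists t' e' a',
  [/\ t' <= T, e' < P & (pos_literal t e w t' e' a' && alpha t' e' a') ||
                        (neg_literal t e w t' e' a' && ~~ alpha t' e' a')].

Lemma tableau_complete y : size y <= Q -> accepts_in M T x y ->
  tableau_sat (fun t e a' => if a' is Some a then column Z (run M t x y) e == a else true).
Proof.
move=> hy [hh ha] t e w ht he.
case hok : (clause_ok t e w); last first.
  by exists t, e, None; rewrite /pos_literal hok !eqxx.
case: w hok => [[[[[l z] a] b] d]|[[a b]|[a|]]] hok; rewrite /pos_literal /neg_literal hok /=.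
- move: hok => /= /and3P[htT e0 heP].
  have hZ : 0 < Z by [].
  (* A column that differs from the true one makes its negative literal hold; if all five are true,
     so is the positive literal. *)
  have [el|ne] := boolP (column Z (run M t x y) Z.-1 == l); last first.
    exists t, Z.-1, (Some l); split=> //; first by rewrite /P; lia.
    by rewrite !eqxx /= ne orbT.
  have [ez|ne] := boolP (column Z (run M t x y) Z == z); last first.
    exists t, Z, (Some z); split=> //; first by rewrite /P; lia.
    by rewrite !eqxx /= ne !orbT.
  have [ea|ne] := boolP (column Z (run M t x y) e.-1 == a); last first.
    exists t, e.-1, (Some a); split=> //; first by lia.
    by rewrite !eqxx /= ne !orbT.
  have [eb|ne] := boolP (column Z (run M t x y) e == b); last first.
    exists t, e, (Some b); split=> //.
    by rewrite !eqxx /= ne !orbT.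
  have [ed|ne] := boolP (column Z (run M t x y) e.+1 == d); last first.
    exists t, e.+1, (Some d); split=> //.
    by rewrite !eqxx /= ne !orbT.
  exists t.+1, e, (Some (local_rule l z a b d)); split=> //.
  rewrite !eqxx /= -(eqP el) -(eqP ez) -(eqP ea) -(eqP eb) -(eqP ed).
  by rewrite -column_step // eqxx.
- move: hok => /= /and3P[/eqP t0 heP /andP[/eqP hba hbb]]; subst t.
  have [ea|ne] := boolP (column Z (run M 0 x y) e == a); last first.
    by exists 0, e, (Some a); split=> //; rewrite !eqxx /= ne.
  exists 0, e.+1, (Some b); split=> //; rewrite !eqxx orbT /=.
  apply: contra hbb => /eqP<-; move: hba; rewrite -(eqP ea) /column /= !ffunE /= inordK //.
  rewrite !add0n /word_on_tape; case: ltnP => // hZ.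
  case h : (onth y (e - Z)) => //= _.
  have hs : size y <= e - Z by rewrite -onthNE h.
  by case: ltnP => h'; [lia | rewrite onth_default //; lia].
- move: hok => /= /and3P[/eqP tT /eqP eZ hacc]; subst t e.
  exists T, Z, (Some a); split=> //; rewrite !eqxx /=.
  apply: contra hacc => /eqP<-; rewrite /accepting_column /=.
  by rewrite hh ha.
- move: hok => /= /eqP t0; subst t.
  exists 0, e, (Some (column Z (run M 0 x y) e)); split=> //; rewrite !eqxx /= orbF andbT.
  rewrite /init_column /= !eqxx /=; apply/forallP => i; rewrite /init_cell ffunE /= add0n.
  case: (e < Z) => //; case: (i =P 0 :> nat) => [_|_]; first by rewrite eqxx.
  case: (i =P 1 :> nat) => [_|_]; last by rewrite /word_on_tape onth0n.
  rewrite /word_on_tape; case: (ltnP (e - Z) (size y)) => h; last by rewrite onth_default.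
  rewrite (leq_trans h hy) /=.
  have : onth y (e - Z) by rewrite onthTE.
  by case: (onth y _) => // -[].
Qed.

Section Soundness.
Variable alpha : nat -> nat -> option A -> bool.
Hypothesis sat : tableau_sat alpha.
Hypothesis QT : Q <= T.

Lemma sat_step t e l z a b d : t < T -> 0 < e -> e.+1 < P ->
  alpha t Z.-1 (Some l) -> alpha t Z (Some z) -> alpha t e.-1 (Some a) ->
  alpha t e (Some b) -> alpha t e.+1 (Some d) ->
  alpha t.+1 e (Some (local_rule l z a b d)).
Proof.
move=> htT e0 heP hl hz ha hb hd.
have [t' [e' [a' [_ _]]]] := sat (inl (l, z, a, b, d) : W) (ltnW htT) (ltnW heP).
rewrite /pos_literal /neg_literal /= htT e0 heP /=.
case/orP=> [/andP[/and3P[/eqP-> /eqP-> /eqP->]]//|].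
case/andP=> /andP[/eqP-> h]; apply: contraNT => _.
by case/or4P: h => [|||/orP[]] /andP[/eqP-> /eqP->].
Qed.

Lemma sat_init e : e < P -> exists2 a, init_column a e & alpha 0 e (Some a).
Proof.
move=> he; have [t' [e' [a' [_ _]]]] := sat (inr (inr None) : W) (leq0n T) he.
rewrite /pos_literal /neg_literal /= orbF.
by case/andP=> /and3P[/eqP-> /eqP->]; case: a' => // a ha h; exists a.
Qed.

Lemma sat_pair e a b : e.+1 < P -> alpha 0 e (Some a) -> alpha 0 e.+1 (Some b) ->
  a.2 tape1 == Some None -> b.2 tape1 == Some None.
Proof.
move=> he ha hb h1; apply: contraT => h2.
have [t' [e' [a' [_ _]]]] := sat (inr (inl (a, b)) : W) (leq0n T) (ltnW he).
rewrite /pos_literal /neg_literal /= he h1 h2 /=.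
by case/andP=> /andP[/eqP-> /orP[]/andP[/eqP-> /eqP->]]; rewrite ?ha ?hb.
Qed.

Lemma sat_final a : alpha T Z (Some a) -> accepting_column a.
Proof.
move=> h; apply: contraT => hacc.
have hZ : Z < P by rewrite /P; lia.
have [t' [e' [a' [_ _]]]] := sat (inr (inr (Some a)) : W) (leqnn T) hZ.
rewrite /pos_literal /neg_literal /= !eqxx hacc /=.
by case/andP=> /and3P[/eqP-> /eqP-> /eqP->]; rewrite h.
Qed.

(** Several initial columns may be true at one place; [a] picks one of them. The certificate is read
    up to the first blank [L], and the pair clauses force blanks from there on. *)
Lemma sat_init_config : exists2 y, size y <= Q &
  forall e, e < P -> alpha 0 e (Some (column Z (init M x y) e)).
Proof.
pose a e : A := odflt (column Z (init M x x) e)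
  [pick a : A | init_column a e && alpha 0 e (Some a)].
have ha e : e < P -> init_column (a e) e /\ alpha 0 e (Some (a e)).
  move=> /sat_init[b h1 h2]; rewrite /a; case: pickP => [c /andP[]//|/(_ b)].
  by rewrite h1 h2.
pose blank j := (a (Z + j)).2 tape1 == Some None.
have hcell j i : Z + j < P -> init_cell (Z + j) i ((a (Z + j)).2 i).
  by move=> /ha[/and3P[_ _ /forallP h] _].
have hrange j : j <= Q -> Z + j < P by rewrite /P; lia.
have hval j : Z + j < P -> exists2 s, (a (Z + j)).2 tape1 = Some s &
    (s == None) || ((j < Q) && ((s == Some (inl true)) || (s == Some (inl false)))).
  move=> hjP; have := hcell j tape1 hjP; rewrite /init_cell ltnNge leq_addr /= inordK // addKn.
  by case: ((a _).2 _) => // s h; exists s.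
have hQ : blank Q.
  rewrite /blank; have [s -> ] := hval Q (hrange Q (leqnn Q)).
  by rewrite ltnn orbF => /eqP->.
pose L := find blank (iota 0 Q.+1).
have hhas : has blank (iota 0 Q.+1).
  by apply/hasP; exists Q; rewrite ?mem_iota //= add0n ltnSn.
have hL : L <= Q by move: hhas; rewrite has_find size_iota ltnS.
have hLblank : blank L.
  by have := nth_find 0 hhas; rewrite nth_iota // add0n.
have hbefore j : j < L -> ~~ blank j.
  move=> hj; have := before_find 0 hj; rewrite nth_iota ?add0n; first by move=> ->.
  by rewrite ltnS; apply: leq_trans (ltnW hj) hL.
have hafter j : L <= j -> Z + j < P -> blank j.
  elim: j => [|j IH]; first by rewrite leqn0 => /eqP<-.
  rewrite leq_eqVlt ltnS => /predU1P[<-//|hj] hP.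
  have hP' : Z + j < P by lia.
  move: (IH hj hP'); apply: (@sat_pair (Z + j)); first by lia.
    by have [] := ha _ hP'.
  by rewrite -addnS; have [] := ha _ hP.
pose y := mkseq (fun j => (a (Z + j)).2 tape1 == Some (Some (inl true))) L.
exists y; first by rewrite size_mkseq.
move=> e he; have [h1 h2] := ha e he.
suff -> : column Z (init M x y) e = a e by [].
case/and3P: h1 => /eqP e1 /eqP e2 /forallP e3.
move: e1 e2 e3 {h2}; case h : (a e) => [[c q] f] /= -> -> e3.
rewrite /column /=; congr (_, _, _); apply/ffunP => i; rewrite ffunE add0n.
have := e3 i; rewrite /init_cell; case: ltnP => hZe; first by move/eqP->.
case hf : (f i) => [s|//].
case: (i =P 0 :> nat) => [_ /eqP->//|_].
case: (i =P 1 :> nat) => [i1|_ /eqP->]; last by rewrite /word_on_tape onth0n.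
have ei : i = tape1 by apply: val_inj; rewrite /= inordK.
move=> hs; congr Some; rewrite /word_on_tape.
have hj : Z + (e - Z) = e by rewrite subnKC.
have hfb : blank (e - Z) = (s == None) by rewrite /blank hj h /= -ei hf.
case: (ltnP (e - Z) L) => hjL.
  have := hbefore _ hjL; rewrite hfb => hn.
  have -> : onth y (e - Z) = Some (s == Some (inl true)).
    by rewrite onthE (nth_map false) ?size_mkseq // nth_mkseq // hj h /= -ei hf.
  by case/orP: hs => [/eqP e0|/andP[_ /orP[]/eqP->]]; rewrite ?e0 // in hn *.
have := hafter _ hjL; rewrite hj => /(_ he); rewrite hfb => /eqP->.
by rewrite onth_default // size_mkseq.
Qed.

(** The step clauses carry the chosen initial row along the computation, on a range of columns that
    narrows with time and still contains [Z] at time [T]. *)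
Lemma tableau_sound : exists2 y, size y <= Q & accepts_in M T x y.
Proof.
have [y hy hinit] := sat_init_config; exists y => //.
have key t : t <= T -> forall e, t <= e -> e + t < P ->
    alpha t e (Some (column Z (run M t x y) e)).
  elim: t => [|t IH] ht e he heP; first by apply: hinit; lia.
  rewrite /run iterS -/(run M t x y) column_step //; last by lia.
  have hT := ltnW ht.
  by apply: sat_step => //; first [lia | apply: IH => //; rewrite /P /Z /= in heP *; lia].
have hfin : alpha T Z (Some (column Z (run M T x y) Z)).
  by apply: key => //; rewrite /P /Z; lia.
by have := sat_final hfin; rewrite /accepting_column /= => /andP[h1 h2].
Qed.

End Soundness.

End Tableau.

(** * NP-hardness *)

Section Numbering.
Variables (M : tm) (x : seq bool) (T Q : nat).
Notation A := (column_type M).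
Notation W := (clause_type M).
Notation P := (width T).

Definition time_of (K i : nat) := i %/ K %/ P.
Definition pos_of (K i : nat) := (i %/ K) %% P.
Definition var_symbol (i : nat) : option A := nth None (enum {: option A}) (i %% #|{: option A}|).
Definition clause_kind (i : nat) : W := nth (inr (inr None)) (enum W) (i %% #|W|).

Definition num_vars := T.+1 * P * #|{: option A}|.
Definition num_clauses := T.+1 * P * #|W|.

Definition cnf_pos (v c : nat) : bool :=
  pos_literal x T Q (time_of #|W| c) (pos_of #|W| c) (clause_kind c)
    (time_of #|{: option A}| v) (pos_of #|{: option A}| v) (var_symbol v).

Definition cnf_neg (v c : nat) : bool :=
  neg_literal T (time_of #|W| c) (pos_of #|W| c) (clause_kind c)
    (time_of #|{: option A}| v) (pos_of #|{: option A}| v) (var_symbol v).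

Definition cnf_occ (v c : nat) : bool := cnf_pos v c || cnf_neg v c.

Lemma width_gt1 : 1 < P.
Proof. by rewrite /width /center; lia. Qed.

Lemma numberingK K t e r : e < P -> r < K -> t <= T ->
  let i := (t * P + e) * K + r in
  [/\ time_of K i = t, pos_of K i = e, i %% K = r & i < T.+1 * P * K].
Proof.
move=> he hr ht i; have P0 := ltnW width_gt1; have K0 : 0 < K by lia.
rewrite /time_of /pos_of /i divnMDl // (divn_small hr) addn0 divnMDl // (divn_small he).
rewrite addn0 !modnMDl !modn_small //; split=> //.
have h1 : t * P + e < T.+1 * P.
  have : t.+1 * P <= T.+1 * P by rewrite leq_mul2r ltnS ht orbT.
  by rewrite mulSn; lia.
have : (t * P + e).+1 * K <= T.+1 * P * K by rewrite leq_mul2r h1 orbT.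
by rewrite mulSn; lia.
Qed.

Lemma numbering_bounds K i : i < T.+1 * P * K ->
  [/\ time_of K i <= T, pos_of K i < P
    & i = (time_of K i * P + pos_of K i) * K + i %% K].
Proof.
move=> hi; have P0 := ltnW width_gt1.
have K0 : 0 < K by case: K hi => //; rewrite muln0.
split; last by rewrite /time_of /pos_of -divn_eq -divn_eq.
- by rewrite -ltnS /time_of !ltn_divLR.
- by rewrite ltn_mod.
Qed.

Lemma card_enum_index (X : finType) (a : X) : index a (enum X) < #|X|.
Proof. by rewrite cardE index_mem mem_enum. Qed.

Lemma cnf_satP : satisfiable num_vars num_clauses cnf_occ cnf_pos <->
  exists alpha, tableau_sat (M := M) x T Q alpha.
Proof.
split=> [[beta hb]|[alpha ha]].
  exists (fun t e a => beta ((t * P + e) * #|{: option A}| + index a (enum {: option A}))).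
  move=> t e w ht he.
  have [h1 h2 h3 h4] := numberingK he (card_enum_index w) ht.
  have hw : clause_kind ((t * P + e) * #|W| + index w (enum W)) = w.
    by rewrite /clause_kind h3 nth_index ?mem_enum.
  have [v hv /andP[hocc hsgn]] := hb _ h4.
  have [h5 h6 h7] := numbering_bounds hv.
  exists (time_of #|{: option A}| v), (pos_of #|{: option A}| v), (var_symbol v); split=> //.
  have hidx : index (var_symbol v) (enum {: option A}) = v %% #|{: option A}|.
    rewrite /var_symbol index_uniq ?enum_uniq //.
    by rewrite -cardE ltn_mod; apply/card_gt0P; exists None.
  rewrite hidx -h7; move: hocc hsgn; rewrite /cnf_occ /cnf_pos /cnf_neg h1 h2 hw.
  case: (pos_literal _ _ _ _ _ _ _ _ _) => /=; first by case: (beta v).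
  by move=> ->; case: (beta v).
exists (fun v => alpha (time_of #|{: option A}| v) (pos_of #|{: option A}| v) (var_symbol v)).
move=> c hc; have [h1 h2 _] := numbering_bounds hc.
have [t [e [a [ht he hlit]]]] := ha _ _ (clause_kind c) h1 h2.
have [h3 h4 h5 h6] := numberingK he (card_enum_index a) ht.
have hv : var_symbol ((t * P + e) * #|{: option A}| + index a (enum {: option A})) = a.
  by rewrite /var_symbol h5 nth_index ?mem_enum.
eexists; first exact: h6.
rewrite /cnf_occ /cnf_pos /cnf_neg h3 h4 hv.
case/orP: hlit => /andP[hl hal]; first by rewrite hl hal.
have -> : pos_literal x T Q (time_of #|W| c) (pos_of #|W| c) (clause_kind c) t e a = false.
  by apply/negP => /literal_sign; rewrite hl.
by rewrite hl (negbTE hal).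
Qed.

End Numbering.

(** Columns and clause types form finite types fixed by the machine, so an index into their
    enumeration is resolved by a fixed case distinction. *)
Lemma def_nth (X : Type) (x0 : X) (s : seq X) (f : X -> ctx -> nat) i :
  (forall a, definable (f a)) -> definable i ->
  definable (fun g => f (nth x0 s (i g)) g).
Proof.
move=> hf; elim: s i => [|a s IH] i hi.
  by apply: definable_eq (hf x0) _ => g; rewrite nth_nil.
apply: definable_eq (def_if (def_eq hi (def_const 0)) (hf a) (IH _ (def_pred hi))) _ => g.
by case: (i g).
Qed.

Lemma def_forall (I : finType) (p : I -> ctx -> bool) :
  (forall i, decidable_by (p i)) -> decidable_by (fun g => [forall i, p i g]).
Proof.
move=> hp.
have h : decidable_by (fun g => all (fun i => p i g) (enum I)).
  by elim: (enum I) => [|i s IH] /=; [exact: (def_const 1) | apply: def_and].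
apply: definable_eq h _ => g; congr nat_of_bool; apply/allP/forallP => h i.
  by apply: h; rewrite mem_enum.
by move=> _; apply: h.
Qed.

(** * Definability of the clauses *)

Section Definability.
Variables (M : tm) (T Q : seq bool * seq bool -> nat).
Hypotheses (hT : definable (fun g => T g.1)) (hQ : definable (fun g => Q g.1)).

Lemma def_word_on_tape (S : finType) (s : cell S) j : definable j ->
  decidable_by (fun g => s == word_on_tape S g.1.1 (j g)).
Proof.
move=> hj.
have h : decidable_by (fun g => match s with
  | None => ~~ (j g < size (word false g))
  | Some (inl b) => (j g < size (word false g)) && (nth false (word false g) (j g) == b)
  | Some (inr _) => false end).
  by case: s => [[b|s]|]; def.
apply: definable_eq h _ => g; congr nat_of_bool; rewrite /word_on_tape /word /= -(odflt_onth false).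
case: ltnP => hl; last first.
  by rewrite onth_default //; case: s => [[b|s]|].
have : onth g.1.1 (j g) by rewrite onthTE.
by case: (onth _ _) => // c _; case: s => [[b|s]|] //=; rewrite eq_sym.
Qed.

Ltac def_user ::=
  match goal with
  | H : definable (fun g => T _) |- definable (fun g => T _) => exact H
  | H : definable (fun g => Q _) |- definable (fun g => Q _) => exact H
  | |- definable (fun g => nat_of_bool (?s == word_on_tape ?S _ (@?j g))) =>
      apply (@def_word_on_tape S s j)
  end.

Lemma def_init_cell (i : tape_index M) o e : definable e ->
  decidable_by (fun g => init_cell g.1.1 (T g.1) (Q g.1) (e g) i o).
Proof.
move=> he; rewrite /init_cell /center; apply: def_ifb; [by def | by def |].
by case: o => [s|]; def.
Qed.

Lemma def_init_column (a : column_type M) e : definable e ->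
  decidable_by (fun g => init_column g.1.1 (T g.1) (Q g.1) a (e g)).
Proof.
move=> he; rewrite /init_column /center.
apply: def_and.
  by apply: (@def_eqb (fun=> a.1.1) (fun g => e g == (T g.1).+1)); [exact: def_constb | def].
apply: def_and; first exact: def_constb.
by apply: def_forall => i; apply: def_init_cell.
Qed.

Lemma def_clause_ok t e (w : clause_type M) : definable t -> definable e ->
  decidable_by (fun g => clause_ok (T g.1) (t g) (e g) w).
Proof.
move=> ht he; rewrite /clause_ok /width /center.
by case: w => [[[[[l z] a] b] d]|[[a b]|[a|]]]; def.
Qed.

Lemma def_pos_literal t e (w : clause_type M) t' e' a' :
  definable t -> definable e -> definable t' -> definable e' ->
  decidable_by (fun g => pos_literal g.1.1 (T g.1) (Q g.1) (t g) (e g) w (t' g) (e' g) a').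
Proof.
move=> ht he ht' he'; rewrite /pos_literal; apply: def_ifb; last by def.
  exact: def_clause_ok.
case: w => [[[[[l z] a] b] d]|[[a b]|[a|]]]; [by def | by def | by def |].
apply: def_and; first by def.
apply: def_and; first by def.
by case: a' => [a|]; [apply: def_init_column | def].
Qed.

Lemma def_neg_literal t e (w : clause_type M) t' e' a' :
  definable t -> definable e -> definable t' -> definable e' ->
  decidable_by (fun g => neg_literal (T g.1) (t g) (e g) w (t' g) (e' g) a').
Proof.
move=> ht he ht' he'; rewrite /neg_literal; apply: def_and; first exact: def_clause_ok.
by rewrite /center; case: w => [[[[[l z] a] b] d]|[[a b]|[a|]]]; def.
Qed.

Lemma def_time_of K i : definable i -> definable (fun g => time_of (T g.1) K (i g)).
Proof. by move=> hi; rewrite /time_of /width /center; def. Qed.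

Lemma def_pos_of K i : definable i -> definable (fun g => pos_of (T g.1) K (i g)).
Proof. by move=> hi; rewrite /pos_of /width /center; def. Qed.

Lemma def_cnf_pos v c : definable v -> definable c ->
  decidable_by (fun g => cnf_pos M g.1.1 (T g.1) (Q g.1) (v g) (c g)).
Proof.
move=> hv hc; rewrite /cnf_pos /clause_kind /var_symbol.
apply: (@def_nth _ _ _ (fun w g => nat_of_bool (pos_literal g.1.1 (T g.1) (Q g.1) _ _ w _ _ _))
  (fun g => c g %% _)); last by def.
move=> w; apply: (@def_nth _ _ _ (fun a g => nat_of_bool (pos_literal g.1.1 (T g.1) (Q g.1)
  (time_of (T g.1) _ (c g)) (pos_of (T g.1) _ (c g)) w
  (time_of (T g.1) _ (v g)) (pos_of (T g.1) _ (v g)) a)) (fun g => v g %% _)); last by def.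
by move=> a; apply: def_pos_literal; first [exact: def_time_of | exact: def_pos_of].
Qed.

Lemma def_cnf_neg v c : definable v -> definable c ->
  decidable_by (fun g => cnf_neg M (T g.1) (v g) (c g)).
Proof.
move=> hv hc; rewrite /cnf_neg /clause_kind /var_symbol.
apply: (@def_nth _ _ _ (fun w g => nat_of_bool (neg_literal (T g.1) _ _ w _ _ _))
  (fun g => c g %% _)); last by def.
move=> w; apply: (@def_nth _ _ _ (fun a g => nat_of_bool (neg_literal (T g.1)
  (time_of (T g.1) _ (c g)) (pos_of (T g.1) _ (c g)) w
  (time_of (T g.1) _ (v g)) (pos_of (T g.1) _ (v g)) a)) (fun g => v g %% _)); last by def.
by move=> a; apply: def_neg_literal; first [exact: def_time_of | exact: def_pos_of].
Qed.

Lemma def_num K : definable (fun g => (T g.1).+1 * width (T g.1) * K).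
Proof. by rewrite /width /center; def. Qed.

End Definability.

Lemma horner_nat_mono (p : {poly nat}) a b : a <= b -> p.[a]%R <= p.[b]%R.
Proof.
move=> hab; rewrite /horner; elim: (polyseq p) => //= c s IH.
by rewrite leq_add2r leq_mul.
Qed.

Theorem D_MAX_NP_hard : NP_hard D_MAX_01_TMBD3B_1.
Proof.
move=> B [M [p [q [hhalt hB]]]].
pose Q (w : seq bool * seq bool) := q.[size w.1]%R.
(* The first summand bounds the running time on all admissible certificates; the second makes room
   for them in the tableau. *)
pose T (w : seq bool * seq bool) := p.[(size w.1 + Q w)%N]%R + Q w.
have hn : definable (fun g => size g.1.1) := def_size false.
have hQ : definable (fun g => Q g.1) by apply: def_poly.
have hT : definable (fun g => T g.1).
  by apply: (def_add _ hQ); apply: def_poly; apply: def_add.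
pose V w := num_vars M (T w); pose C w := num_clauses M (T w).
pose occ w := cnf_occ M w.1 (T w) (Q w); pose sgn w := cnf_pos M w.1 (T w) (Q w).
have hV : definable (fun g => V g.1) := def_num hT _.
have hC : definable (fun g => C g.1) := def_num hT _.
have hocc v c : definable v -> definable c -> decidable_by (fun g => occ g.1 (v g) (c g)).
  move=> hv hc; apply: def_or; [exact: def_cnf_pos | exact: def_cnf_neg].
have hsgn v c : definable v -> definable c -> decidable_by (fun g => sgn g.1 (v g) (c g)).
  by move=> hv hc; apply: def_cnf_pos.
have hw := wdef_code_gadget hV hC hocc hsgn.
eexists; split; first exact: wdefinable_poly_time hw.
move=> x /=; set w := (x, [::]).
have C1 : 1 < C w.
  have := width_gt1 (T w); have : 0 < #|clause_type M| by apply/card_gt0P; exists (inr (inr None)).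
  rewrite /C /num_clauses => h1 h2; rewrite -mulnA mulSn.
  apply: leq_trans (leq_addr _ _); exact: leq_trans (leq_pmulr _ h1).
have V0 : 0 < V w.
  rewrite /V /num_vars !muln_gt0 /=.
  by apply/card_gt0P; exists None.
rewrite (gadget_correct _ _ V0 C1) cnf_satP hB.
(* A halted machine stays put, so a single time bound serves certificates of all lengths. *)
have hacc y : size y <= Q w ->
    accepts_in M p.[(size x + size y)%N]%R x y <-> accepts_in M (T w) x y.
  move=> hy; have hle : p.[(size x + size y)%N]%R <= T w.
    by apply: leq_trans (leq_addr _ _); apply: horner_nat_mono; rewrite leq_add2l.
  have hh := hhalt x y.
  by rewrite /accepts_in /halts_in (halted_run hh hle).
split=> [[y hy hacy]|[alpha hal]].
  by eexists; apply: (tableau_complete hy); apply/(hacc y hy).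
have [y hy hy2] := tableau_sound hal (leq_addl _ _).
by exists y => //; apply/(hacc y hy).
Qed.

Theorem theorem4 : NP_complete D_MAX_01_TMBD3B_1.
Proof. by split; [exact: D_MAX_in_NP | exact: D_MAX_NP_hard]. Qed.
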